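(* For each $n$ let $\{U_i\}$ be an $\varepsilon$-approximate unitary $2$-design on $n$ qubits, where $\varepsilon=2^{-\log^{\omega(1)}n}$. Then $\{U_i\}$ is a pseudorandom unitary ensemble (PRU) against the subclass of $\mathsf{AC}^0\circ\mathsf{QNC}^0$ oracle circuits on a multiple of $n$ qubits in which the unitary is applied non-adaptively over all the qubits used by the circuit, and the pre-processing $\mathsf{QNC}^0$ circuit before applying the unitary is $1$-dimensional geometrically local. That is: for every $t=\mathrm{poly}(n)$ and every (family of) oracle circuit(s) $G^U=F\circ\left(C_2\cdot U^{\otimes t}\cdot C_1\right)$ on $tn$ qubits on a line (no further qubits are used), where the $t$ copies of $U$ act on the $t$ consecutive blocks of $n$ qubits, $C_1$ is a $1$-dimensional geometrically local $\mathsf{QNC}^0$ circuit, $C_2$ is a $\mathsf{QNC}^0$ circuit, all qubits are then measured in the computational basis, and $F\in\mathsf{AC}^0$ with a single output bit is applied to the outcomes, $$\left|\mathbb{E}_i\left[G^{U_i}(|0^{tn}\rangle\langle0^{tn}|)\right]-\mathbb{E}\left[G^{U_{\mathsf{Haar}}}(|0^{tn}\rangle\langle 0^{tn}|)\right]\right|_1=\mathrm{negl}(n).$$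
   Context: All objects are families indexed by $n$; $\mathrm{poly}(n)=n^{O(1)}$, $\mathrm{negl}(n)=n^{-\omega(1)}$; logarithms are base 2. $\varepsilon=2^{-\log^{\omega(1)}n}$ means $\varepsilon(n)\le2^{-(\log n)^{g(n)}}$ for some $g(n)\to\infty$. A unitary ensemble $\mathcal D=\{U_i\}$ is a discrete probability distribution over $n$-qubit unitaries, $\mathbb{E}_i$ is expectation over it, and $U_{\mathsf{Haar}}$ is an $n$-qubit Haar random unitary. With $\Phi^{(2)}_{\mathcal D}(\rho)=\mathbb{E}_i[U_i^{\otimes 2}\rho(U_i^\dagger)^{\otimes 2}]$ and $\Phi^{(2)}_{\mathsf{Haar}}(\rho)=\mathbb{E}[U_{\mathsf{Haar}}^{\otimes 2}\rho(U_{\mathsf{Haar}}^\dagger)^{\otimes 2}]$, $\mathcal D$ is an $\varepsilon$-approximate unitary $2$-design if $\|\Phi^{(2)}_{\mathcal D}(\rho)-\Phi^{(2)}_{\mathsf{Haar}}(\rho)\|_1\le\varepsilon$ for all operators $\rho$ with $\|\rho\|_1\le1$ (trace norm). $\mathsf{QNC}^0$: polynomial-size, constant-depth quantum circuits whose gates act on at most $2$ qubits; $1$-dimensional geometrically local means every two-qubit gate acts on two adjacent qubits of the line. $\mathsf{AC}^0$: polynomial-size, constant-depth classical circuits with unbounded fan-in AND/OR gates and NOT gates. $G^U(\rho)$ denotes the output distribution on initial state $\rho$ (expectations are mixtures), and $|\cdot|_1$ is total variation distance. *)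

(* Defs.v *)
From HB Require Import structures.
From mathcomp Require Import all_boot all_order all_algebra.
From mathcomp Require Import spectral sesquilinear.
From mathcomp Require Import all_classical all_reals all_analysis.
From mathcomp.real_closed Require Import complex mxtens.

Set Implicit Arguments.
Unset Strict Implicit.
Unset Printing Implicit Defensive.

Import Order.TTheory GRing.Theory Num.Theory.
Import numFieldNormedType.Exports.

Local Open Scope classical_set_scope.
Local Open Scope ring_scope.
Local Open Scope complex_scope.
Local Open Scope sesquilinear_scope.

(* The growth conditions only concern large n. *)

(* f n = n^(O(1)) *)
Definition poly_bounded (f : nat -> nat) : Prop :=
  exists c : nat, \forall n \near \oo, (f n <= n ^ c)%N.

(* f n = n^(-omega(1)) *)
Definition negligible_fun (R : realType) (f : nat -> R) : Prop :=
  exists2 h : nat -> R, h @ \oo --> +oo &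
    \forall n \near \oo, `|f n| <= n%:R `^ (- h n).

Definition log2 (R : realType) (x : R) : R := ln x / ln 2.

(* eps n = 2^(-(log n)^(omega(1))) *)
Definition inv_superquasipoly (R : realType) (eps : nat -> R) : Prop :=
  exists2 g : nat -> R, g @ \oo --> +oo &
    \forall n \near \oo, eps n <= 2 `^ (- (log2 n%:R `^ g n)).

(* Measurable sets are generated by the real and imaginary parts of the
   entries: this is the Borel sigma-algebra of C^(d x d). *)
Definition entry_cylinders (R : realType) (d : nat) : set (set 'M[R[i]]_d) :=
  [set A | exists i j (B : set R), measurable B /\
    (A = (fun M : 'M[R[i]]_d => complex.Re (M i j)) @^-1` B \/
     A = (fun M : 'M[R[i]]_d => complex.Im (M i j)) @^-1` B)].

HB.instance Definition _ (R : realType) := isPointed.Build R[i] 0.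

Notation borel_mx R d := (g_sigma_algebraType (@entry_cylinders R d)).

(* The Haar probability measure of the unitary group, seen as a measure on all
   d x d matrices that is carried by the unitary ones. *)
Definition is_haar (R : realType) (d : nat)
    (mu : probability (borel_mx R d) R) : Prop :=
  [/\ mu [set V : 'M[R[i]]_d | V \is unitarymx] = 1%E,
      forall V : 'M[R[i]]_d, V \is unitarymx ->
        forall A : set (borel_mx R d), measurable A ->
          mu ((fun W : 'M[R[i]]_d => V *m W) @^-1` A) = mu A
    & forall V : 'M[R[i]]_d, V \is unitarymx ->
        forall A : set (borel_mx R d), measurable A ->
          mu ((fun W : 'M[R[i]]_d => W *m V) @^-1` A) = mu A].

(* The sum of the singular values of A, which are the square roots of the
   (real, nonnegative) eigenvalues of A^t* *m A. *)
Definition trace_norm (R : realType) (d : nat) (A : 'M[R[i]]_d) : R :=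
  \sum_(i < d) Num.sqrt (complex.Re (spectral_diag (A ^t* *m A) 0 i)).

Definition expect_mx (R : realType) dsp (T : measurableType dsp)
    (P : probability T R) (d : nat) (X : T -> 'M[R[i]]_d) : 'M[R[i]]_d :=
  \matrix_(i, j) ((\int[P]_w complex.Re (X w i j))%R
                  +i* (\int[P]_w complex.Im (X w i j))%R).

Definition twirl2 (R : realType) dsp (T : measurableType dsp)
    (P : probability T R) (d : nat) (U : T -> 'M[R[i]]_d)
    (rho : 'M[R[i]]_(d * d)) : 'M[R[i]]_(d * d) :=
  expect_mx P (fun w => (U w *t U w) *m rho *m (U w *t U w) ^t*).

(* A discrete ensemble {U_k} is indexed by nat: U_k is drawn with probability
   P [set k], which may be zero. *)
Definition approx_2design (R : realType) (d : nat) (eps : R)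
    (P : probability nat R) (U : nat -> 'M[R[i]]_d)
    (haar : probability (borel_mx R d) R) : Prop :=
  forall rho : 'M[R[i]]_(d * d), trace_norm rho <= 1 ->
    trace_norm (twirl2 P U rho - twirl2 haar id rho) <= eps.

(* The basis states of N qubits are indexed by 'I_(2 ^ N), qubit 0 being the
   most significant bit, in agreement with the Kronecker product [*t]. *)
Definition qbit (N : nat) (x : 'I_(2 ^ N)) (i : 'I_N) : bool :=
  odd (x %/ 2 ^ (N - i.+1)).

Lemma of_qbits_subproof (k : nat) (b : 'I_k -> bool) :
  (\sum_(j < k) b j * 2 ^ (k - j.+1) < 2 ^ k)%N.
Proof.
elim: k b => [|k IHk] b; first by rewrite big_ord0.
rewrite big_ord_recl subSS subn0 expnS mul2n -addnn -addnS.
apply: leq_add; first by case: (b ord0); rewrite ?mul1n ?mul0n.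
exact: IHk (fun j => b (lift ord0 j)).
Qed.

Definition of_qbits (k : nat) (b : 'I_k -> bool) : 'I_(2 ^ k) :=
  Ordinal (of_qbits_subproof b).

Record gate (R : realType) (N : nat) := Gate {
  arity : nat;
  wires : arity.-tuple 'I_N;
  gate_unitary : 'M[R[i]]_(2 ^ arity) }.

Definition gate_wf (R : realType) (N : nat) (g : gate R N) : bool :=
  [&& (0 < arity g <= 2)%N, uniq (wires g) & gate_unitary g \is unitarymx].

(* The operator of a gate on the whole register, acting as the identity on the
   other qubits. *)
Definition gate_mx (R : realType) (N : nat) (g : gate R N) : 'M[R[i]]_(2 ^ N) :=
  let sub (x : 'I_(2 ^ N)) := of_qbits (fun j => qbit x (tnth (wires g) j)) in
  \matrix_(x, y)
    if [forall c, (c \notin tval (wires g)) ==> (qbit x c == qbit y c)]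
    then gate_unitary g (sub x) (sub y) else 0.

(* The gates of a layer act in parallel, on pairwise disjoint sets of qubits;
   the depth of a circuit is its number of layers. The head of the list is
   applied first. *)
Definition qlayer (R : realType) (N : nat) := seq (gate R N).
Definition qcircuit (R : realType) (N : nat) := seq (qlayer R N).

Definition qlayer_wf (R : realType) (N : nat) (L : qlayer R N) : bool :=
  all (@gate_wf R N) L && uniq (flatten [seq tval (wires g) | g <- L]).

Definition qlayer_mx (R : realType) (N : nat) (L : qlayer R N)
    : 'M[R[i]]_(2 ^ N) :=
  foldl (fun M g => gate_mx g *m M) 1%:M L.

Definition qcircuit_mx (R : realType) (N : nat) (C : qcircuit R N)
    : 'M[R[i]]_(2 ^ N) :=
  foldl (fun M L => qlayer_mx L *m M) 1%:M C.

Definition is_QNC0 (R : realType) (N : nat -> nat)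
    (C : forall n, qcircuit R (N n)) : Prop :=
  [/\ forall n, all (@qlayer_wf R (N n)) (C n),
      exists depth : nat, forall n, (size (C n) <= depth)%N
    & poly_bounded (fun n => size (flatten (C n)))].

Definition geom_local_1d (R : realType) (N : nat) (C : qcircuit R N) : bool :=
  all (fun g => all (fun a : 'I_N => all (fun b : 'I_N => a <= b.+1)%N
                                         (wires g)) (wires g)) (flatten C).

(* Wires are numbered by nat, the inputs first and then the gates, layer after
   layer. A gate reads wires of strictly earlier layers; a number that is not
   (yet) that of a wire denotes the constant false. *)
Inductive cgate := CAnd of seq nat | COr of seq nat | CNot of nat.

Definition cgate_eval (v : seq bool) (g : cgate) : bool :=
  match g with
  | CAnd s => all (nth false v) s
  | COr s => has (nth false v) s
  | CNot i => ~~ nth false v i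
  end.

Record ccircuit := CCircuit {
  clayers : seq (seq cgate);
  coutput : nat }.

Definition ccircuit_eval (F : ccircuit) (input : seq bool) : bool :=
  nth false
    (foldl (fun v L => v ++ [seq cgate_eval v g | g <- L]) input (clayers F))
    (coutput F).

Definition is_AC0 (F : nat -> ccircuit) : Prop :=
  (exists depth : nat, forall n, (size (clayers (F n)) <= depth)%N) /\
  poly_bounded (fun n => size (flatten (clayers (F n)))).

(* U^(tensor t), block j of n qubits being the qubits j * n, ..., j * n + n - 1
   of the n * t qubits. *)
Definition oracle_mx (R : realType) (n t : nat) (U : 'M[R[i]]_(2 ^ n))
    : 'M[R[i]]_(2 ^ (n * t)) :=
  castmx (esym (expnM 2 n t), esym (expnM 2 n t)) (ntensmx U t).

Definition zero_state (R : realType) (N : nat) : 'M[R[i]]_(2 ^ N) :=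
  let x0 := of_qbits (fun _ : 'I_N => false) in delta_mx x0 x0.

(* The output distribution of F o (C2 . U^(tensor t) . C1) on the initial state
   rho, all qubits being measured in the computational basis before F. *)
Definition output_dist (R : realType) (n t : nat)
    (C1 C2 : qcircuit R (n * t)) (F : ccircuit) (U : 'M[R[i]]_(2 ^ n))
    (rho : 'M[R[i]]_(2 ^ (n * t))) (b : bool) : R :=
  let W := qcircuit_mx C2 *m oracle_mx t U *m qcircuit_mx C1 in
  \sum_(x : 'I_(2 ^ (n * t)) |
          ccircuit_eval F [seq qbit x i | i <- enum 'I_(n * t)] == b)
    complex.Re ((W *m rho *m W ^t*) x x).

Definition mean_output_dist (R : realType) dsp (T : measurableType dsp)
    (P : probability T R) (n t : nat) (U : T -> 'M[R[i]]_(2 ^ n))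
    (C1 C2 : qcircuit R (n * t)) (F : ccircuit)
    (rho : 'M[R[i]]_(2 ^ (n * t))) (b : bool) : R :=
  (\int[P]_w output_dist C1 C2 F (U w) rho b)%R.

Definition tv_dist (R : realType) (p q : bool -> R) : R :=
  2^-1 * \sum_(b : bool) `|p b - q b|.

(* Main.v *)
Require Import Defs.
From mathcomp Require Import all_boot all_order all_algebra all_fingroup.
From mathcomp Require Import spectral sesquilinear.
From mathcomp Require Import all_classical all_reals all_analysis.
From mathcomp.real_closed Require Import complex mxtens.
From mathcomp Require Import ring lra zify measurable_realfun.
Set Implicit Arguments.
Unset Strict Implicit.
Unset Printing Implicit Defensive.
Import Order.TTheory GRing.Theory Num.Theory.
Local Open Scope ring_scope.
Local Open Scope sesquilinear_scope.

(* Each block of C1 interacts with the other blocks only through the boundedly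
   many gates that cross its two ends, because C1 is local in one dimension. In
   the Heisenberg picture, a parity of w output bits becomes an observable on
   O(w) qubits before C2; expand it in Pauli operators, and for each of them
   split U^(tensor t) and C1 along one block on which it is not the identity. The
   bias of the parity is thus at most 2^O(w) times a bound on quantities
   |<0| X^* U^* Q U Y |0>|, where X, Q, Y are fixed unitaries and Q is traceless.
   Their second moment is a second moment of U, hence within eps of its Haar
   value O(2^-n). So all parities of polylogarithmically many output bits have
   quasipolynomially small bias, and by Braverman's theorem AC0 distinguishes
   neither output distribution from uniform bits. Braverman's theorem is obtained
   from the Linial-Mansour-Nisan tail bound, through the switching lemma, and from
   Razborov-Smolensky approximation. *)

(** * Fourier analysis on the cube *)

(** The t copies of U are one and the same matrix, so averaging a parity directly would call for a
    t-design. Two copies suffice because a bound is taken before averaging: after the split along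
    one block, each term is a product of a matrix entry on that block and a matrix entry on all the
    others, and the latter has modulus at most 1 for every unitary U, however it depends on U. Only
    the block entry is averaged, and AM-GM passes from its modulus to its square. The price is the
    l1 weight of the expansions. For C1 it is bounded, since at most two gates per layer cross the
    ends of a block; without locality, the number of crossing gates could grow with n. For the light
    cone of w bits it is 2^O(w). With w polylogarithmic in n of a degree fixed by the depth of F,
    the product is still beaten by eps, whose exponent outgrows every fixed power of log n. The
    parities are nearly but not exactly unbiased, so the polynomials in Braverman's argument need a
    small l1 norm of coefficients besides a low degree. Both are tracked together from the start. *)

Notation cube I := {ffun I -> bool}.

Definition wt (I : finType) (S : cube I) : nat := (\sum_i S i)%N.

(** Addition on [bool] is exclusive or, so sets S and points x are elements of one group F_2^I, and
    the characters are symmetric in the two. *)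
Definition chi (K : comPzRingType) (I : finType) (S x : cube I) : K :=
  \prod_i (-1) ^+ (S i && x i).

Definition avg (K : fieldType) (I : finType) (f : cube I -> K) : K :=
  #|cube I|%:R^-1 * \sum_x f x.

Definition fourier (K : fieldType) (I : finType) (f : cube I -> K) (S : cube I) : K :=
  avg (fun x => f x * chi K S x).

Section Cube.
Variable I : finType.
Implicit Types S T x y z : cube I.

Lemma cubeDE x y i : (x + y) i = x i (+) y i.
Proof. by rewrite ffunE. Qed.

Lemma cube0E i : (0 : cube I) i = false.
Proof. by rewrite ffunE. Qed.

Lemma cubeDD x y : x + y + y = x.
Proof. by apply/ffunP => i; rewrite !ffunE -[LHS]/(_ (+) _ (+) _) addbK. Qed.

Lemma cubeDx x : x + x = 0.
Proof. by apply/ffunP => i; rewrite !ffunE -[LHS]/(_ (+) _) addbb. Qed.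

Lemma cube_neq0 x : x != 0 -> exists i, x i.
Proof.
move=> xN0; apply/existsP; apply: contraNT xN0 => /existsPn xF.
by apply/eqP/ffunP => i; rewrite cube0E; apply/negbTE.
Qed.

Lemma wt_gt0 S : (0 < wt S)%N = (S != 0).
Proof.
rewrite /wt lt0n sum_nat_eq0; congr (~~ _); apply/forall_inP/eqP => [S0 | -> i _].
  by apply/ffunP => i; rewrite cube0E; have := S0 i isT; case: (S i).
by rewrite cube0E.
Qed.

Lemma wtD_le S T : (wt (S + T)%R <= wt S + wt T)%N.
Proof.
rewrite /wt -big_split /=; apply: leq_sum => i _.
by rewrite cubeDE; case: (S i); case: (T i).
Qed.

Lemma wt0 : wt (0 : cube I) = 0%N.
Proof. by apply/eqP; rewrite -leqn0 leqNgt wt_gt0 eqxx. Qed.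

Lemma card_cube : #|cube I| = (2 ^ #|I|)%N.
Proof. by rewrite card_ffun card_bool. Qed.

Section Characters.
Variable K : comPzRingType.

Lemma chiC S x : chi K S x = chi K x S.
Proof. by apply: eq_bigr => i _; rewrite andbC. Qed.

Lemma chiDr S x y : chi K S (x + y) = chi K S x * chi K S y.
Proof.
rewrite /chi -big_split /=; apply: eq_bigr => i _; rewrite cubeDE.
by case: (S i); rewrite ?expr0 ?mulr1 //= signr_addb.
Qed.

Lemma chiDl S T x : chi K (S + T) x = chi K S x * chi K T x.
Proof. by rewrite chiC chiDr !(chiC x). Qed.

Lemma chi0l x : chi K 0 x = 1.
Proof. by rewrite /chi big1 // => i _; rewrite cube0E. Qed.

Lemma chi0r x : chi K x 0 = 1.
Proof. by rewrite chiC chi0l. Qed.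

Lemma chi_sqr S x : chi K S x * chi K S x = 1.
Proof. by rewrite -chiDr cubeDx chi0r. Qed.

Lemma chi_sign S x : chi K S x = 1 \/ chi K S x = -1.
Proof.
rewrite /chi; elim/big_rec: _ => [|i y _ [] ->]; first by left.
  by case: (_ && _); [right|left]; rewrite mulr1 ?expr1 ?expr0.
by case: (_ && _); [left|right]; rewrite ?expr1 ?mulN1r ?opprK ?expr0 ?mul1r.
Qed.

Lemma chi_sum z : \sum_S chi K S z = #|cube I|%:R * (z == 0)%:R.
Proof.
rewrite /chi -(bigA_distr_bigA (fun i (b : bool) => (-1) ^+ (b && z i) : K)) /=.
under eq_bigr do rewrite big_bool /= expr0.
have [->|/cube_neq0[i zi]] := eqVneq z 0.
  under eq_bigr do rewrite cube0E expr0.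
  by rewrite prodr_const card_cube natrX mulr1.
by rewrite (bigD1 i) //= zi expr1 addNr !mul0r mulr0.
Qed.

End Characters.

Lemma chi_norm (K : numDomainType) S x : `|chi K S x| = 1.
Proof. by case: (chi_sign K S x) => ->; rewrite ?normrN normr1. Qed.

Section FourierInversion.
Variable K : numFieldType.
Implicit Type f : cube I -> K.

Lemma card_cube_neq0 : (#|cube I|%:R : K) != 0.
Proof. by rewrite pnatr_eq0 card_cube -lt0n expn_gt0. Qed.

Lemma chi_ortho S T : avg (fun x => chi K S x * chi K T x) = (S == T)%:R.
Proof.
rewrite /avg; under eq_bigr do rewrite -chiDl chiC.
rewrite chi_sum mulrA mulVf ?card_cube_neq0 // mul1r (_ : (_ == 0) = (S == T)) //.
apply/eqP/eqP => [/(congr1 (fun x => x + T))|->]; last exact: cubeDx.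
by rewrite cubeDD add0r.
Qed.

Lemma avg_sum (J : Type) (r : seq J) (P : pred J) (F : J -> cube I -> K) :
  avg (fun x => \sum_(j <- r | P j) F j x) = \sum_(j <- r | P j) avg (F j).
Proof. by rewrite /avg exchange_big mulr_sumr. Qed.

Lemma avgZ c f : avg (fun x => c * f x) = c * avg f.
Proof. by rewrite /avg -mulr_sumr mulrCA. Qed.

Lemma eq_avg f g : f =1 g -> avg f = avg g.
Proof. by move=> fg; rewrite /avg; under eq_bigr do rewrite fg. Qed.

Lemma fourier_inversion f x : f x = \sum_S fourier f S * chi K S x.
Proof.
transitivity (avg (fun y => f y * \sum_S chi K S (y + x))); last first.
  rewrite (eq_avg (g := fun y => \sum_S chi K S x * (f y * chi K S y))) => [|y].
    by rewrite avg_sum; apply: eq_bigr => S _; rewrite avgZ mulrC.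
  by rewrite mulr_sumr; apply: eq_bigr => S _; rewrite chiDr mulrA mulrC.
rewrite /avg (bigD1 x) //= cubeDx chi_sum eqxx mulr1 big1 ?addr0 => [|y yx].
  by rewrite mulrCA mulVf ?mulr1 ?card_cube_neq0.
rewrite chi_sum (_ : (y + x == 0) = false) ?mulr0 //.
apply: contraNF yx => /eqP/(congr1 (fun z => z + x)).
by rewrite cubeDD add0r => ->.
Qed.

Lemma fourier_unique (c : cube I -> K) f :
  (forall x, f x = \sum_S c S * chi K S x) -> fourier f =1 c.
Proof.
move=> fE S; rewrite /fourier (eq_avg (g := fun x => \sum_T c T * (chi K T x * chi K S x))).
  rewrite avg_sum (bigD1 S) //= avgZ chi_ortho eqxx mulr1 big1 ?addr0 // => T TS.
  by rewrite avgZ chi_ortho (negbTE TS) mulr0.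
by move=> x; rewrite fE mulr_suml; under eq_bigr do rewrite -mulrA.
Qed.

Lemma fourier0 f : fourier f 0 = avg f.
Proof. by apply: eq_avg => x; rewrite chi0l mulr1. Qed.

Lemma parseval f g : avg (fun x => f x * g x) = \sum_S fourier f S * fourier g S.
Proof.
rewrite (eq_avg (g := fun x => \sum_S fourier f S * (g x * chi K S x))) => [|x].
  by rewrite avg_sum; apply: eq_bigr => S _; rewrite avgZ.
rewrite {1}(fourier_inversion f) mulr_suml; apply: eq_bigr => S _.
by rewrite -mulrA [chi K S x * _]mulrC.
Qed.

Lemma avg1 : avg (fun _ : cube I => 1 : K) = 1.
Proof. by rewrite /avg sumr_const -[_ *+ _]mulr_natr mul1r mulVf ?card_cube_neq0. Qed.

Lemma avgD f g : avg (fun x => f x + g x) = avg f + avg g.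
Proof. by rewrite /avg big_split mulrDr. Qed.

End FourierInversion.

Lemma avg_le (K : numFieldType) (f g : cube I -> K) :
  (forall x, f x <= g x) -> avg f <= avg g.
Proof. by move=> fg; rewrite /avg ler_wpM2l ?invr_ge0 ?ler0n // ler_sum. Qed.

Section LowDegree.
Variable R : realFieldType.
Implicit Types f g : cube I -> R.

(** A multilinear polynomial in the signs: k bounds its degree and M the l1 norm of its
    coefficients. A distribution whose parities have bias at most Delta changes the mean of such a
    polynomial by at most Delta * M. *)
Definition lowdeg k M f := exists c : cube I -> R,
  [/\ forall x, f x = \sum_S c S * chi R S x,
      forall S, (k < wt S)%N -> c S = 0
    & \sum_S `|c S| <= M].

Lemma lowdeg_ext k M f g : f =1 g -> lowdeg k M f -> lowdeg k M g.
Proof. by move=> fg [c [cE ck cM]]; exists c; split=> // x; rewrite -fg. Qed.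

Lemma lowdegW k k' M M' f : (k <= k')%N -> M <= M' -> lowdeg k M f -> lowdeg k' M' f.
Proof.
move=> kk' MM' [c [cE ck cM]]; exists c; split=> // [S kS|].
  by apply: ck; apply: leq_ltn_trans kS.
exact: le_trans MM'.
Qed.

Lemma lowdeg_chi T M c : `|c| <= M -> lowdeg (wt T) M (fun x => c * chi R T x).
Proof.
move=> cM; exists (fun S => if S == T then c else 0); split.
- move=> x; rewrite (bigD1 T) //= eqxx big1 ?addr0 // => S /negbTE ->.
  by rewrite mul0r.
- by move=> S TS; case: eqP TS => // ->; rewrite ltnn.
- rewrite (bigD1 T) //= eqxx big1 ?addr0 // => S /negbTE ->.
  by rewrite normr0.
Qed.

Lemma lowdeg_cst k M c : `|c| <= M -> lowdeg k M (fun=> c).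
Proof.
move=> cM; apply: (lowdegW (k := 0) (M := M)) => //; rewrite -wt0.
by apply: lowdeg_ext (lowdeg_chi 0 cM) => x; rewrite chi0l mulr1.
Qed.

Lemma lowdegD k M M' f g : lowdeg k M f -> lowdeg k M' g ->
  lowdeg k (M + M') (fun x => f x + g x).
Proof.
move=> [c [cE ck cM]] [c' [cE' ck' cM']]; exists (fun S => c S + c' S); split.
- by move=> x; rewrite cE cE' -big_split; apply: eq_bigr => S _; rewrite mulrDl.
- by move=> S kS; rewrite ck // ck' // addr0.
- apply: le_trans (lerD cM cM'); rewrite -big_split.
  by apply: ler_sum => S _; apply: ler_normD.
Qed.

Lemma lowdeg_ge0 k M f : lowdeg k M f -> 0 <= M.
Proof. by move=> [c [_ _ cM]]; apply: le_trans cM; apply: sumr_ge0. Qed.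

Lemma lowdeg_norm k M f x : lowdeg k M f -> `|f x| <= M.
Proof.
move=> [c [-> _ cM]]; apply: le_trans (ler_norm_sum _ _ _) _.
by apply: le_trans cM; apply: ler_sum => S _; rewrite normrM chi_norm mulr1.
Qed.

(** Multiplication convolves the coefficients over F_2^I: degrees add and the l1 norm is
    submultiplicative. *)
Lemma lowdegM k k' M M' f g : lowdeg k M f -> lowdeg k' M' g ->
  lowdeg (k + k') (M * M') (fun x => f x * g x).
Proof.
move=> fl gl; have M0 := lowdeg_ge0 fl.
case: fl gl => [c [cE ck cM]] [c' [cE' ck' cM']].
exists (fun S => \sum_T c T * c' (T + S)); split.
- move=> x; rewrite cE cE' mulr_suml.
  under [RHS]eq_bigr do rewrite mulr_suml.
  rewrite [RHS]exchange_big /=; apply: eq_bigr => S _.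
  rewrite [RHS](reindex_inj (addrI S)) /= mulr_sumr; apply: eq_bigr => T _.
  have -> : S + (S + T) = T by rewrite addrA cubeDx add0r.
  by rewrite chiDl mulrACA.
- move=> S kS; rewrite big1 // => T _.
  have [kT|kT] := ltnP k (wt T); first by rewrite ck // mul0r.
  rewrite ck' ?mulr0 // -(ltn_add2l k); apply: leq_trans kS _.
  have -> : S = T + (T + S) by rewrite addrA cubeDx add0r.
  by apply: leq_trans (wtD_le _ _) _; rewrite addrA cubeDx add0r leq_add2r.
- apply: le_trans (_ : \sum_S \sum_T `|c T| * `|c' (T + S)| <= _).
    apply: ler_sum => S _; apply: le_trans (ler_norm_sum _ _ _) _.
    by apply: ler_sum => T _; rewrite normrM.
  rewrite exchange_big /=.
  under eq_bigr => T _ do rewrite -mulr_sumr (reindex_inj (addrI T)) /=.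
  under eq_bigr => T _ do under eq_bigr => S _ do rewrite addrA cubeDx add0r.
  by rewrite -mulr_suml ler_pM ?sumr_ge0.
Qed.

Lemma lowdegB k M M' f g : lowdeg k M f -> lowdeg k M' g ->
  lowdeg k (M + M') (fun x => f x - g x).
Proof.
move=> fl gl; apply: lowdegD => //; have := lowdegM (lowdeg_cst 0 (lexx `|-1|)) gl.
rewrite add0n normrN normr1 mul1r; apply: lowdeg_ext => x; exact: mulN1r.
Qed.

Lemma lowdeg_sum k M (n : nat) (F : 'I_n -> cube I -> R) (P : pred 'I_n) :
  0 <= M -> (forall j, lowdeg k M (F j)) ->
  lowdeg k (n%:R * M) (fun x => \sum_(j | P j) F j x).
Proof.
move=> M0 Fl; elim: n => [|n IHn] in F P Fl *.
  by apply: lowdeg_ext (lowdeg_cst k (M := 0%:R * M) (c := 0) _) => [x|];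
    rewrite ?big_ord0 ?normr0 ?mul0r.
apply: (lowdeg_ext (f := fun x => (if P ord0 then F ord0 x else 0)
   + \sum_(j < n | P (lift ord0 j)) F (lift ord0 j) x)) => [x|].
  by rewrite [RHS]big_mkcond big_ord_recl -big_mkcond.
have -> : n.+1%:R * M = M + n%:R * M by rewrite -add1n natrD mulrDl mul1r.
apply: lowdegD; last exact: IHn.
by case: (P ord0) => //; apply: lowdeg_cst; rewrite normr0.
Qed.

Lemma lowdeg_prod k M (n : nat) (F : 'I_n -> cube I -> R) :
  (forall j, lowdeg k M (F j)) ->
  lowdeg (n * k) (M ^+ n) (fun x => \prod_j F j x).
Proof.
move=> Fl; elim: n => [|n IHn] in F Fl *.
  by apply: lowdeg_ext (lowdeg_cst _ (M := M ^+ 0) (c := 1) _) => [x|];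
    rewrite ?big_ord0 ?normr1.
apply: (lowdeg_ext (f := fun x => F ord0 x * \prod_(j < n) F (lift ord0 j) x)) => [x|].
  by rewrite [RHS]big_ord_recl.
by rewrite mulSn exprS; apply: lowdegM => //; apply: IHn.
Qed.

Lemma lowdeg_var i : lowdeg 1 1 (fun x => (x i)%:R).
Proof.
pose e : cube I := [ffun j => j == i].
have chie x : chi R e x = 1 - 2 * (x i)%:R.
  rewrite /chi (bigD1 i) //= ffunE eqxx big1 ?mulr1 => [|j /negbTE ji].
    by case: (x i); rewrite /= ?expr0 ?expr1; ring.
  by rewrite ffunE ji.
have we : wt e = 1%N.
  rewrite /wt (bigD1 i) //= ffunE eqxx big1 // => j /negbTE ji.
  by rewrite ffunE ji.
have h : `|2^-1 : R| <= 2^-1 by rewrite ger0_norm ?invr_ge0.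
have hN : `|- 2^-1 : R| <= 2^-1 by rewrite normrN.
have := lowdegD (lowdeg_cst _ h) (lowdeg_chi e hN); rewrite we.
have -> : (2^-1 + 2^-1 : R) = 1 by field.
by apply: lowdeg_ext => x; rewrite chie; field.
Qed.

Lemma lowdeg_fourier k M f : lowdeg k M f ->
  [/\ forall S, (k < wt S)%N -> fourier f S = 0 & \sum_S `|fourier f S| <= M].
Proof.
move=> [c [cE ck cM]]; have fc := fourier_unique cE.
by split=> [S kS|]; [rewrite fc ck|under eq_bigr do rewrite fc].
Qed.

End LowDegree.
End Cube.

(** * Restrictions, decision trees and bounded-depth circuits *)

(** One type for three objects: a restriction ([None] is a free variable), a conjunction of
    literals, and the answers along a path of a decision tree. *)
Notation pcube I := {ffun I -> option bool}.

Section Restrictions.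
Variable I : finType.
Implicit Types (x : cube I) (r s t C : pcube I) (f g : cube I -> bool).

Definition app r x : cube I := [ffun i => odflt (x i) (r i)].

(* The assignments of t take precedence. *)
Definition over r t : pcube I := [ffun i => if t i is Some b then Some b else r i].

Definition psize t : nat := (\sum_i (t i != None))%N.

Definition pnil : pcube I := [ffun=> None].

Definition psingle i b : pcube I := [ffun j => if j == i then Some b else None].

Definition samedom r t := [forall i, (r i == None) == (t i == None)].

Definition psub C r := [forall i, (C i != None) ==> (r i == C i)].

Definition pfalse C r := [exists i, [&& C i != None, r i != None & r i != C i]].

Definition pfree C r : pcube I := [ffun i => if r i is None then C i else None].

Definition total x : pcube I := [ffun i => Some (x i)].

Lemma app_over r t x : app (over r t) x = app t (app r x).
Proof. by apply/ffunP => i; rewrite !ffunE; case: (t i). Qed.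

Lemma app_nil x : app pnil x = x.
Proof. by apply/ffunP => i; rewrite !ffunE. Qed.

Lemma overA r s t : over r (over s t) = over (over r s) t.
Proof. by apply/ffunP => i; rewrite !ffunE; case: (t i). Qed.

Lemma psize_eq0 t : (psize t == 0%N) = (t == pnil).
Proof.
rewrite /psize sum_nat_eq0; apply/forall_inP/eqP => [t0|-> i _]; last by rewrite ffunE.
apply/ffunP => i; rewrite ffunE; have := t0 i isT; case: (t i) => //.
Qed.

Lemma psize_nil : psize pnil = 0%N.
Proof. by apply/eqP; rewrite psize_eq0. Qed.

Lemma psize_samedom r t : samedom r t -> psize r = psize t.
Proof. by move=> /forallP rt; apply: eq_bigr => i _; rewrite (eqP (rt i)). Qed.

Lemma psub_trans s r t : psub r s -> psub s t -> psub r t.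
Proof.
move=> /forallP rs /forallP st; apply/forallP => i; apply/implyP => ri.
move/implyP: (rs i) => /(_ ri)/eqP sr; rewrite -sr.
by move/implyP: (st i); rewrite sr => ->.
Qed.

Lemma psub_over r t p : psub r t -> psub (over r p) (over t p).
Proof.
move=> /forallP rt; apply/forallP => i; rewrite !ffunE.
by case: (p i) => [b|]; rewrite ?eqxx ?rt.
Qed.

Lemma psub_pfalse C r t : psub r t -> pfalse C r -> pfalse C t.
Proof.
move=> /forallP rt /existsP[i /and3P[Ci ri rC]]; apply/existsP; exists i.
by move: (rt i); rewrite ri /= => /eqP ->; rewrite Ci ri rC.
Qed.

Lemma psub_total_app r x : psub r (total (app r x)).
Proof. by apply/forallP => i; rewrite !ffunE; case: (r i) => //= b. Qed.

Definition leval (L : seq (pcube I)) x := has (fun C => psub C (total x)) L.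

(** Existence of a decision tree of depth at most k, stated on the function itself, without a type
    of trees. Being a boolean, it can serve as the event over which restrictions are summed. *)
Fixpoint dt k f : bool :=
  [forall x, f x == f 0] ||
  (if k is k'.+1 then [exists i, [forall b, dt k' (fun x => f (app (psingle i b) x))]]
   else false).

Lemma eq_dt k f g : f =1 g -> dt k f = dt k g.
Proof.
elim: k f g => [|k IHk] f g fg /=.
  by congr (_ || _); apply: eq_forallb => x; rewrite !fg.
congr (_ || _); first by apply: eq_forallb => x; rewrite !fg.
by apply: eq_existsb => i; apply: eq_forallb => b; apply: IHk => x.
Qed.

Lemma dt_cst k f b : f =1 (fun=> b) -> dt k f.
Proof. by move=> fb; case: k => [|k] /=; apply/orP; left; apply/forallP => x; rewrite !fb. Qed.

Lemma dt_node k f i : (forall b, dt k (fun x => f (app (psingle i b) x))) -> dt k.+1 f.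
Proof. by move=> fi /=; apply/orP; right; apply/existsP; exists i; apply/forallP. Qed.

Lemma dt_ind (P : nat -> (cube I -> bool) -> Prop) :
  (forall k f b, f =1 (fun=> b) -> P k f) ->
  (forall k f i, (forall b, dt k (fun x => f (app (psingle i b) x))) ->
     (forall b, P k (fun x => f (app (psingle i b) x))) -> P k.+1 f) ->
  forall k f, dt k f -> P k f.
Proof.
move=> Pc Pn; elim=> [|k IHk] f /=.
  by rewrite orbF => /forallP f0; apply: (Pc _ _ (f 0)) => x; apply/eqP.
move=> /orP[/forallP f0|/existsP[i /forallP fi]].
  by apply: (Pc _ _ (f 0)) => x; apply/eqP.
by apply: (Pn _ _ i) => // b; apply: IHk.
Qed.

Lemma dtW k k' f : (k <= k')%N -> dt k f -> dt k' f.
Proof.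
move=> kk' fk; elim/dt_ind: fk k' kk' => {k f} [k f b fb k' _|k f i _ IH [|k'] // kk'].
  exact: dt_cst fb.
by apply: (@dt_node _ _ i) => b; apply: IH.
Qed.

Lemma dt_neg k f b : dt k f -> dt k (fun x => b (+) f x).
Proof.
elim/dt_ind => {k f} [k f c fc|k f i _ IH].
  by apply: (@dt_cst _ _ (b (+) c)) => x; rewrite fc.
by apply: (@dt_node _ _ i) => c; apply: IH.
Qed.

Lemma psize_single_free t i : t i != None ->
  psize t = (psize [ffun j => if j == i then None else t j]).+1.
Proof.
move=> ti; rewrite /psize (bigD1 i) //= ti add1n; congr _.+1.
rewrite [RHS](bigD1 i) //= ffunE eqxx add0n; apply: eq_bigr => j /negbTE ji.
by rewrite ffunE ji.
Qed.

(** Querying a whole set of variables at once costs its size; only the domain of t matters, and p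
    ranges over the possible answers. *)
Lemma dt_query k t f :
  (forall p, samedom p t -> dt k (fun x => f (app p x))) -> dt (psize t + k) f.
Proof.
move En : (psize t) => n; elim: n t f En => [|n IHn] t f /eqP.
  rewrite psize_eq0 => /eqP -> /(_ pnil) H.
  by rewrite (@eq_dt _ _ (fun x => f (app pnil x))) => [|x]; rewrite ?app_nil // H //;
    apply/forallP => i; rewrite eqxx.
move=> tn; have /existsP[i ti] : [exists i, t i != None].
  apply: contraTT tn => /existsPn t0; have := psize_eq0 t.
  have -> : t = pnil by apply/ffunP => i; rewrite ffunE; have /negPn/eqP := t0 i.
  by rewrite eqxx => /eqP ->.
move=> H; rewrite addSn; apply: (@dt_node _ _ i) => b.
apply: (IHn [ffun j => if j == i then None else t j]).
  by apply/eqP; rewrite -eqSS -psize_single_free.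
move=> p pt; rewrite (@eq_dt _ _ (fun x => f (app (over p (psingle i b)) x))).
  apply: H; apply/forallP => j; move/forallP: pt => /(_ j); rewrite !ffunE.
  by case: (eqVneq j i) => [->|//]; rewrite (negbTE ti).
by move=> x; rewrite app_over.
Qed.

(** One term for each path to an accepting leaf: a tree of depth k is a DNF of width k. *)
Lemma dt_leval k f : dt k f ->
  exists2 L, all (fun C => psize C <= k)%N L & f =1 leval L.
Proof.
elim/dt_ind => {k f} [k f b fb|k f i _ IH].
  exists (if b then [:: pnil] else [::]); first by case: b {fb} => //=; rewrite psize_nil.
  move=> x; rewrite fb; case: b {fb} => //=; rewrite orbF; apply/esym/forallP => i.
  by rewrite ffunE.
have [L0 sL0 fL0] := IH false; have [L1 sL1 fL1] := IH true.
pose L b := if b then L1 else L0.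
have sL b : all (fun C => psize C <= k)%N (L b) by case: b.
have fL b : (fun x => f (app (psingle i b) x)) =1 leval (L b) by case: b.
pose ext b := [seq over C (psingle i b) | C <- L b].
exists (ext false ++ ext true).
  rewrite all_cat !all_map; apply/andP.
  suff H b : all (preim (fun C => over C (psingle i b)) (fun C => psize C <= k.+1)%N) (L b).
    by split; apply: H.
  apply: sub_all (sL b) => C /= Ck.
  have [Ci|Ci] := eqVneq (C i) None.
    rewrite (psize_single_free (i := i)) ?ffunE ?eqxx //.
    rewrite ltnS; apply: leq_trans Ck; apply: leq_sum => j _; rewrite !ffunE.
    by case: (eqVneq j i).
  apply: leq_trans (leqW Ck); apply: leq_sum => j _; rewrite !ffunE.
  by case: (eqVneq j i) => [->|_]; rewrite ?Ci.
move=> x; rewrite /leval has_cat !has_map.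
have fxi : f x = leval (L (x i)) x.
  rewrite -fL; congr f; apply/ffunP => j; rewrite !ffunE.
  by case: (eqVneq j i) => [->|].
have H b : has (preim (fun C => over C (psingle i b)) (fun C => psub C (total x))) (L b) =
  (x i == b) && f x.
  apply/hasP/andP => [[C CL /=] /forallP Cx|[/eqP <-]].
    have xi : x i = b.
      by move/(_ i): (Cx); rewrite !ffunE eqxx => /eqP[].
    split; first by rewrite xi.
    have -> : x = app (psingle i b) (app C x).
      apply/ffunP => j; move/(_ j): (Cx); rewrite !ffunE.
      by case: (eqVneq j i) => [->|_] /= ; rewrite ?xi //; case: (C j) => //= c /eqP[].
    rewrite fL; apply/hasP; exists C => //; exact: psub_total_app.
  rewrite fxi => /hasP[C CL Cx]; exists C => //=; apply/forallP => j.
  rewrite !ffunE; case: (eqVneq j i) => [->|_] /=; first by rewrite eqxx.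
  by move/forallP: Cx => /(_ j); rewrite ffunE.
by rewrite !H; case: (x i); case: (f x).
Qed.

Lemma dt_or_leval k (n : nat) (g : 'I_n -> cube I -> bool) :
  (forall j, dt k (g j)) ->
  exists2 L, all (fun C => psize C <= k)%N L & (fun x => [exists j, g j x]) =1 leval L.
Proof.
move=> gk; elim: n => [|n IHn] in g gk *.
  by exists [::] => // x; apply/existsP => [[[]]].
have [L sL gL] := IHn (fun j => g (lift ord0 j)) (fun j => gk _).
have [L0 sL0 gL0] := dt_leval (gk ord0).
exists (L0 ++ L); first by rewrite all_cat sL0.
move=> x; rewrite /leval has_cat -[has _ L0]gL0 -[has _ L]gL.
apply/existsP/orP => [[j]|[g0|/existsP[j gj]]]; last by exists (lift ord0 j).
  case: (unliftP ord0 j) => [j' ->|->] gj; last by left.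
  by right; apply/existsP; exists j'.
by exists ord0.
Qed.

(** A query node is the polynomial x_i f_1 + (1 - x_i) f_0, so each level adds one to the degree. *)
Lemma dt_lowdeg (R : realFieldType) k f : dt k f ->
  exists M, lowdeg k M (fun x => (f x)%:R : R).
Proof.
elim/dt_ind => {k f} [k f b fb|k f i _ IH].
  exists `|b%:R|; have := @lowdeg_cst I R k _ _ (lexx `|b%:R : R|).
  by apply: lowdeg_ext => x; rewrite fb.
have [M0 f0] := IH false; have [M1 f1] := IH true.
have h1 : lowdeg 1 (`|1| + 1) (fun x => 1 - (x i)%:R : R).
  exact: lowdegB (@lowdeg_cst I R _ _ _ (lexx _)) (lowdeg_var _ _).
exists (1 * M1 + (`|1| + 1) * M0); rewrite -add1n.
have := lowdegD (lowdegM (lowdeg_var R i) f1) (lowdegM h1 f0).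
apply: lowdeg_ext => x.
have fE b : x i = b -> app (psingle i b) x = x.
  by move=> xi; apply/ffunP => j; rewrite !ffunE; case: (eqVneq j i) => [->|].
case xi: (x i); rewrite ?(fE true xi) ?(fE false xi) /=.
  by rewrite subrr mul1r mul0r addr0.
by rewrite subr0 mul1r mul0r add0r.
Qed.

(** Formulas of depth d in which every OR has fan-in at most m; the sign b at each gate supplies
    negations and ANDs. Bounding the fan-in instead of the size lets shared subcircuits be unfolded
    freely, and union bounds then cost a factor of about m per level. *)
Fixpoint AC (d m : nat) f : Prop :=
  if d is d'.+1 then
    exists (b : bool) (n : nat) (g : 'I_n -> cube I -> bool),
      [/\ (n <= m)%N, forall j, AC d' m (g j) & f =1 (fun x => b (+) [exists j, g j x])]
  else (exists b, f =1 (fun=> b)) \/ (exists b i, f =1 (fun x => b (+) x i)).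

Lemma eq_AC d m f g : f =1 g -> AC d m f -> AC d m g.
Proof.
case: d => [|d] fg /=.
  case=> [[b fb]|[b [i fb]]]; [left; exists b|right; exists b, i] => x; by rewrite -fg fb.
by case=> [b [n [h [nm hA fE]]]]; exists b, n, h; split=> // x; rewrite -fg fE.
Qed.

Lemma AC_neg d m b f : AC d m f -> AC d m (fun x => b (+) f x).
Proof.
case: d => [|d] /=.
  case=> [[c fc]|[c [i fc]]]; [left; exists (b (+) c)|right; exists (b (+) c), i] => x;
  by rewrite fc ?addbA.
case=> [c [n [h [nm hA fE]]]]; exists (b (+) c), n, h; split=> // x.
by rewrite fE addbA.
Qed.

Lemma AC_mon d m m' f : (m <= m')%N -> AC d m f -> AC d m' f.
Proof.
move=> mm'; elim: d f => [//|d IHd] f /= [b [n [h [nm hA fE]]]].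
exists b, n, h; split=> // [|j]; last exact: IHd.
exact: leq_trans mm'.
Qed.

Lemma AC_or d m (n : nat) (g : 'I_n -> cube I -> bool) : (n <= m)%N ->
  (forall j, AC d m (g j)) -> AC d.+1 m (fun x => [exists j, g j x]).
Proof. by move=> nm gA; rewrite /=; exists false, n, g; split. Qed.

Lemma AC_S d m f : (0 < m)%N -> AC d m f -> AC d.+1 m f.
Proof.
move=> m0 fA; apply: eq_AC (@AC_or d m 1 (fun _ => f) m0 (fun _ => fA)) => x.
by apply/existsP/idP => [[]|] //; exists ord0.
Qed.

Lemma ACW d d' m f : (0 < m)%N -> (d <= d')%N -> AC d m f -> AC d' m f.
Proof.
move=> m0 /subnK <- fA; elim: (d' - d)%N => [//|k IHk].
by rewrite addSn; apply: AC_S.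
Qed.

End Restrictions.

Arguments AC {I} d m f : simpl never.

(** * The switching lemma *)

Section RandomRestrictions.
Variables (R : realFieldType) (I : finType).
Implicit Types (r s t C : pcube I) (p : R).

(** The probability of r when every variable stays free with probability p and is otherwise set to a
    uniform bit. *)
Definition pweight p r : R := \prod_i (if r i is Some _ then (1 - p) / 2 else p).

Lemma pweight_ge0 p r : 0 <= p <= 1 -> 0 <= pweight p r.
Proof.
move=> /andP[p0 p1]; apply: prodr_ge0 => i _; case: (r i) => // _.
by rewrite divr_ge0 ?subr_ge0.
Qed.

Lemma sum_option_bool (F : option bool -> R) :
  \sum_o F o = F None + (F (Some true) + F (Some false)).
Proof.
rewrite (bigD1 None) //= (bigD1 (Some true)) //= (bigD1 (Some false)) //=.
by rewrite big1 ?addr0 // => [[[]|]].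
Qed.

Lemma sum_pweight p : \sum_r pweight p r = 1.
Proof.
rewrite /pweight -(bigA_distr_bigA (fun i (o : option bool) =>
  if o is Some _ then (1 - p) / 2 else p)) big1 // => i _.
by rewrite sum_option_bool; field.
Qed.

(** A coordinatewise map sends a pair of independent product distributions to a product
    distribution. It serves both to compose two random restrictions and to draw the free set
    separately from the values. *)
Lemma sum_pushforward (S T W : finType) (a : S -> R) (b : T -> R) (h : S -> T -> W)
    (G : {ffun I -> W} -> R) :
  \sum_(u : {ffun I -> S}) \sum_(v : {ffun I -> T})
     (\prod_i a (u i)) * (\prod_i b (v i)) * G [ffun i => h (u i) (v i)] =
  \sum_(w : {ffun I -> W})
     (\prod_i \sum_x \sum_y a x * b y * (h x y == w i)%:R) * G w.
Proof.
under [RHS]eq_bigr => w _.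
  rewrite (bigA_distr_bigA (fun i x => \sum_y a x * b y * (h x y == w i)%:R)).
  under eq_bigr => u _ do
    rewrite (bigA_distr_bigA (fun i y => a (u i) * b y * (h (u i) y == w i)%:R)).
  rewrite mulr_suml; under eq_bigr => u _ do rewrite mulr_suml.
  over.
rewrite [RHS]exchange_big; apply: eq_bigr => u _ /=; rewrite [RHS]exchange_big.
apply: eq_bigr => v _ /=; rewrite (bigD1 [ffun i => h (u i) (v i)]) //=.
rewrite [X in _ = _ + X]big1 ?addr0 => [|w wN].
  rewrite -big_split /=; congr (_ * _); apply: eq_bigr => i _.
  by rewrite ffunE eqxx mulr1.
have [i hi] : exists i, h (u i) (v i) != w i.
  apply/existsP; apply: contraNT wN => /existsPn hw; apply/eqP/ffunP => i.
  by rewrite ffunE; apply/esym/eqP; rewrite -[_ == _]negbK.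
by rewrite (bigD1 i) //= (negbTE hi) !mulr0 !mul0r.
Qed.

(** A variable stays free under the composition exactly if it is free in both restrictions, hence
    the parameter p * q. *)
Lemma pweight_over p q (G : pcube I -> R) :
  \sum_s \sum_r pweight p s * pweight q r * G (over r s) =
  \sum_r pweight (p * q) r * G r.
Proof.
rewrite /pweight; have := sum_pushforward (fun o : option bool => if o is Some _ then (1 - p) / 2 else p)
  (fun o : option bool => if o is Some _ then (1 - q) / 2 else q)
  (fun o o' => if o is Some b then Some b else o') G.
rewrite -/(over _ _) => ->; apply: eq_bigr => r _; congr (_ * _).
apply: eq_bigr => i _; rewrite !sum_option_bool.
by case: (r i) => [[]|] /=; rewrite ?eqxx /=; field.
Qed.

Lemma sum_cover (T K : finType) (F : T -> R) (P : pred T) (Q : K -> pred T) :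
  (forall x, 0 <= F x) -> (forall x, P x -> exists k, Q k x) ->
  \sum_(x | P x) F x <= \sum_k \sum_(x | Q k x) F x.
Proof.
move=> F0 PQ; under [leRHS]eq_bigr do rewrite big_mkcond.
rewrite exchange_big big_mkcond /=; apply: ler_sum => x _.
case: ifP => [/PQ[k Qk]|_]; last by apply: sumr_ge0 => k _; case: ifP.
by rewrite (bigD1 k) //= Qk lerDl; apply: sumr_ge0 => k' _; case: ifP.
Qed.

Lemma sum_sub (T : finType) (F : T -> R) (P Q : pred T) :
  (forall x, 0 <= F x) -> (forall x, P x -> Q x) ->
  \sum_(x | P x) F x <= \sum_(x | Q x) F x.
Proof.
move=> F0 PQ; rewrite big_mkcond [leRHS]big_mkcond; apply: ler_sum => x _.
by case: ifP => [/PQ->|_] //; case: ifP.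
Qed.

Lemma sum_inj_le (T T' : finType) (F : T' -> R) (P : pred T) (Q : pred T') (h : T -> T') :
  (forall x, 0 <= F x) -> {in P &, injective h} -> (forall x, P x -> Q (h x)) ->
  \sum_(x | P x) F (h x) <= \sum_(y | Q y) F y.
Proof.
move=> F0 hi PQ; rewrite -(big_imset F hi) /=; apply: sum_sub => // y /imsetP[x Px ->].
exact: PQ.
Qed.

Lemma exp_le_2 (w : nat) (y : R) : 0 <= y -> w%:R * y <= 1 / 2 -> (1 + y) ^+ w <= 2.
Proof.
move=> y0; elim: w => [|w IHw] wy; first by rewrite expr0 ler1n.
have wy' : w%:R * y <= 1 / 2 by apply: le_trans wy; rewrite ler_wpM2r // ler_nat.
(* The factor 1 - k y strengthens the claim enough for induction; it is at least 1/2 in the range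
   considered, which gives the bound 2. *)
suff H k : (k%:R * y <= 1 / 2) -> (1 + y) ^+ k * (1 - k%:R * y) <= 1.
  have := H _ wy; move: wy; set a := _ ^+ _; set b := _ * y => wy ab.
  have a0 : 0 <= a by apply: exprn_ge0; lra.
  by nra.
elim: k => [|k IHk] ky; first by rewrite expr0; lra.
have ky' : k%:R * y <= 1 / 2 by apply: le_trans ky; rewrite ler_wpM2r // ler_nat.
apply: le_trans (IHk ky'); rewrite exprSr -mulrA; apply: ler_wpM2l.
  by apply: exprn_ge0; lra.
rewrite -natr1; have : 0 <= k%:R * y * y + y * y by rewrite addr_ge0 ?mulr_ge0 ?ler0n.
by nra.
Qed.

Lemma find_eq (T : Type) (x0 : T) (a : pred T) (l : seq T) j : (j < size l)%N ->
  a (nth x0 l j) -> (forall i, (i < j)%N -> ~~ a (nth x0 l i)) -> find a l = j.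
Proof.
move=> jl aj ai; apply/eqP; rewrite eqn_leq; apply/andP; split.
  by rewrite leqNgt; apply/negP => /(before_find x0); rewrite aj.
rewrite leqNgt; apply/negP => /ai; apply/negP; rewrite negbK; apply: nth_find.
by rewrite has_find; apply: leq_ltn_trans jl; rewrite leqNgt; apply/negP => /(before_find x0); rewrite aj.
Qed.

Section SwitchingLemma.
Variables (L : seq (pcube I)) (w : nat).
Hypotheses (w_gt0 : (0 < w)%N) (width_L : all (fun C => psize C <= w)%N L).

(** The first term not falsified by r. If all are falsified, the default is the empty term, whose
    free part is empty, so that the canonical tree stops there as well. *)
Definition fterm r := nth (pnil I) L (find (fun C => ~~ pfalse C r) L).

(* The depth, up to the fuel n, of the canonical decision tree of the DNF L
   under r, which queries at once all the free variables of the first term that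
   r does not falsify. *)
Fixpoint cdepth n r : nat :=
  if n is n'.+1 then
    let t := pfree (fterm r) r in
    if t == pnil I then 0%N
    else (psize t + \max_(s | samedom s t) cdepth n' (over r s))%N
  else 0%N.

Definition stars r : nat := (\sum_i (r i == None))%N.

(** Either no term is live and the DNF is false, or the first live term has no free literal left and
    is therefore already satisfied. *)
Lemma leval_cst r : pfree (fterm r) r = pnil I ->
  (fun x => leval L (app r x)) =1 (fun=> has (fun C => ~~ pfalse C r) L).
Proof.
move=> tN x; apply/hasP/hasP => [[C CL Cx]|[C CL Cr]].
  exists C => //; apply/existsP => -[i /and3P[Ci ri rC]].
  move/forallP/(_ i): Cx; rewrite Ci !ffunE => /= /eqP Cx; move: rC; rewrite -Cx.
  by case: (r i) ri => //= b; rewrite eqxx.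
have hs : has (fun C => ~~ pfalse C r) L by apply/hasP; exists C.
exists (fterm r); first by apply: mem_nth; rewrite -has_find.
have := nth_find (pnil I) hs; rewrite -/(fterm r) => /existsPn Cf.
apply/forallP => i; apply/implyP => Ci; rewrite !ffunE.
move: (Cf i) (congr1 (fun t : pcube I => t i) tN); rewrite !ffunE Ci /=.
case: (r i) => [b|]; first by rewrite /= negbK => /eqP ->.
by move=> _ C0; rewrite C0 in Ci.
Qed.

Lemma dt_cdepth n r : (stars r <= n)%N -> dt (cdepth n r) (fun x => leval L (app r x)).
Proof.
elim: n r => [|n IHn] r rn.
  apply: (@dt_cst _ _ _ (leval L (app r 0))) => x; congr leval; apply/ffunP => i.
  rewrite !ffunE; have : (r i == None) = false :> bool.
    apply/negbTE; move: rn; rewrite leqn0 sum_nat_eq0 => /forall_inP/(_ i isT).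
    by case: (r i == None).
  by case: (r i).
rewrite /=; case: eqP => [/leval_cst tN|/eqP tN]; first exact: dt_cst tN.
apply: dt_query => s st; rewrite (@eq_dt _ _ _ (fun x => leval L (app (over r s) x))); last first.
  move=> x; congr leval; rewrite app_over; apply/ffunP => i; rewrite !ffunE.
  move/forallP/(_ i): st; rewrite ffunE; case: (r i) => [b|] //=.
  by case: (s i).
apply: (@dtW _ (cdepth n (over r s))); first exact: (@leq_bigmax_cond _ _ (fun s => cdepth n (over r s))).
apply: IHn; rewrite -ltnS; apply: leq_trans rn.
have [i ti] : exists i, pfree (fterm r) r i != None.
  apply/existsP; apply: contraNT tN => /existsPn t0; apply/eqP/ffunP => i.
  by rewrite [RHS]ffunE; apply/eqP; rewrite -[_ == _]negbK.
rewrite /stars (bigD1 i) //= [X in (_ < X)%N](bigD1 i) //=.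
have -> : r i == None by move: ti; rewrite ffunE; case: (r i).
have -> : over r s i == None = false.
  rewrite ffunE; move/forallP/(_ i): st; rewrite (negbTE ti).
  by case: (s i).
rewrite add0n add1n ltnS; apply: leq_sum => j _; rewrite ffunE.
by case: (s j).
Qed.

Definition pdom_sub s t := [forall i, (s i != None) ==> (t i != None)].

(** Fixing a free variable replaces its factor p by (1 - p) / 2; the ratio 2p / (1 - p) is what each
    variable of a long path saves. *)
Lemma pweight_free p r t : 0 <= p < 1 -> (forall i, t i != None -> r i = None) ->
  pweight p r = (2 * p / (1 - p)) ^+ psize t * pweight p (over r t).
Proof.
move=> /andP[p0 p1] tr; rewrite /psize -prodrXr /pweight -big_split /=.
apply: eq_bigr => i _; rewrite ffunE; case ti: (t i) => [b|] /=.
  by rewrite tr ?ti // expr1; field; apply/eqP; lra.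
by rewrite expr0 mul1r.
Qed.

(** Each variable of C is either absent from t or set in one of two ways, so the sum with the empty
    path is (1 + 2y)^|C| <= 2, and removing the empty path leaves at most 1. With y = 1 / (4w) this
    pays for the choice of the answers, the side information of the encoding. *)
Lemma sum_subpaths (y : R) C : 0 <= y -> w%:R * y <= 1 / 4 -> (psize C <= w)%N ->
  \sum_(t | (t != pnil I) && pdom_sub t C) y ^+ psize t <= 1.
Proof.
move=> y0 wy Cw.
suff : \sum_(t | pdom_sub t C) y ^+ psize t <= 2.
  rewrite (bigD1 (pnil I)) /=; last by apply/forallP => i; rewrite ffunE.
  rewrite psize_nil expr0 (eq_bigl (fun t => (t != pnil I) && pdom_sub t C)); first by lra.
  by move=> t; rewrite andbC.
have -> : \sum_(t | pdom_sub t C) y ^+ psize t = (1 + 2 * y) ^+ psize C.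
  rewrite [in RHS]/psize -prodrXr.
  transitivity (\prod_(i : I) \sum_(o : option bool)
     (if o != None then (C i != None)%:R * y else 1)).
    rewrite bigA_distr_bigA big_mkcond; apply: eq_bigr => t _.
    case: ifP => [/forallP tC|/negbT/forallPn[ i]].
      rewrite /psize -prodrXr; apply: eq_bigr => i _.
      by move: (tC i); case: (t i) => [b|] //= ->; rewrite expr1 mul1r.
    by rewrite negb_imply => /andP[ti Ci]; rewrite (bigD1 i) //= ti (negbTE Ci) !mul0r.
  apply: eq_bigr => i _; rewrite sum_option_bool /=.
  by case: (C i) => [b|] /=; rewrite ?expr1 ?expr0 ?mul1r ?mul0r ?addr0 //; ring.
apply: exp_le_2; first by lra.
have : (psize C)%:R * y <= w%:R * y by rewrite ler_wpM2r // ler_nat.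
by lra.
Qed.

Section Core.
Variable p : R.
Let switch_factor := 2 * p / (1 - p).
Hypotheses (p0 : 0 <= p) (p1 : p < 1) (wr : 4 * w%:R * switch_factor <= 1).

Let switch_factor_ge0 : 0 <= switch_factor.
Proof. by rewrite /switch_factor divr_ge0 ?mulr_ge0 // subr_ge0 ltW. Qed.

Let branching_factor_ge0 : 0 <= 4 * w%:R * switch_factor.
Proof. by rewrite mulr_ge0 // mulr_ge0 ?ler0n. Qed.

Let pw0 (r : pcube I) : 0 <= pweight p r.
Proof. by apply: pweight_ge0; rewrite p0 ltW. Qed.

(* Razborov's encoding as an induction: a bad r is charged to its extension
   which satisfies the first live term, and this changes its weight by
   switch_factor for every fixed variable. The up-closed event Q records the
   extensions already made; u is the path followed so far in the decision tree, which is
   defined on some of the variables that these extensions have fixed. *)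
Lemma switching_core n (s : nat) (Q : pred (pcube I)) u :
  (forall r r', psub r r' -> Q r -> Q r') -> (forall r, Q r -> pdom_sub u r) ->
  \sum_(r | Q r && (s <= cdepth n (over r u))%N) pweight p r <=
  (4 * w%:R * switch_factor) ^+ s * \sum_(r | Q r) pweight p r.
Proof.
elim: n s Q u => [|n IHn] s Q u Qup Qu; case: s => [|s] /=.
- by rewrite expr0 mul1r; apply: sum_sub => // r /andP[].
- rewrite big_pred0 => [|r]; last by rewrite andbF.
  by rewrite mulr_ge0 ?exprn_ge0 ?sumr_ge0.
- by rewrite expr0 mul1r; apply: sum_sub => // r /andP[].
pose jt r := find (fun C => ~~ pfalse C (over r u)) L.
(* A bad r is classified by the index of its first live term and by answers attaining the maximum in
   [cdepth]. *)
pose B (k : 'I_(size L) * pcube I) r := [&& Q r, jt r == k.1,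
   k.2 != pnil I, samedom k.2 (pfree (nth (pnil I) L k.1) (over r u))
   & (s.+1 - psize k.2 <= cdepth n (over r (over u k.2)))%N].
apply: le_trans (sum_cover (Q := B) pw0 _) _.
  move=> r /andP[Qr]; case: ifPn => [//|tN].
  set t := pfree _ _ in tN *; move=> st.
  have jr : (jt r < size L)%N.
    rewrite ltnNge; apply: contraNN tN => jr; rewrite /t /fterm nth_default //.
    by apply/eqP/ffunP => i; rewrite [LHS]ffunE [RHS]ffunE; case: (over r u i) => [b|]; rewrite ?ffunE.
  have tt : t \in [pred s | samedom s t] by rewrite inE; apply/forallP => i; rewrite eqxx.
  have [|t1 t1t mE] := @eq_bigmax_cond _ [pred s | samedom s t] (fun s => cdepth n (over (over r u) s)).
    by apply/card_gt0P; exists t.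
  have {}t1t : samedom t1 t by [].
  exists (Ordinal jr, t1); rewrite /B /= Qr eqxx /=; apply/and3P; split => //.
    by rewrite -psize_eq0 (psize_samedom t1t) psize_eq0.
  rewrite leq_subLR (psize_samedom t1t) overA -mE; exact: st.
have H (k : 'I_(size L) * pcube I) : \sum_(r | B k r) pweight p r <=
  (if (k.2 != pnil I) && pdom_sub k.2 (nth (pnil I) L k.1) then (4 * w%:R)^-1 ^+ psize k.2 else 0)
  * ((4 * w%:R * switch_factor) ^+ s.+1 * \sum_(r | Q r && (jt r == k.1)) pweight p r).
  case: k => j t1 /=; set C := nth _ L j.
  case: ifPn => [/andP[t1N t1C]|t1P]; last first.
    rewrite mul0r big_pred0 // => r; apply/negP => /and5P[_ _ /= t1N /forallP t1s _].
    move/negP: t1P; apply; rewrite t1N /=; apply/forallP => i; move: (t1s i); rewrite -/C ffunE.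
    by case: (over r u i) => [b|] => [/eqP|/eqP ->]; [case: (t1 i)|apply/implyP].
  (* [t1] holds the answers followed by the path, [sg] the literals of C on the same variables. The
     charge goes to [over r sg]; with the index and [t1] fixed, the domain of [sg] is known, so
     freeing it gives r back. *)
  pose sg : pcube I := [ffun i => if t1 i is None then None else C i].
  have sgE : psize sg = psize t1.
    apply: eq_bigr => i _; rewrite ffunE; move/forallP/(_ i): t1C.
    by case: (t1 i) => //= b ->.
  (* The event for the next round. It is again up-closed: a falsified term stays falsified and C
     stays satisfied, so C remains the first live term. *)
  pose Q' r := [&& Q r, jt r == j, psub C (over r u) & pdom_sub t1 r].
  have Bsg r : B (j, t1) r -> forall i, sg i != None -> r i = None /\ u i = None.
    move=> /and5P[_ _ _ /= /forallP t1s _] i; move: (t1s i); rewrite -/C !ffunE.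
    by case: (t1 i) => [b|] //; case: (u i) => [b'|]; case: (r i).
  have key : \sum_(r | B (j, t1) r) pweight p r <= switch_factor ^+ psize t1 *
    \sum_(r | Q' r && (s.+1 - psize t1 <= cdepth n (over r (over u t1)))%N) pweight p r.
    rewrite mulr_sumr.
    have -> : \sum_(r | B (j, t1) r) pweight p r =
        \sum_(r | B (j, t1) r) switch_factor ^+ psize t1 * pweight p (over r sg).
      apply: eq_bigr => r Br; rewrite (@pweight_free p r sg) ?p0 ?sgE // => i sgi.
      by case: (Bsg r Br i sgi).
    apply: (@sum_inj_le _ _ (fun r => switch_factor ^+ psize t1 * pweight p r)).
    - by move=> r; rewrite mulr_ge0 // exprn_ge0.
    - move=> r r' Br Br' /ffunP rr'; apply/ffunP => i; move: (rr' i); rewrite !ffunE.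
      rewrite -/(sg i); have [sgi|sgi] := eqVneq (sg i) None.
        by move: (sgi); rewrite ffunE => ->.
      by have [-> _] := Bsg r Br i sgi; have [-> _] := Bsg r' Br' i sgi.
    move=> r Br; have sr : psub r (over r sg).
      apply/forallP => i; rewrite [over r sg i]ffunE.
      case sgi: (sg i) => [b|]; last by rewrite eqxx implybT.
      by have [|-> _] := Bsg r Br i; rewrite ?sgi.
    move: (Br) => /and5P[/= Qr /eqP jr _ /forallP t1s dr].
    have hs : has (fun C => ~~ pfalse C (over r u)) L by rewrite has_find [find _ _]jr.
    have Cr : ~~ pfalse C (over r u).
      by have := nth_find (pnil I) hs; rewrite [find _ _]jr.
    have Csub : psub C (over (over r sg) u).
      apply/forallP => i; apply/implyP => Ci; move/existsPn/(_ i): Cr (t1s i).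
      rewrite -/C Ci !ffunE /=; case ui: (u i) => [b|] //=.
        by rewrite negbK.
      case t1i: (t1 i) => [b|]; case ri: (r i) => [b'|] //=.
      - by case: (C i).
      - by rewrite negbK => ->.
      - by rewrite (negbTE Ci).
    apply/andP; split; last first.
      apply: leq_trans dr _; rewrite leq_eqVlt; apply/orP; left; apply/eqP; congr cdepth.
      by apply/ffunP => i; rewrite !ffunE; case: (t1 i) => [b|]; case: (u i).
    apply/and4P; split => //.
    - exact: Qup sr Qr.
    - apply/eqP; apply: (find_eq (x0 := pnil I)) => //.
        apply/existsPn => i; have := forallP Csub i; rewrite -/C.
        by case: (C i) => //= b /eqP ->; rewrite eqxx.
      move=> i ij; rewrite negbK; apply: psub_pfalse (psub_over _ sr) _.
      by have := before_find (pnil I) (a := fun C => ~~ pfalse C (over r u)) (s := L);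
        move=> /(_ i); rewrite [find _ _]jr => /(_ ij)/negbFE.
    - apply/forallP => i; apply/implyP => t1i; rewrite !ffunE.
      have := forallP t1C i; rewrite t1i /=.
      by case: (t1 i) t1i => // b _; case: (C i).
  apply: le_trans key _.
  have t1gt0 : (0 < psize t1)%N by rewrite lt0n psize_eq0.
  have Q'up r r' : psub r r' -> Q' r -> Q' r'.
    move=> rr' /and4P[Qr /eqP jr Cr tr]; have Cr' := psub_trans Cr (psub_over u rr').
    apply/and4P; split => //; first exact: Qup rr' Qr.
      apply/eqP; apply: (find_eq (x0 := pnil I)) => //.
        apply/existsPn => i; have := forallP Cr' i; rewrite -/C.
        by case: (C i) => //= b /eqP ->; rewrite eqxx.
      move=> i ij; rewrite negbK; apply: psub_pfalse (psub_over _ rr') _.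
      by have := before_find (pnil I) (a := fun C => ~~ pfalse C (over r u)) (s := L);
        move=> /(_ i); rewrite [find _ _]jr => /(_ ij)/negbFE.
    apply/forallP => i; apply/implyP => /(implyP (forallP tr i)) ri.
    by move: (implyP (forallP rr' i) ri) => /eqP ->.
  have Q'u r : Q' r -> pdom_sub (over u t1) r.
    move=> /and4P[Qr _ _ tr]; apply/forallP => i; rewrite !ffunE.
    by have := forallP tr i; case: (t1 i) => [b|] // _; exact: (forallP (Qu _ Qr) i).
  apply: le_trans (ler_wpM2l (exprn_ge0 _ switch_factor_ge0) (IHn _ _ _ Q'up Q'u)) _.
  rewrite [leLHS]mulrA [leRHS]mulrA; apply: ler_pM.
  - by rewrite mulr_ge0 ?exprn_ge0.
  - exact: sumr_ge0.
  (* The power is shared: (4w)^-|t1| pays for the sum over [t1], and the rest restores the exponent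
     from s.+1 - |t1| to at least s.+1. If |t1| exceeds s.+1 the truncated subtraction is harmless,
     the base being at most 1. *)
  - have -> : switch_factor ^+ psize t1 = (4 * w%:R)^-1 ^+ psize t1 * (4 * w%:R * switch_factor) ^+ psize t1.
      by rewrite -exprMn [_^-1 * _]mulrA mulVf ?mul1r // mulf_neq0 // pnatr_eq0 -?lt0n.
    rewrite -[leLHS]mulrA; apply: ler_wpM2l.
      by rewrite exprn_ge0 // invr_ge0 mulr_ge0.
    rewrite -exprD; apply: ler_wiXn2l => //.
    by rewrite -leq_subLR.
  - by apply: sum_sub => // r /and4P[-> ->].
apply: le_trans (ler_sum _ (fun k _ => H k)) _.
rewrite -(pair_bigA _ (fun (j : 'I_(size L)) t1 =>
  (if (t1 != pnil I) && pdom_sub t1 (nth (pnil I) L j) then (4 * w%:R)^-1 ^+ psize t1 else 0)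
  * ((4 * w%:R * switch_factor) ^+ s.+1 * \sum_(r | Q r && (jt r == j)) pweight p r))) /=.
apply: le_trans (_ : \sum_(j < size L) 1 * ((4 * w%:R * switch_factor) ^+ s.+1 *
    \sum_(r | Q r && (jt r == j)) pweight p r) <= _).
  apply: ler_sum => j _; rewrite -mulr_suml -big_mkcond; apply: ler_wpM2r.
    by rewrite mulr_ge0 ?exprn_ge0 ?sumr_ge0.
  apply: sum_subpaths; first by rewrite invr_ge0 mulr_ge0.
    rewrite invfM mulrCA mulfV ?mulr1 ?pnatr_eq0 -?lt0n //; lra.
  by apply: (allP width_L); apply: mem_nth.
(* No factor for the number of terms: each r has a single first live term, so the events over j are
   disjoint parts of Q. *)
rewrite -mulr_sumr mul1r -mulr_sumr; apply: ler_wpM2l; first exact: exprn_ge0.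
under [leLHS]eq_bigr => j _ do rewrite big_mkcondr.
rewrite [leLHS]exchange_big; apply: ler_sum => r Qr /=.
have [jr|jr] := ltnP (jt r) (size L).
  rewrite (bigD1 (Ordinal jr)) //= eqxx big1 ?addr0 // => j jN.
  by case: eqP => // jE; case/eqP: jN; apply: val_inj.
rewrite big1 // => j _; case: eqP => // jE; move: (ltn_ord j).
by rewrite -jE ltnNge jr.
Qed.


Lemma switching (s : nat) :
  \sum_(r | ~~ dt s (fun x => leval L (app r x))) pweight p r <= (4 * w%:R * switch_factor) ^+ s.+1.
Proof.
have := @switching_core #|I| s.+1 predT (pnil I) (fun _ _ _ h => h) _.
rewrite sum_pweight mulr1; set X := _ ^+ _ => H; apply: le_trans (H _).
  apply: sum_sub => // r /=; apply: contraNT; rewrite -leqNgt => h.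
  apply: (dtW h); rewrite (_ : over r (pnil I) = r).
    by apply: dt_cdepth; rewrite /stars -sum1_card; apply: leq_sum => i _; case: (_ == _).
  by apply/ffunP => i; rewrite !ffunE.
by move=> r _; apply/forallP => i; rewrite ffunE.
Qed.

End Core.
End SwitchingLemma.
End RandomRestrictions.

(** * Fourier tails of bounded-depth circuits *)

Section LinialMansourNisan.
Variables (R : realFieldType) (I : finType).
Implicit Types (r : pcube I) (S T J x z : cube I) (f : cube I -> bool) (F : cube I -> R).

(** One round of restriction per level. Once all children are trees of depth s, the gate is a DNF of
    width s up to a sign, and the switching lemma turns it into a tree of depth s again. A failure
    is that of one of at most m children or that of the gate, hence the factor m + 1 per level. *)
Lemma AC_restriction d m s (p : R) f : (0 < s)%N -> 0 <= p <= 1 / 2 ->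
  16 * s%:R * p <= 1 / 2 -> AC d m f ->
  \sum_(r | ~~ dt s (fun x => f (app r x))) pweight (p ^+ d) r <=
    (m.+1)%:R ^+ d * 2^-1 ^+ s.
Proof.
move=> s0 /andP[p0 p12] sp; elim: d f => [|d IHd] f /=.
  move=> fE; rewrite big_pred0 ?mulr_ge0 ?exprn_ge0 ?invr_ge0 // => r; apply/negbTE.
  rewrite negbK; case: fE => [[b fb]|[b [i fb]]]; first exact: dt_cst (fun x => fb _).
  apply: (@dtW _ 1) => //; apply: (@dt_node _ _ _ i) => c.
  apply: (@dt_cst _ _ _ (f (app r (app (psingle i c) 0)))) => x; rewrite !fb.
  by congr (_ (+) _); rewrite !ffunE eqxx.
move=> [b [n [g [nm gA fE]]]].
have pd01 : 0 <= p ^+ d <= 1 by rewrite exprn_ge0 //= exprn_ile1 //; lra.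
have p01 : 0 <= p <= 1 by lra.
rewrite big_mkcond exprSr; under eq_bigr do rewrite -mulrb -mulr_natr.
(* The restriction of parameter p^d takes precedence and makes the children shallow; the one of
   parameter p then collapses the gate. *)
rewrite -(pweight_over _ _ (fun r => (~~ dt s (fun x => f (app r x)))%:R)).
apply: le_trans (_ : \sum_(r1 : pcube I) (pweight (p ^+ d) r1 *
   (\sum_(j < n) (~~ dt s (fun x => g j (app r1 x)))%:R) + pweight (p ^+ d) r1 * 2^-1 ^+ s) <= _).
  apply: ler_sum => r1 _; rewrite -mulrDr; under eq_bigr do rewrite -mulrA.
  rewrite -mulr_sumr; apply: ler_wpM2l; first exact: pweight_ge0.
  have [/forallP gd|/forallPn[j gj]] := boolP [forall j, dt s (fun x => g j (app r1 x))].
    apply: ler_wpDl; first by apply: sumr_ge0 => j _; rewrite ler0n.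
    have [L sL gL] := dt_or_leval gd.
    have lt_p1 : p < 1 by lra.
    (* As p <= 1/2, the quantity is at most 16 s p; this is the origin of the 16 in the
       hypothesis. *)
    have x12 : 4 * s%:R * (2 * p / (1 - p)) <= 1 / 2.
      rewrite !mulrA ler_pdivrMr ?subr_gt0 //; nra.
    have x0 : 0 <= 4 * s%:R * (2 * p / (1 - p)).
      by rewrite mulr_ge0 ?divr_ge0 ?mulr_ge0 ?subr_ge0 ?ler0n // ltW.
    have := @switching R I L s s0 sL p p0 lt_p1 _ s; set X := _ * _ in x12 x0 *.
    move=> /(_ _) H; apply: le_trans (_ : X ^+ s.+1 <= _).
      apply: le_trans (H _); last by lra.
      rewrite [leRHS]big_mkcond; apply: ler_sum => r2 _.
      rewrite (_ : dt s (fun x => f (app (over r2 r1) x)) =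
                   dt s (fun x => b (+) leval L (app r2 x))); last first.
        by apply: eq_dt => x; rewrite fE app_over; congr (_ (+) _); rewrite -gL.
      case: ifPn => [|/negPn/(dt_neg b) ->]; last by rewrite /= mulr0.
      by move=> _; case: (~~ _); rewrite /= ?mulr1 ?mulr0 ?pweight_ge0.
    apply: le_trans (_ : X ^+ s <= _); first by rewrite exprS ler_piMl ?exprn_ge0 //; lra.
    by apply: lerXn2r; rewrite ?nnegrE //; lra.
  rewrite ler_wpDr ?exprn_ge0 ?invr_ge0 //.
  apply: le_trans (_ : 1 <= _); last first.
    by rewrite (bigD1 j) //= gj lerDl; apply: sumr_ge0 => k _; rewrite ler0n.
  rewrite -[leRHS](sum_pweight I p); apply: ler_sum => r2 _.
  by case: (~~ _); rewrite /= ?mulr1 ?mulr0 ?pweight_ge0.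
rewrite big_split /= -mulr_suml sum_pweight mul1r.
under eq_bigr do rewrite mulr_sumr; rewrite exchange_big /=.
have H j : \sum_r1 pweight (p ^+ d) r1 * (~~ dt s (fun x => g j (app r1 x)))%:R <=
    m.+1%:R ^+ d * 2^-1 ^+ s.
  apply: le_trans (IHd _ (gA j)); rewrite [leRHS]big_mkcond; apply: ler_sum => r1 _.
  by case: (~~ _); rewrite /= ?mulr1 ?mulr0.
apply: le_trans (lerD (ler_sum _ (fun j _ => H j)) (lexx _)) _.
rewrite sumr_const card_ord -mulrnAl -[X in _ + X]mul1r -mulrDl.
apply: ler_wpM2r; first by rewrite exprn_ge0 // invr_ge0.
rewrite exprS -[m.+1%:R]natr1 mulrDl mul1r; apply: lerD.
  rewrite -mulr_natl; apply: ler_wpM2r; first by rewrite exprn_ge0 // natr1 ler0n.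
  by rewrite ler_nat.
by apply: exprn_ege1; rewrite natr1 ler1n.
Qed.


Definition meet S J : cube I := [ffun i => S i && J i].
Definition diff S J : cube I := [ffun i => S i && ~~ J i].
Definition fixout J z : pcube I := [ffun i => if J i then None else Some (z i)].

Definition cweight (q : R) J : R := \prod_i (if J i then q else 1 - q).

Lemma meetDdiff S J : meet S J + diff S J = S.
Proof. by apply/ffunP => i; rewrite cubeDE !ffunE; case: (S i); case: (J i). Qed.

Lemma chi_fixout S J z x :
  chi R S (app (fixout J z) x) = chi R (meet S J) x * chi R (diff S J) z.
Proof.
rewrite /chi -big_split; apply: eq_bigr => i _ /=; rewrite !ffunE.
by case: (S i) => //=; case: (J i); rewrite /= ?expr0 ?mulr1 ?mul1r.
Qed.

Lemma sum_pweight_fixout (q : R) (G : pcube I -> R) :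
  \sum_r pweight q r * G r = \sum_J cweight q J * avg (fun z => G (fixout J z)).
Proof.
have := sum_pushforward (fun b : bool => if b then q else 1 - q) (fun _ : bool => 2^-1)
  (fun b c => if b then None else Some c) G.
have -> : \sum_(w : pcube I) (\prod_i \sum_(b : bool) \sum_(c : bool)
    (if b then q else 1 - q) * 2^-1 * ((if b then None else Some c) == w i)%:R) * G w =
    \sum_r pweight q r * G r.
  apply: eq_bigr => w _; congr (_ * _); apply: eq_bigr => i _.
  by rewrite !big_bool /=; case: (w i) => [[]|] /=; rewrite ?eqxx /=; field.
move=> <-; apply: eq_bigr => J _; rewrite /avg mulrA mulr_sumr; apply: eq_bigr => z _.
rewrite /cweight; congr (_ * _ * _).
by rewrite prodr_const card_cube natrX -exprVn.
Qed.

(** The coefficient at T of the restricted function is the sum of fourier F S * chi (S minus J) z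
    over the sets S with trace T on J. Averaging its square over z removes the cross terms by
    orthogonality. *)
Lemma avg_fixout_tail J s F :
  avg (fun z => \sum_(T | (s < wt T)%N) fourier (fun x => F (app (fixout J z) x)) T ^+ 2) =
  \sum_(S | (s < wt (meet S J))%N) fourier F S ^+ 2.
Proof.
pose c z T := \sum_(S | meet S J == T) fourier F S * chi R (diff S J) z.
have cE z : fourier (fun x => F (app (fixout J z) x)) =1 c z.
  apply: fourier_unique => x; rewrite [F _]fourier_inversion.
  rewrite (partition_big (fun S => meet S J) predT) //=; apply: eq_bigr => T _.
  rewrite mulr_suml; apply: eq_bigr => S /eqP <-.
  by rewrite chi_fixout mulrA mulrAC.
rewrite (eq_avg (g := fun z => \sum_(T | (s < wt T)%N) c z T ^+ 2)) => [|z]; last first.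
  by apply: eq_bigr => T _; rewrite cE.
rewrite avg_sum [RHS](partition_big (fun S => meet S J) (fun T => s < wt T)%N) //=.
apply: eq_bigr => T sT.
rewrite (eq_avg (g := fun z => \sum_(S | meet S J == T) \sum_(S' | meet S' J == T)
   (fourier F S * fourier F S') * (chi R (diff S J) z * chi R (diff S' J) z))); last first.
  move=> z; rewrite expr2 /c mulr_suml; apply: eq_bigr => S _.
  by rewrite mulr_sumr; apply: eq_bigr => S' _; rewrite mulrACA.
rewrite avg_sum [RHS](eq_bigl (fun S => meet S J == T)) => [|S]; last first.
  by case: eqP => [->|]; rewrite ?sT ?andbF.
apply: eq_bigr => S /eqP ST; rewrite avg_sum (bigD1 S) ?ST //= avgZ chi_ortho eqxx mulr1.
rewrite big1 ?addr0 ?expr2 // => S' /andP[/eqP S'T S'S].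
rewrite avgZ chi_ortho; case: eqP => [dE|]; last by rewrite mulr0.
by case/eqP: S'S; rewrite -(meetDdiff S' J) -(meetDdiff S J) dE S'T ST.
Qed.

(** A tree of depth s has degree at most s, so no tail; in every other case Parseval bounds the tail
    of a 0/1 function by 1. *)
Lemma dt_fourier_tail s f :
  \sum_(T | (s < wt T)%N) fourier (fun x => (f x)%:R : R) T ^+ 2 <= (~~ dt s f)%:R.
Proof.
case: (boolP (dt s f)) => [/(dt_lowdeg R)[M /lowdeg_fourier[H _]]|_] /=.
  by rewrite big1 // => T /H ->; rewrite expr0n.
apply: le_trans (_ : \sum_T fourier (fun x => (f x)%:R : R) T ^+ 2 <= _).
  by apply: sum_sub => // T; exact: sqr_ge0.
under eq_bigr do rewrite expr2; rewrite -parseval -[leRHS](avg1 I R); apply: avg_le => x.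
by case: (f x); rewrite ?mulr1 ?mulr0 ?ler01.
Qed.

Lemma cweight_ge0 (q : R) J : 0 <= q <= 1 -> 0 <= cweight q J.
Proof.
move=> /andP[q0 q1]; apply: prodr_ge0 => i _; case: ifP => // _.
by rewrite subr_ge0.
Qed.

(** A random J of density q keeps more than s elements of a large S with probability at least 1/2.
    This is Markov's inequality for 2^-|S and J|, whose mean is (1 - q/2)^|S|. *)
Lemma cweight_meet (q : R) (s k : nat) S : 0 <= q <= 1 ->
  (1 - q / 2) ^+ k <= 2^-1 ^+ s.+1 -> (k <= wt S)%N ->
  1 / 2 <= \sum_(J | (s < wt (meet S J))%N) cweight q J.
Proof.
move=> q01 qk kS; have /andP[q0 q1] := q01.
have sumE : \sum_J cweight q J = 1.
  rewrite /cweight -(bigA_distr_bigA (fun i (b : bool) => if b then q else 1 - q)).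
  by rewrite big1 // => i _; rewrite big_bool /=; ring.
have : \sum_(J | ~~ (s < wt (meet S J))%N) cweight q J <= 2 ^+ s * (1 - q / 2) ^+ wt S.
  have -> : (1 - q / 2) ^+ wt S = \sum_J cweight q J * 2^-1 ^+ wt (meet S J).
    rewrite /wt -prodrXr; under [RHS]eq_bigr do rewrite -prodrXr /cweight -big_split /=.
    transitivity (\prod_i \sum_(b : bool) (if b then q else 1 - q) * 2^-1 ^+ (S i && b)).
      by apply: eq_bigr => i _; rewrite big_bool /=; case: (S i); rewrite /= ?expr0 ?expr1; field.
    rewrite bigA_distr_bigA; apply: eq_bigr => J _; apply: eq_bigr => i _.
    by rewrite ffunE.
  rewrite mulr_sumr big_mkcond; apply: ler_sum => J _; rewrite -leqNgt.
  case: ifP => [h|_]; last first.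
    by rewrite mulr_ge0 ?exprn_ge0 // mulr_ge0 ?cweight_ge0 ?exprn_ge0 ?invr_ge0.
  rewrite mulrCA ler_peMr ?cweight_ge0 // exprVn ler_pdivlMr ?exprn_gt0 // mul1r.
  by rewrite ler_weXn2l // ler1n.
move: sumE; rewrite (bigID (fun J => s < wt (meet S J))%N) /=.
have h0 : 0 <= 1 - q / 2 by lra.
have h1 : 1 - q / 2 <= 1 by lra.
have : (1 - q / 2) ^+ wt S <= 2^-1 ^+ s.+1 by apply: le_trans qk; apply: ler_wiXn2l.
move=> /(ler_wpM2l (exprn_ge0 s (ler0n R 2))).
rewrite [2^-1 ^+ _]exprS mulrCA -exprMn mulfV ?pnatr_eq0 // expr1n mulr1.
by lra.
Qed.

(** The squared coefficient of a set of weight at least k counts at least half in the expected tail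
    above s of the restricted function, and that tail is at most the probability that no tree of
    depth s exists. *)
Lemma fourier_tail_restriction (q : R) (s k : nat) f : 0 <= q <= 1 ->
  (1 - q / 2) ^+ k <= 2^-1 ^+ s.+1 ->
  \sum_(S | (k <= wt S)%N) fourier (fun x => (f x)%:R : R) S ^+ 2 <=
  2 * \sum_(r | ~~ dt s (fun x => f (app r x))) pweight q r.
Proof.
move=> q01 qk; set F := fun x => _.
apply: le_trans (_ : 2 * \sum_J cweight q J *
    \sum_(S | (s < wt (meet S J))%N) fourier F S ^+ 2 <= _).
  under [X in _ <= _ * X]eq_bigr do rewrite mulr_sumr big_mkcond.
  rewrite exchange_big mulr_sumr [leLHS]big_mkcond; apply: ler_sum => S _ /=.
  rewrite -big_mkcond -mulr_suml; case: ifP => [kS|_]; last first.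
    by rewrite mulr_ge0 // mulr_ge0 ?sqr_ge0 // sumr_ge0 // => J _; apply: cweight_ge0.
  rewrite mulrA ler_peMl ?sqr_ge0 //.
  by have := cweight_meet q01 qk kS; lra.
apply: ler_wpM2l => //; rewrite [leRHS]big_mkcond.
under [leRHS]eq_bigr do rewrite -mulrb -mulr_natr.
rewrite sum_pweight_fixout; apply: ler_sum => J _; apply: ler_wpM2l.
  exact: cweight_ge0.
rewrite -avg_fixout_tail; apply: avg_le => z; exact: dt_fourier_tail.
Qed.

(** An elementary substitute for (1 - u)^n <= exp(-nu); with n u = 1 it gives 1/2. *)
Lemma one_sub_exp_le (u : R) n : 0 <= u <= 1 -> (1 - u) ^+ n * (1 + n%:R * u) <= 1.
Proof.
move=> /andP[u0 u1]; elim: n => [|n IHn]; first by rewrite expr0 mul0r addr0 mulr1.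
apply: le_trans IHn; rewrite exprSr -mulrA; apply: ler_wpM2l.
  by rewrite exprn_ge0 // subr_ge0.
rewrite -natr1; have : 0 <= n%:R * u * u + u * u by rewrite addr_ge0 ?mulr_ge0 ?ler0n.
by nra.
Qed.

Lemma AC_fourier_tail d m s f : (0 < s)%N -> AC d m f ->
  \sum_(S | (2 * (32 * s) ^ d * s.+1 <= wt S)%N) fourier (fun x => (f x)%:R : R) S ^+ 2 <=
  2 * (m.+1%:R ^+ d * 2^-1 ^+ s).
Proof.
(* With p = 1 / (32 s), 16 s p is exactly 1/2. The density is p^d, so 2 (32 s)^d elements halve (1 -
   p^d / 2)^n, and s.+1 such groups reach 2^-(s.+1). *)
move=> s0 fA; pose p : R := (32 * s)%:R^-1.
have s1 : 1 <= s%:R :> R by rewrite ler1n.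
have p0 : 0 < p by rewrite invr_gt0 ltr0n muln_gt0.
have sp : 16 * s%:R * p = 1 / 2.
  by rewrite /p natrM; field; lra.
have p12 : 0 <= p <= 1 / 2 by apply/andP; split; nra.
have q01 : 0 <= p ^+ d <= 1 by apply/andP; split; [apply: exprn_ge0|apply: exprn_ile1]; lra.
apply: le_trans (fourier_tail_restriction (s := s) f q01 _) _; last first.
  by apply: ler_wpM2l => //; apply: AC_restriction => //; rewrite sp.
rewrite exprM; apply: lerXn2r; rewrite ?nnegrE ?exprn_ge0 ?invr_ge0 //; try lra.
have u01 : 0 <= p ^+ d / 2 <= 1 by lra.
have := one_sub_exp_le (2 * (32 * s) ^ d) u01.
rewrite natrM natrX (_ : _ * (_ / 2) = 1); last first.
  rewrite /p exprVn; field; rewrite -natrX pnatr_eq0 expn_eq0 muln_eq0; lia.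
set a := _ ^+ _; lra.
Qed.

End LinialMansourNisan.

(** * Approximation by low-degree polynomials *)

Section RazborovSmolensky.
Variables (R : realFieldType) (I : finType).
Implicit Types (x : cube I) (f : cube I -> bool).

Lemma AC_cst d m b : AC d m (fun _ : cube I => b).
Proof.
case: d => [|d] /=; first by left; exists b.
exists b, 0%N, (fun _ _ => false); split=> // [[//]|x].
by rewrite (_ : [exists j, _] = false) ?addbF //; apply/existsP => [[]].
Qed.

Lemma AC_mask d m (b : bool) f : AC d m f -> AC d m (fun x => b && f x).
Proof. by case: b => // _; exact: AC_cst. Qed.

Lemma AC_orS d m n h (g : 'I_n -> cube I -> bool) : (n < m)%N -> AC d m h ->
  (forall j, AC d m (g j)) -> AC d.+1 m (fun x => h x || [exists j, g j x]).
Proof.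
move=> nm hA gA; pose g' (j : 'I_n.+1) := if unlift ord0 j is Some j' then g j' else h.
have g'A j : AC d m (g' j) by rewrite /g'; case: unlift.
apply: eq_AC (AC_or nm g'A) => x; apply/existsP/orP => [[j]|[hx|/existsP[j gj]]].
- rewrite /g'; case: unlift => [j' gj|hx]; last by left.
  by right; apply/existsP; exists j'.
- by exists ord0; rewrite /g' unlift_none.
- by exists (lift ord0 j); rewrite /g' liftK.
Qed.

(** Exactly one child with index in S is true, in which case the real sum over S is 1. The event is
    written as two levels of gates above the children because the error of the approximation must
    itself be a bounded-depth function, to which the Fourier tail bound applies. *)
Definition hits_one n (g : 'I_n -> cube I -> bool) (S : cube 'I_n) x :=
  [exists j, ~~ (~~ (S j && g j x) || [exists l, ((l != j) && S l) && g l x])].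

Lemma AC_hits_one d m n (g : 'I_n -> cube I -> bool) S : (n < m)%N ->
  (forall j, AC d m (g j)) -> AC d.+2 m (hits_one g S).
Proof.
move=> nm gA; apply: AC_or; first exact: ltnW.
move=> j; apply: (AC_neg true); apply: AC_orS => // [|l].
  by apply: (AC_neg true); apply: AC_mask.
exact: AC_mask.
Qed.

Lemma hits_one_sum n (g : 'I_n -> cube I -> bool) S x : hits_one g S x ->
  \sum_(j | S j) (g j x)%:R = 1 :> R.
Proof.
case/existsP => j; rewrite negb_or negbK => /andP[/andP[Sj gj] /existsPn gl].
rewrite (bigD1 j) //= gj big1 ?addr0 // => l /andP[Sl lj].
by have := gl l; rewrite lj Sl /= => /negbTE ->.
Qed.

(** Isolation: with t true children and density q, the probability is at least t q (1 - q)^(t - 1)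
    >= t q (1 - (t - 1) q) >= 1/4 * 1/2. *)
Lemma hits_one_prob n (g : 'I_n -> cube I -> bool) (q : R) x :
  let t := (\sum_j g j x)%N in
  0 <= q <= 1 -> 1 / 4 <= t%:R * q -> t%:R * q <= 1 / 2 ->
  1 / 8 <= \sum_(S | hits_one g S x) cweight q S.
Proof.
move=> t q01 tq4 tq2; have /andP[q0 q1] := q01.
pose iso S j := [forall i, g i x ==> (S i == (i == j))].
have isoP j : g j x -> \sum_(S : cube 'I_n | iso S j) cweight q S = q * (1 - q) ^+ (t.-1).
  move=> gj; transitivity (\prod_(i < n) \sum_(b : bool)
      (if g i x ==> (b == (i == j)) then (if b then q else 1 - q) else 0)).
    rewrite bigA_distr_bigA big_mkcond; apply: eq_bigr => S _.
    case: ifPn => [/forallP Si|/forallPn[i /negbTE Si]].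
      by apply: eq_bigr => i _; rewrite Si.
    by rewrite (bigD1 i) //= Si mul0r.
  rewrite (bigD1 j) //= big_bool gj eqxx /= addr0; congr (_ * _).
  rewrite /t [X in _ ^+ X.-1](bigD1 j) //= gj -prodrXr; apply: eq_bigr => i /negbTE ij.
  by rewrite big_bool ij; case: (g i x); rewrite /= ?expr1 ?expr0 ?add0r //; ring.
apply: le_trans (_ : \sum_(j | g j x) \sum_(S : cube 'I_n | iso S j) cweight q S <= _).
  under eq_bigr => j gj do rewrite isoP //.
  rewrite sumr_const -[leRHS]mulr_natl.
  have -> : #|[pred j | g j x]| = t by rewrite /t -sum1_card big_mkcond; apply: eq_bigr => j _; rewrite inE; case: (g j x).
  clear isoP; clearbody t; case: t tq4 tq2 => [|t] /=; first by rewrite mul0r; lra.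
  move=> tq4 tq2; have : 1 - t%:R * q <= (1 - q) ^+ t.
    elim: t {tq4 tq2} => [|t IHt]; first by rewrite expr0 mul0r subr0.
    have h : (1 - t%:R * q) * (1 - q) <= (1 - q) ^+ t.+1.
      by rewrite exprSr; apply: ler_wpM2r => //; lra.
    have : 0 <= t%:R * q * q by rewrite !mulr_ge0.
    by move: h; set y := _ ^+ _; rewrite -natr1; lra.
  have tE : t.+1%:R = t%:R + 1 :> R by rewrite natr1.
  rewrite tE in tq4 tq2 *; set a := _ ^+ _; set b := t%:R in tq4 tq2 * => ha.
  have b0 : 0 <= b by rewrite ler0n.
  have : 1 / 2 <= a by nra.
  by rewrite mulrA; nra.
under eq_bigr do rewrite big_mkcond.
rewrite exchange_big [leRHS]big_mkcond; apply: ler_sum => S _ /=.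
rewrite -big_mkcondr; have cw0 := cweight_ge0 S q01.
have [j gj|no] := pickP (fun j => g j x && iso S j); last by rewrite big_pred0 //; case: ifP.
rewrite (big_pred1 j) => [|l /=].
  case: ifPn => // /existsPn/(_ j); move: gj => /andP[gj /forallP Sj].
  rewrite negbK gj /= andbT; have := Sj j; rewrite gj eqxx => /eqP -> /existsP[l].
  by move=> /andP[/andP[lj Sl] gl]; have := Sj l; rewrite gl (negbTE lj) Sl.
apply/andP/eqP => [[gl /forallP Sl]|-> //]; last exact/andP.
move: gj => /andP[gj /forallP Sj]; have := Sl j; have := Sj j.
by rewrite gj eqxx /= => /eqP -> /eqP/esym/eqP ->.
Qed.

(** A random set at a random one of a + 1 scales isolates a true child with probability at least 1 /
    (8 (a + 1)), for every x in P. Averaging over x under nu yields one fixed set that does so for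
    this fraction of the mass. *)
Lemma hits_one_step a n (g : 'I_n -> cube I -> bool) (nu : cube I -> R) (P : pred (cube I)) :
  (n <= 2 ^ a)%N -> (forall x, 0 <= nu x) -> (forall x, P x -> [exists j, g j x]) ->
  exists S, \sum_(x | P x && ~~ hits_one g S x) nu x <=
    (1 - (8 * a.+1)%:R^-1) * \sum_(x | P x) nu x.
Proof.
move=> na nu0 Pg; pose hit S := \sum_(x | P x && hits_one g S x) nu x.
pose S := [arg max_(S > (0 : cube 'I_n)) hit S]%O.
have hitS T : hit T <= hit S by rewrite /S; case: arg_maxP => // i _; apply.
exists S; suff : (8 * a.+1)%:R^-1 * \sum_(x | P x) nu x <= hit S.
  rewrite mulrBl mul1r; set c := _^-1 * _ => ch.
  by rewrite [\sum_(x | P x) _](bigID (hits_one g S)) /= -/(hit S); lra.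
rewrite natrM invfM -mulrA ler_pdivrMl ?ltr0n //.
rewrite mulrC ler_pdivrMr ?ltr0n //.
(* For t true children, the scale k = floor(log2 t) puts t * q k between 1/4 and 1/2. *)
pose q (k : 'I_a.+1) : R := (2 ^ k.+2)%:R^-1.
have q01 k : 0 <= q k <= 1.
  by rewrite invr_ge0 ler0n /= invf_le1 ?ltr0n ?expn_gt0 // ler1n expn_gt0.
have cwS k : \sum_(T : cube 'I_n) cweight (q k) T = 1.
  rewrite /cweight -(bigA_distr_bigA (fun i (b : bool) => if b then q k else 1 - q k)).
  by rewrite big1 // => i _; rewrite big_bool /=; ring.
suff : \sum_(x | P x) nu x / 8 <= \sum_(k < a.+1) \sum_(T : cube 'I_n) cweight (q k) T * hit T.
  move=> H; have : \sum_(k < a.+1) \sum_(T : cube 'I_n) cweight (q k) T * hit T <= a.+1%:R * hit S.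
    apply: le_trans (_ : \sum_(k < a.+1) hit S <= _); last first.
      by rewrite sumr_const card_ord mulr_natl.
    apply: ler_sum => k _; rewrite -[leRHS]mul1r -(cwS k) mulr_suml.
    by apply: ler_sum => T _; rewrite ler_wpM2l // cweight_ge0.
  by rewrite -mulr_suml in H; lra.
under [leRHS]eq_bigr do under eq_bigr do rewrite mulr_sumr.
under [leRHS]eq_bigr do under eq_bigr do rewrite big_mkcondr.
under [leRHS]eq_bigr do rewrite exchange_big.
rewrite exchange_big; apply: ler_sum => x Px /=.
pose t := (\sum_j g j x)%N.
have t0 : (0 < t)%N.
  by have /existsP[j gj] := Pg _ Px; rewrite /t (bigD1 j) //= gj.
have tn : (t <= 2 ^ a)%N.
  apply: leq_trans na; rewrite -[X in (_ <= X)%N](card_ord n) -sum1_card.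
  by apply: leq_sum => j _; case: (g j x).
have ka : (trunc_log 2 t < a.+1)%N.
  by rewrite ltnS -(@leq_exp2l 2) //; apply: leq_trans tn; apply: trunc_logP.
rewrite (bigD1 (Ordinal ka)) //= -[leLHS]addr0; apply: lerD; last first.
  apply: sumr_ge0 => k _; apply: sumr_ge0 => T _; case: ifP => // _.
  by rewrite mulr_ge0 ?cweight_ge0.
rewrite -big_mkcond -mulr_suml mulrC ler_wpM2r //.
rewrite -div1r; apply: hits_one_prob => //; rewrite /q /= -/t.
  rewrite ler_pdivlMr ?ltr0n ?expn_gt0 // !expnS !natrM.
  have : (2 ^ trunc_log 2 t)%:R <= t%:R :> R by rewrite ler_nat trunc_logP.
  lra.
rewrite ler_pdivrMr ?ltr0n ?expn_gt0 // !expnS !natrM.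
have : t%:R <= (2 ^ (trunc_log 2 t).+1)%:R :> R by rewrite ler_nat ltnW // trunc_log_ltn.
rewrite expnS natrM; lra.
Qed.

(** Greedy choice: each new set is taken for the mass that the earlier ones missed. *)
Lemma hits_one_iter a n r (g : 'I_n -> cube I -> bool) (nu : cube I -> R) :
  (n <= 2 ^ a)%N -> (forall x, 0 <= nu x) ->
  exists S : nat -> cube 'I_n,
    \sum_(x | [exists j, g j x] && ~~ [exists i : 'I_r, hits_one g (S i) x]) nu x <=
    (1 - (8 * a.+1)%:R^-1) ^+ r * \sum_x nu x.
Proof.
move=> na nu0; have c0 : 0 <= 1 - (8 * a.+1)%:R^-1 :> R.
  by rewrite subr_ge0 invf_le1 ?ltr0n // ler1n.
elim: r => [|r [S IH]].
  by exists (fun=> 0); rewrite expr0 mul1r; apply: sum_sub.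
pose P x := [exists j, g j x] && ~~ [exists i : 'I_r, hits_one g (S i) x].
have [x /andP[]//|T HT] := @hits_one_step a n g nu P na nu0 _.
exists (fun i => if (i < r)%N then S i else T).
rewrite exprS -mulrA; apply: le_trans (ler_wpM2l c0 IH); apply: le_trans HT.
apply: sum_sub => // x /andP[gx /existsPn hx]; rewrite /P gx /=; apply/andP; split.
  apply/existsPn => i; have := hx (widen_ord (leqnSn r) i).
  by rewrite /= ltn_ord.
by have := hx ord_max; rewrite /= ltnn.
Qed.

(** Logarithm of the l1 norm of the approximating polynomial. A sum of at most 2^a children has norm
    2^(a + v), the two increments outside the product are for the complements 1 - prod and 1 - p,
    and the one inside is for each factor 1 - sum. *)
Fixpoint rs_log_norm a r d : nat :=
  if d is d'.+1 then (r * (a + rs_log_norm a r d').+1).+2 else 1%N.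

(** The polynomial agrees exactly with f off an event e that is small and is itself of bounded
    depth. The measure nu is arbitrary, so that one polynomial can be good for two distributions at
    once. *)
Lemma razborov_smolensky a r d f (nu : cube I -> R) : (0 < a)%N -> (0 < r)%N ->
  (forall x, 0 <= nu x) -> AC d (2 ^ a) f ->
  exists p e, [/\ lowdeg (r ^ d) (2 ^+ rs_log_norm a r d : R) p,
     AC d.+3 (2 ^ (a + r)) e,
     forall x, ~~ e x -> p x = (f x)%:R
   & \sum_(x | e x) nu x <=
     (2 ^ a).+1%:R ^+ d * (1 - (8 * a.+1)%:R^-1) ^+ r * \sum_x nu x].
Proof.
move=> a0 r0 nu0; set c := (1 - _) ^+ r.
have c0 : 0 <= c by rewrite exprn_ge0 // subr_ge0 invf_le1 ?ltr0n // ler1n.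
have nuS : 0 <= \sum_x nu x by apply: sumr_ge0.
have am : (2 ^ a < 2 ^ (a + r))%N by rewrite ltn_exp2l // -addn1 leq_add2l.
elim: d f => [|d IHd] f fA.
  exists (fun x => (f x)%:R), (fun=> false); split => //.
  2: exact: AC_cst.
  2: by rewrite big_pred0 // expr0 mul1r mulr_ge0.
  rewrite expn0 expr1; case: (fA : AC 0 _ _) => [[b fb]|[b [i fb]]].
    by apply: lowdeg_ext (@lowdeg_cst I R _ _ (b%:R) _) => [x|]; rewrite ?fb // normr_nat ler_nat; case: b {fb}.
  have h1 : lowdeg 1 (1 + 1) (fun x => 1 - (x i)%:R : R).
    by apply: lowdegB (lowdeg_var _ _); apply: lowdeg_cst; rewrite normr1.
  case: b fb => fb.
    by apply: lowdeg_ext h1 => x; rewrite fb; case: (x i); rewrite /= ?subrr ?subr0.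
  by apply: lowdeg_ext (lowdegW (leqnn 1) _ (lowdeg_var R i)) => [x|]; rewrite ?fb //; lra.
case: fA => b [n [g [na gA fE]]].
have [pe peP] : exists pe : 'I_n -> (cube I -> R) * (cube I -> bool), forall j,
   [/\ lowdeg (r ^ d) (2 ^+ rs_log_norm a r d) (pe j).1, AC d.+3 (2 ^ (a + r)) (pe j).2,
     forall x, ~~ (pe j).2 x -> (pe j).1 x = (g j x)%:R
   & \sum_(x | (pe j).2 x) nu x <= (2 ^ a).+1%:R ^+ d * c * \sum_x nu x].
  elim: n {na fE} g gA => [|n IHn] g gA; first by exists (fun _ => (fun=> 0, fun=> false)); case.
  have [pe' pe'P] := IHn (fun j => g (lift ord0 j)) (fun j => gA _).
  have [p [e pP]] := IHd _ (gA ord0).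
  exists (fun j => if unlift ord0 j is Some j' then pe' j' else (p, e)) => j.
  by case: (unliftP ord0 j) => [j' ->|->].
have [S HS] := @hits_one_iter a n r g nu na nu0.
set v := rs_log_norm a r d in peP *.
pose e x := [exists j, (pe j).2 x] ||
  ([exists j, g j x] && ~~ [exists i : 'I_r, hits_one g (S i) x]).
(* If the OR is false all factors are 1; if some set isolates a true child its factor vanishes. So p
   is correct wherever the children are and some set hits. *)
pose p x := 1 - \prod_(i < r) (1 - \sum_(j | S i j) (pe j).1 x).
have gA' j : AC d (2 ^ (a + r)) (g j) by apply: AC_mon (gA j); apply: ltnW.
exists (fun x => if b then 1 - p x else p x), e; split.
- have v1 (u : nat) : 1 + 2 ^+ u <= 2 ^+ u.+1 :> R.
    by rewrite exprS; have := exprn_ege1 u (ler1n R 2); lra.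
  rewrite expnS; have pl : lowdeg (r * r ^ d) (2 ^+ (r * (a + v).+1).+1) p.
    apply: (@lowdegW _ _ (r * r ^ d) _ (1 + (2 ^+ (a + v).+1) ^+ r)) => //.
      by rewrite -exprM mulnC; exact: v1.
    have one k : lowdeg k 1 (fun _ : cube I => 1 : R) by apply: lowdeg_cst; rewrite normr1.
    apply: (lowdegB (one _)); apply: (@lowdeg_prod _ _ _ _ _
      (fun i x => 1 - \sum_(j | S i j) (pe j).1 x)) => i.
    apply: (@lowdegW _ _ (r ^ d) _ (1 + n%:R * 2 ^+ v)) => //.
      apply: le_trans (v1 _); rewrite lerD2l exprD ler_wpM2r ?exprn_ge0 //.
      by rewrite -natrX ler_nat.
    apply: (lowdegB (one _)); apply: (lowdeg_sum (F := fun j => (pe j).1)) => [|j].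
      by rewrite exprn_ge0.
    by case: (peP j).
  case: b fE => _.
    apply: lowdegW (leqnn _) (v1 _) _; apply: lowdegB => //.
    by apply: lowdeg_cst; rewrite normr1.
  by apply: lowdegW pl => //; rewrite ler_weXn2l // ler1n.
- apply: (@eq_AC _ _ _ (fun x => ([exists j, g j x] && ~~ [exists i : 'I_r, hits_one g (S i) x])
       || [exists j, (pe j).2 x])) => [x|]; first by rewrite /e orbC.
  apply: AC_orS => [||j]; last by case: (peP j).
    exact: leq_ltn_trans na am.
  apply: (@eq_AC _ _ _ (fun x => true (+) (~~ [exists j, g j x] || [exists i : 'I_r, hits_one g (S i) x]))).
    by move=> x /=; rewrite negb_or negbK.
  apply: AC_neg; apply: AC_orS => [||i].
  + apply: leq_trans (ltn_expl r (isT : (1 < 2)%N)) _.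
    by rewrite leq_exp2l // leq_addl.
  + apply: (AC_neg true); apply: AC_S; first by rewrite expn_gt0.
    by apply: AC_or => //; apply: leq_trans na (ltnW am).
  + by apply: AC_hits_one => //; apply: leq_ltn_trans na am.
- move=> x; rewrite /e negb_or => /andP[/existsPn ne hx].
  have pg j : (pe j).1 x = (g j x)%:R by case: (peP j) => _ _ ->.
  have -> : p x = ([exists j, g j x])%:R.
    rewrite /p; under eq_bigr do under eq_bigr do rewrite pg.
    case: (boolP [exists j, g j x]) hx => [_ /negPn|/existsPn ng _]; last first.
      rewrite big1 ?subrr // => i _; rewrite big1 ?subr0 // => j _.
      by rewrite (negbTE (ng j)).
    by move=> /existsP[i hi]; rewrite (bigD1 i) //= hits_one_sum // subrr mul0r subr0.
  by rewrite fE; case: b {fE}; case: [exists j, _]; rewrite /= ?subrr ?subr0.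
- apply: le_trans (_ : \sum_(x | [exists j, (pe j).2 x]) nu x + c * \sum_x nu x <= _).
    rewrite (bigID (fun x => [exists j, (pe j).2 x])) /=; apply: lerD.
      by apply: sum_sub => // x /andP[].
    by apply: le_trans HS; apply: sum_sub => // x /andP[/orP[->|]].
  apply: le_trans (_ : \sum_(j < n) (2 ^ a).+1%:R ^+ d * c * \sum_x nu x + c * \sum_x nu x <= _).
    rewrite lerD2r; apply: le_trans (_ : \sum_(j < n) \sum_(x | (pe j).2 x) nu x <= _).
      by apply: (sum_cover (Q := fun j => (pe j).2)) => // x /existsP.
    by apply: ler_sum => j _; case: (peP j).
  rewrite sumr_const card_ord -[X in X + _]mulr_natl 2!mulrA -!mulrDl.
  apply: ler_wpM2r => //; rewrite -[X in _ + X <= _]mul1r -mulrDl; apply: ler_wpM2r => //.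
  have y1 : 1 <= (2 ^ a).+1%:R ^+ d :> R by apply: exprn_ege1; rewrite ler1n.
  rewrite exprS; set y := _ ^+ d in y1 *.
  rewrite -[(2 ^ a).+1%:R]natr1 mulrDl mul1r; apply: lerD => //.
  by apply: ler_wpM2r; [lra|rewrite ler_nat].
Qed.

End RazborovSmolensky.

(** * Small-bias distributions fool bounded-depth circuits *)

Section Braverman.
Variables (R : realFieldType) (I : finType).
Implicit Types (S x : cube I) (f : cube I -> bool) (F : cube I -> R).

Definition truncate k F x : R := \sum_(S | (wt S < k)%N) fourier F S * chi R S x.

Lemma fourier_truncate k F S :
  fourier (truncate k F) S = if (wt S < k)%N then fourier F S else 0.
Proof.
apply: (fourier_unique (c := fun S => if (wt S < k)%N then fourier F S else 0)) => x.
by rewrite /truncate big_mkcond; apply: eq_bigr => T _; case: ifP; rewrite ?mul0r.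
Qed.

Lemma fourierB F G S : fourier (fun x => F x - G x) S = fourier F S - fourier G S.
Proof.
rewrite /fourier /avg -mulrBr -sumrB; congr (_ * _).
by apply: eq_bigr => x _; rewrite mulrBl.
Qed.

Lemma truncate_dist k F :
  avg (fun x => (F x - truncate k F x) ^+ 2) = \sum_(S | (k <= wt S)%N) fourier F S ^+ 2.
Proof.
rewrite (eq_avg (g := fun x => (F x - truncate k F x) * (F x - truncate k F x))) => [|x].
  rewrite parseval [RHS]big_mkcond; apply: eq_bigr => S _.
  rewrite fourierB fourier_truncate; case: ltnP => _ /=.
    by rewrite subrr mul0r.
  by rewrite subr0 expr2.
by rewrite expr2.
Qed.

Lemma fourier_norm F S : (forall x, `|F x| <= 1) -> `|fourier F S| <= 1.
Proof.
move=> F1; rewrite /fourier /avg normrM ger0_norm ?invr_ge0 ?ler0n //.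
apply: le_trans (ler_wpM2l _ (ler_norm_sum _ _ _)) _; first by rewrite invr_ge0 ler0n.
apply: le_trans (_ : avg (fun _ : cube I => 1 : R) <= _); last by rewrite avg1.
by apply: avg_le => x; rewrite normrM chi_norm mulr1.
Qed.

(** With y = 2^-(a + 1), each coefficient of weight below k is at most 1 <= y^-k y^|S|, and the sum
    of y^|S| over all S is (1 + y)^|I| <= 2. *)
Lemma lowdeg_truncate a k F : (#|I| <= 2 ^ a)%N -> (forall x, `|F x| <= 1) ->
  lowdeg k (2 ^+ (a.+1 * k).+1) (truncate k F).
Proof.
move=> Ia F1; exists (fun S => if (wt S < k)%N then fourier F S else 0); split.
- move=> x; rewrite /truncate big_mkcond; apply: eq_bigr => T _.
  by case: ifP; rewrite ?mul0r.
- by move=> S kS; rewrite ltnNge ltnW.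
pose y : R := 2^-1 ^+ a.+1.
have y0 : 0 < y by rewrite exprn_gt0 // invr_gt0.
have y1 : y <= 1 by rewrite exprn_ile1 // ?invr_ge0 //; lra.
apply: le_trans (_ : \sum_(S : cube I) 2 ^+ (a.+1 * k) * y ^+ wt S <= _).
  apply: ler_sum => S _; case: ifP => [Sk|_]; last first.
    by rewrite normr0 mulr_ge0 // exprn_ge0 // ltW.
  apply: le_trans (fourier_norm S F1) _.
  have -> : 2 ^+ (a.+1 * k) = y^-1 ^+ k by rewrite exprM /y -[X in X ^+ k = _]invrK -exprVn.
  rewrite exprVn mulrC ler_pdivlMr ?exprn_gt0 ?invr_gt0 // mul1r.
  by apply: ler_wiXn2l => //; [exact: ltW|exact: ltnW].
rewrite -mulr_sumr exprS [leRHS]mulrC; apply: ler_wpM2l; first by rewrite exprn_ge0.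
have -> : \sum_(S : cube I) y ^+ wt S = (1 + y) ^+ #|I|.
  transitivity (\sum_(S : cube I) \prod_i y ^+ S i).
    by apply: eq_bigr => S _; rewrite /wt -prodrXr.
  rewrite -(bigA_distr_bigA (fun i (b : bool) => y ^+ b)) -prodr_const.
  by apply: eq_bigr => i _; rewrite big_bool /= expr0 expr1 addrC.
apply: exp_le_2; first exact: ltW.
apply: le_trans (_ : 2 ^+ a * y <= _).
  by apply: ler_wpM2r; [exact: ltW|rewrite -natrX ler_nat].
by rewrite /y exprS mulrCA -exprMn mulfV ?pnatr_eq0 // expr1n; lra.
Qed.

Definition expect (mu : cube I -> R) F : R := \sum_x mu x * F x.

(** The constant coefficient is the uniform mean; every other character in the expansion contributes
    at most Delta times its coefficient. *)
Lemma expect_lowdeg (mu : cube I -> R) k M F Delta : \sum_x mu x = 1 -> 0 <= Delta ->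
  (forall S, (0 < wt S <= k)%N -> `|expect mu (chi R S)| <= Delta) ->
  lowdeg k M F -> `|expect mu F - avg F| <= Delta * M.
Proof.
move=> mu1 D0 muD [c [cE ck cM]].
have -> : avg F = c 0 by rewrite -fourier0 (fourier_unique cE).
have -> : expect mu F = \sum_S c S * expect mu (chi R S).
  rewrite /expect; under eq_bigr do rewrite cE mulr_sumr.
  rewrite exchange_big; apply: eq_bigr => S _; rewrite mulr_sumr.
  by apply: eq_bigr => x _; rewrite mulrCA.
have h0 : expect mu (chi R 0) = 1.
  by rewrite -mu1; apply: eq_bigr => x _; rewrite chi0l mulr1.
rewrite (bigD1 (0 : cube I)) //= h0 mulr1 addrAC subrr add0r.
apply: le_trans (ler_norm_sum _ _ _) _.
apply: le_trans (_ : \sum_(S : cube I | S != 0) Delta * `|c S| <= _).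
  apply: ler_sum => S S0; rewrite normrM mulrC; have [Sk|kS] := leqP (wt S) k.
    by apply: ler_wpM2r => //; apply: muD; rewrite wt_gt0 S0.
  by rewrite ck // normr0 !mulr0.
rewrite -mulr_sumr; apply: ler_wpM2l => //; apply: le_trans cM.
by apply: sum_sub.
Qed.

Section Fool.
Variables (a r s d : nat) (mu : cube I -> R) (Delta : R).
Hypotheses (a0 : (0 < a)%N) (r0 : (0 < r)%N) (s0 : (0 < s)%N).
Hypotheses (mu0 : forall x, 0 <= mu x) (mu1 : \sum_x mu x = 1) (D0 : 0 <= Delta).
Hypothesis Ia : (#|I| <= 2 ^ a)%N.

(** [eps] bounds the error mass of the approximation per unit of mass and [v] is the logarithm of
    its norm; [tau] bounds the Fourier tail of the error event beyond weight [k], and [ml] the norm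
    of the sandwiching polynomial. The depth d.+3 and fan-in 2^(a + r) are those of the error
    event. *)
Let eps : R := (2 ^ a).+1%:R ^+ d * (1 - (8 * a.+1)%:R^-1) ^+ r.
Let v := rs_log_norm a r d.
Let tau : R := 2 * ((2 ^ (a + r)).+1%:R ^+ d.+3 * 2^-1 ^+ s).
Let k := (2 * (32 * s) ^ d.+3 * s.+1)%N.
Let ml : R := 1 + (1 + 2 ^+ v * (1 + 2 ^+ (a.+1 * k).+1)) ^+ 2.

Hypothesis muD : forall S, (0 < wt S <= 2 * (r ^ d + k))%N -> `|expect mu (chi R S)| <= Delta.

(* The lower sandwiching polynomial is 1 - (1 - p (1 - e~))^2, where p agrees
   with f off the error indicator e and e~ is the truncation of e. *)
Lemma fool_lower f : AC d (2 ^ a) f ->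
  avg (fun x => (f x)%:R) - (6 * eps + 2 * ((2 ^+ v) ^+ 2 * tau) + Delta * ml) <=
  expect mu (fun x => (f x)%:R).
Proof.
(* The sum of mu and the uniform distribution, of total mass 2: the error event is then at most 2 *
   [eps] under each of them. *)
move=> fA; pose nu x := mu x + #|cube I|%:R^-1.
have u0 : 0 <= #|cube I|%:R^-1 :> R by rewrite invr_ge0 ler0n.
have nu0 x : 0 <= nu x by rewrite addr_ge0.
have [p [e [pl eA pf nue]]] := razborov_smolensky a0 r0 nu0 fA.
have nuS : \sum_x nu x = 2.
  rewrite /nu big_split /= mu1 sumr_const -[_^-1 *+ _]mulr_natr mulVf //.
  exact: card_cube_neq0.
rewrite nuS -/eps in nue.
have [mue ue] : \sum_(x | e x) mu x <= 2 * eps /\ avg (fun x => (e x)%:R) <= 2 * eps.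
  have -> : avg (fun x => (e x)%:R) = \sum_(x | e x) #|cube I|%:R^-1 :> R.
    rewrite /avg mulr_sumr [RHS]big_mkcond; apply: eq_bigr => x _.
    by case: (e x); rewrite ?mulr1 ?mulr0.
  move: nue; rewrite /nu big_split /= => nue.
  have h1 : 0 <= \sum_(x | e x) mu x by apply: sumr_ge0.
  have h2 : 0 <= \sum_(x | e x) #|cube I|%:R^-1 :> R by apply: sumr_ge0.
  by split; lra.
pose E x : R := (e x)%:R; pose et := truncate k E.
have E1 x : `|E x| <= 1 by rewrite /E; case: (e x); rewrite ?normr1 ?normr0.
have etl : lowdeg k (2 ^+ (a.+1 * k).+1) et by apply: lowdeg_truncate.
have Et : avg (fun x => (E x - et x) ^+ 2) <= tau.
  by rewrite truncate_dist; apply: AC_fourier_tail.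
pose p' x := p x * (1 - et x).
pose fl x := 1 - (1 - p' x) * (1 - p' x).
have one j : lowdeg j 1 (fun _ : cube I => 1 : R) by apply: lowdeg_cst; rewrite normr1.
have fll : lowdeg (2 * (r ^ d + k)) ml fl.
  rewrite /ml mul2n -addnn expr2; apply: (lowdegB (one _)).
  have H : lowdeg (r ^ d + k) (1 + 2 ^+ v * (1 + 2 ^+ (a.+1 * k).+1)) (fun x => 1 - p' x).
    by apply: (lowdegB (one _)); apply: lowdegM pl _; apply: (lowdegB (one _)).
  exact: (lowdegM H H).
have /ler_normlP[h1 h2] := expect_lowdeg mu1 D0 muD fll.
(* The polynomial lies below f or e, not below f. Where F = 0, both f and e fail, so p and hence
   [fl] vanish; where F = 1, the gap is the square (1 - p')^2. *)
pose F x : R := (f x || e x)%:R.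
have FE x : F x - fl x = (F x - p' x) ^+ 2.
  rewrite /F /fl; have [fe|] := boolP (f x || e x); first by rewrite /=; ring.
  rewrite negb_or => /andP[/negbTE fx ex].
  by rewrite /p' pf // fx /= mul0r; ring.
have Fmu : expect mu fl <= expect mu F.
  apply: ler_sum => x _; apply: ler_wpM2l => //; rewrite -subr_ge0 FE.
  exact: sqr_ge0.
have Fmu' : expect mu F <= expect mu (fun x => (f x)%:R) + \sum_(x | e x) mu x.
  rewrite /expect [X in _ <= _ + X]big_mkcond -big_split; apply: ler_sum => x _ /=.
  rewrite /F; case: (f x); case: (e x); rewrite /= ?mulr1 ?mulr0 ?addr0 ?add0r //.
  by rewrite lerDl.
have Fav : avg (fun x => (f x)%:R) <= avg F.
  by apply: avg_le => x; rewrite /F ler_nat; case: (f x).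
(* On e, (1 - p (1 - et))^2 <= 2 + 2 p^2 (E - et)^2; off e, F = p and the gap is (p et)^2. So p only
   multiplies the truncation error of E, which [tau] controls in mean square. *)
have Fd : avg F - avg fl <= 2 * avg E + 2 * ((2 ^+ v) ^+ 2 * tau).
  apply: le_trans (_ : avg (fun x => 2 * E x + 2 * (2 ^+ v) ^+ 2 * (E x - et x) ^+ 2) <= _).
    have -> : avg F - avg fl = avg (fun x => F x - fl x).
      by rewrite /avg -mulrBr -sumrB.
    apply: avg_le => x; rewrite FE.
    have pn : p x ^+ 2 <= (2 ^+ v) ^+ 2.
      by rewrite -real_normK ?num_real // lerXn2r ?nnegrE ?exprn_ge0 // (lowdeg_norm x pl).
    apply: le_trans (_ : 2 * E x + 2 * (p x ^+ 2 * (E x - et x) ^+ 2) <= _); last first.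
      by rewrite lerD2l -[leRHS]mulrA; apply: ler_wpM2l => //; apply: ler_wpM2r => //; exact: sqr_ge0.
    rewrite /F /p' /E; have [ex|ex] := boolP (e x).
      rewrite orbT /= -subr_ge0.
      have -> : 2 * 1 + 2 * (p x ^+ 2 * (1 - et x) ^+ 2) - (1 - p x * (1 - et x)) ^+ 2 =
        (1 + p x * (1 - et x)) ^+ 2 :> R by ring.
      exact: sqr_ge0.
    rewrite orbF -(pf _ ex) /= -subr_ge0.
    have -> : 2 * 0 + 2 * (p x ^+ 2 * (0 - et x) ^+ 2) - (p x - p x * (1 - et x)) ^+ 2 =
        (p x * et x) ^+ 2 :> R by ring.
    exact: sqr_ge0.
  rewrite avgD !avgZ lerD2l -mulrA; do 2!apply: ler_wpM2l => //.
(* The 6 [eps] are the 2 [eps] of e under mu and twice its uniform mass 2 [eps]. *)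
by move: h1 h2 ue Fd; rewrite -/E; lra.
Qed.

End Fool.

(** The class is closed under negation, so the lower bound for 1 - f is the upper bound for f. *)
Lemma AC_expect_dist a r s d (mu : cube I -> R) Delta f :
  (0 < a)%N -> (0 < r)%N -> (0 < s)%N -> (#|I| <= 2 ^ a)%N ->
  (forall x, 0 <= mu x) -> \sum_x mu x = 1 -> 0 <= Delta ->
  let eps := (2 ^ a).+1%:R ^+ d * (1 - (8 * a.+1)%:R^-1) ^+ r in
  let v := rs_log_norm a r d in
  let tau := 2 * ((2 ^ (a + r)).+1%:R ^+ d.+3 * 2^-1 ^+ s) in
  let k := (2 * (32 * s) ^ d.+3 * s.+1)%N in
  (forall S, (0 < wt S <= 2 * (r ^ d + k))%N -> `|expect mu (chi R S)| <= Delta) ->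
  AC d (2 ^ a) f ->
  `|expect mu (fun x => (f x)%:R) - avg (fun x => (f x)%:R)| <=
    6 * eps + 2 * ((2 ^+ v) ^+ 2 * tau) +
    Delta * (1 + (1 + 2 ^+ v * (1 + 2 ^+ (a.+1 * k).+1)) ^+ 2).
Proof.
move=> a0 r0 s0 Ia mu0 mu1 D0 eps v tau k muD fA.
have H := fool_lower a0 r0 s0 mu0 mu1 D0 Ia muD.
have h1 := H f fA; have h2 := H _ (AC_neg true fA).
have eN : expect mu (fun x => (true (+) f x)%:R) = 1 - expect mu (fun x => (f x)%:R).
  rewrite -[X in X - _]mu1 /expect -sumrB; apply: eq_bigr => x _.
  by case: (f x); rewrite /= ?mulr1 ?mulr0 ?subrr ?subr0.
have aN : avg (fun x => (true (+) f x)%:R) = 1 - avg (fun x => (f x)%:R) :> R.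
  rewrite -[X in X - _](avg1 I R) /avg -mulrBr -sumrB; congr (_ * _); apply: eq_bigr => x _.
  by case: (f x); rewrite /= ?subrr ?subr0.
rewrite eN aN in h2; move: h1 h2; rewrite -/eps -/v -/tau -/k => h1 h2.
by apply/ler_normlP; split; lra.
Qed.

End Braverman.

(** * Choice of the parameters as powers of the logarithm of the size *)

Definition polylike (h : nat -> nat) := exists B, forall a, (1 < a)%N -> (h a <= a ^ B)%N.

Lemma polylike_id : polylike id.
Proof. by exists 1%N => a _; rewrite expn1. Qed.

(** Restricting to a > 1 lets powers of a absorb constants, so the exponent B never has to be
    computed. *)
Lemma polylike_cst c : polylike (fun=> c).
Proof. by exists c => a a1; apply: leq_trans (ltnW (ltn_expl c a1)) _. Qed.

Lemma polylikeM g h : polylike g -> polylike h -> polylike (fun a => g a * h a)%N.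
Proof.
move=> [B gB] [C hC]; exists (B + C)%N => a a1.
by rewrite expnD; apply: leq_mul; [apply: gB|apply: hC].
Qed.

Lemma polylikeD g h : polylike g -> polylike h -> polylike (fun a => g a + h a)%N.
Proof.
move=> [B gB] [C hC]; exists (B + C).+1 => a a1.
apply: leq_trans (_ : a ^ (B + C) + a ^ (B + C) <= _)%N.
  have a0 : (0 < a)%N by apply: ltnW.
  by apply: leq_add; [apply: leq_trans (gB a a1) _|apply: leq_trans (hC a a1) _];
    rewrite leq_pexp2l ?leq_addr ?leq_addl.
by rewrite addnn -mul2n expnS leq_mul2r a1 orbT.
Qed.

Lemma polylikeS g : polylike g -> polylike (fun a => (g a).+1).
Proof. by move=> gP; have := polylikeD (polylike_cst 1) gP. Qed.

Lemma polylikeX g e : polylike g -> polylike (fun a => g a ^ e)%N.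
Proof.
move=> [B gB]; exists (B * e)%N => a a1; rewrite expnM.
by case: e => [//|e]; rewrite leq_exp2r // gB.
Qed.

Lemma polylike_rs_log_norm d r : polylike r -> polylike (fun a => rs_log_norm a (r a) d).
Proof.
move=> rP; elim: d => [|d IHd]; first exact: polylike_cst.
by do 2!apply: polylikeS; apply: polylikeM => //; apply: polylikeS;
  apply: polylikeD => //; exact: polylike_id.
Qed.

(** Braverman's theorem for small bias. B depends on the depth alone, and a is the logarithm of the
    fan-in as well as the number of bits of accuracy. *)
Theorem AC_fooled (d : nat) : exists B : nat, forall (R : realFieldType) (I : finType)
    (a : nat) (mu : cube I -> R) (f : cube I -> bool),
  (1 < a)%N -> (#|I| <= 2 ^ a)%N -> (forall x, 0 <= mu x) -> \sum_x mu x = 1 ->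
  (forall S, (0 < wt S <= a ^ B)%N -> `|expect mu (chi R S)| <= 2^-1 ^+ (a ^ B)) ->
  AC d (2 ^ a) f ->
  `|expect mu (fun x => (f x)%:R) - avg (fun x => (f x)%:R)| <= 2^-1 ^+ a.
Proof.
(* As (1 - 1 / (8 (a + 1)))^(8 (a + 1)) <= 1/2, [r] sets leave 2^-b, and [b] also pays for (2^a +
   1)^d. Likewise [s] pays for the squared norm 2^(2v) and the factor in [tau], and [D] for the l1
   norm of the sandwiching polynomial. What remains is (6/64 + 1/4 + 1/4) 2^-a. *)
pose b a := (a + 6 + a.+1 * d)%N; pose r a := (8 * a.+1 * b a)%N.
pose v a := rs_log_norm a (r a) d.
pose s a := (2 * v a + (a + r a).+1 * d.+3 + (a + 4))%N.
pose k a := (2 * (32 * s a) ^ d.+3 * (s a).+1)%N.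
pose D a := (a + 2 + (2 * (v a + (a.+1 * k a).+1.+2)).+1)%N.
have idP := polylike_id; have cP := polylike_cst.
have bP : polylike b.
  by apply: polylikeD; [apply: polylikeD|apply: polylikeM; first apply: polylikeS].
have rP : polylike r.
  by apply: polylikeM => //; apply: polylikeM => //; apply: polylikeS.
have vP : polylike v by exact: polylike_rs_log_norm.
have sP : polylike s.
  apply: polylikeD; last exact: polylikeD.
  apply: polylikeD; first exact: polylikeM.
  by apply: polylikeM => //; apply: polylikeS; apply: polylikeD.
have kP : polylike k.
  apply: polylikeM; last exact: polylikeS.
  by apply: polylikeM => //; apply: polylikeX; apply: polylikeM.
have DP : polylike D.
  apply: polylikeD; first exact: polylikeD.
  apply: polylikeS; apply: polylikeM => //; apply: polylikeD => //.
  by do 3!apply: polylikeS; apply: polylikeM => //; apply: polylikeS.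
have [B HB] : polylike (fun a => D a + 2 * (r a ^ d + k a))%N.
  apply: polylikeD => //; apply: polylikeM => //; apply: polylikeD => //.
  exact: polylikeX.
exists B => R I a mu f a1 Ia mu0 mu1 muD fA.
have a0 : (0 < a)%N := ltnW a1.
have r0 : (0 < r a)%N by rewrite /r /b !muln_gt0 !addn_gt0 orbT.
have s0 : (0 < s a)%N by rewrite /s !addn_gt0 orbT.
have BD : (D a <= a ^ B)%N := leq_trans (leq_addr _ _) (HB a a1).
have B2 : (2 * (r a ^ d + k a) <= a ^ B)%N := leq_trans (leq_addl _ _) (HB a a1).
have h01 : 0 <= 2^-1 :> R by rewrite invr_ge0.
have h11 : 2^-1 <= 1 :> R by lra.
have Dl0 : 0 <= 2^-1 ^+ (a ^ B) :> R by rewrite exprn_ge0.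
apply: le_trans (AC_expect_dist a0 r0 s0 Ia mu0 mu1 Dl0 _ fA) _ => [S /andP[S0 S1]|].
  by apply: muD; rewrite S0 (leq_trans S1).
have two u : 1 <= 2 ^+ u :> R by apply: exprn_ege1; rewrite ler1n.
have twoS u : 1 + 2 ^+ u <= 2 ^+ u.+1 :> R by rewrite exprS; have := two u; lra.
have succ u : (2 ^ u).+1%:R <= 2 ^+ u.+1 :> R by rewrite -natr1 natrX addrC twoS.
have half u w : 2 ^+ u * 2^-1 ^+ (u + w) = 2^-1 ^+ w :> R.
  by rewrite exprD mulrA -exprMn mulfV ?pnatr_eq0 // expr1n mul1r.
have ha0 : 0 <= 2^-1 ^+ a :> R by rewrite exprn_ge0.
have e1 : (2 ^ a).+1%:R ^+ d * (1 - (8 * a.+1)%:R^-1) ^+ r a <= 2^-1 ^+ (a + 6) :> R.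
  apply: le_trans (_ : 2 ^+ (a.+1 * d) * 2^-1 ^+ b a <= _); last first.
    by rewrite /b addnC half.
  apply: ler_pM; rewrite ?exprn_ge0 //.
  - by rewrite subr_ge0 invf_le1 ?ltr0n // ler1n.
  - by rewrite exprM lerXn2r ?nnegrE ?exprn_ge0.
  - rewrite /r exprM lerXn2r ?nnegrE ?exprn_ge0 ?subr_ge0 ?invf_le1 ?ltr0n ?ler1n //.
    have u01 : 0 <= ((8 * a.+1)%:R^-1 : R) <= 1 by rewrite invr_ge0 ler0n invf_le1 ?ltr0n ?ler1n.
    have := one_sub_exp_le (8 * a.+1) u01; rewrite mulfV ?pnatr_eq0 //.
    set y := _ ^+ _; lra.
have e2 : 2 * ((2 ^+ v a) ^+ 2 * (2 * ((2 ^ (a + r a)).+1%:R ^+ d.+3 * 2^-1 ^+ s a))) <= 2^-1 ^+ (a + 2) :> R.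
  apply: le_trans (_ : 2 ^+ 2 * (2 ^+ (2 * v a + (a + r a).+1 * d.+3) * 2^-1 ^+ s a) <= _); last first.
    by rewrite /s half (_ : a + 4 = 2 + (a + 2))%N ?half //; lia.
  have -> : 2 * ((2 ^+ v a) ^+ 2 * (2 * ((2 ^ (a + r a)).+1%:R ^+ d.+3 * 2^-1 ^+ s a))) =
      2 ^+ 2 * ((2 ^+ (2 * v a) * (2 ^ (a + r a)).+1%:R ^+ d.+3) * 2^-1 ^+ s a) :> R.
    by rewrite (mulnC 2) exprM; ring.
  apply: ler_wpM2l; [exact: exprn_ge0|apply: ler_wpM2r; first exact: exprn_ge0].
  rewrite exprD; apply: ler_wpM2l; first exact: exprn_ge0.
  by rewrite exprM; apply: lerXn2r; rewrite ?nnegrE ?exprn_ge0.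
have e3 : 2^-1 ^+ (a ^ B) * (1 + (1 + 2 ^+ v a * (1 + 2 ^+ (a.+1 * k a).+1)) ^+ 2) <= 2^-1 ^+ (a + 2) :> R.
  apply: le_trans (_ : 2^-1 ^+ D a * 2 ^+ (2 * (v a + (a.+1 * k a).+1.+2)).+1 <= _); last first.
    by rewrite mulrC /D [(a + 2 + _)%N]addnC half.
  apply: ler_pM; [exact: exprn_ge0| |exact: ler_wiXn2l|].
    by rewrite addr_ge0 ?exprn_ge0 ?addr_ge0 ?mulr_ge0 ?addr_ge0 ?exprn_ge0.
  apply: le_trans (twoS _); rewrite lerD2l [(2 * (v a + _))%N]mulnC [2 ^+ (_ * 2)]exprM.
  apply: lerXn2r; rewrite ?nnegrE ?addr_ge0 ?mulr_ge0 ?addr_ge0 ?exprn_ge0 //.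
  apply: le_trans (_ : 1 + 2 ^+ (v a + (a.+1 * k a).+2) <= _); last by rewrite [in leRHS]addnS; apply: twoS.
  by rewrite lerD2l exprD ler_wpM2l ?exprn_ge0.
move: e1 e2 e3; rewrite ![2^-1 ^+ (a + _)]exprD; set z := 2^-1 ^+ a in ha0 *.
have -> : 2^-1 ^+ 6 = 64^-1 :> R by field.
have -> : 2^-1 ^+ 2 = 4^-1 :> R by field.
lra.
Qed.

(** * From circuits with numbered wires to bounded-depth formulas *)

Section Circuits.
Variable N : nat.
Implicit Types x : cube 'I_N.

Definition wires_after (ls : seq (seq cgate)) (v : seq bool) : seq bool :=
  foldl (fun v L => v ++ [seq cgate_eval v g | g <- L]) v ls.

Definition input_bits x : seq bool := [seq x i | i <- enum 'I_N].

Lemma size_wires_after ls v : size (wires_after ls v) = (size v + size (flatten ls))%N.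
Proof.
elim: ls v => [|L ls IH] v /=; first by rewrite addn0.
by rewrite /wires_after /= in IH *; rewrite IH !size_cat size_map addnA.
Qed.

(** A gate may list a wire repeatedly or name wires that do not exist. Numbers beyond the range are
    collapsed to sz, which still reads as false, and repetitions are dropped, so the fan-in is at
    most sz + 1. *)
Definition distinct_wires sz (s : seq nat) := undup (map (minn sz) s).

Lemma size_distinct_wires sz s : (size (distinct_wires sz s) <= sz.+1)%N.
Proof.
rewrite -(size_iota 0 sz.+1); apply: uniq_leq_size; first exact: undup_uniq.
by move=> j; rewrite mem_undup mem_iota => /mapP[i _ ->]; rewrite ltnS geq_minl.
Qed.

Lemma nth_minn_size (v : seq bool) j : nth false v (minn (size v) j) = nth false v j.
Proof.
by rewrite /minn; case: ltnP => // h; rewrite [LHS]nth_default // [RHS]nth_default // ltnW.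
Qed.

Lemma has_distinct_wires (v : seq bool) s :
  has (nth false v) s = [exists k : 'I_(size (distinct_wires (size v) s)),
                           nth false v (nth 0%N (distinct_wires (size v) s) k)].
Proof.
set t := distinct_wires _ _.
apply/hasP/existsP => [[j js vj]|[k vk]].
  have jt : minn (size v) j \in t by rewrite mem_undup map_f.
  exists (Ordinal (etrans (index_mem _ _) jt)) => /=.
  by rewrite nth_index // nth_minn_size.
have : nth 0%N t k \in t by exact: mem_nth.
rewrite mem_undup => /mapP[j js jE]; exists j => //.
by move: vk; rewrite jE nth_minn_size.
Qed.

Lemma AC_cgate d m (v : cube 'I_N -> seq bool) sz g : (sz < m)%N ->
  (forall x, size (v x) = sz) ->
  (forall j, AC d m (fun x => nth false (v x) j)) ->
  AC d.+1 m (fun x => cgate_eval (v x) g).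
Proof.
move=> szm vsz vA; have m0 : (0 < m)%N by apply: leq_ltn_trans szm.
case: g => [s|s|i] /=.
- apply: (@eq_AC _ _ _ (fun x => true (+) [exists k : 'I_(size (distinct_wires sz s)),
      ~~ nth false (v x) (nth 0%N (distinct_wires sz s) k)])) => [x|].
    rewrite /= -(vsz x) -[all _ _]negbK -has_predC; congr (~~ _).
    set t := distinct_wires _ _; apply/existsP/hasP => [[k vk]|[j js vj]].
      have : nth 0%N t k \in t by exact: mem_nth.
      rewrite mem_undup => /mapP[j js jE]; exists j => //=.
      by move: vk; rewrite jE nth_minn_size.
    have jt : minn (size (v x)) j \in t by rewrite mem_undup map_f.
    exists (Ordinal (etrans (index_mem _ _) jt)) => /=.
    by rewrite nth_index // nth_minn_size.
  apply: AC_neg; apply: AC_or => [|k]; last exact: (AC_neg true).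
  exact: leq_trans (size_distinct_wires _ _) szm.
- apply: (@eq_AC _ _ _ (fun x => [exists k : 'I_(size (distinct_wires sz s)),
      nth false (v x) (nth 0%N (distinct_wires sz s) k)])) => [x|].
    by rewrite has_distinct_wires vsz.
  apply: AC_or => [|k]; last exact: vA.
  exact: leq_trans (size_distinct_wires _ _) szm.
- by apply: AC_S => //; apply: (AC_neg true).
Qed.

(** A bound m above the number of all wires bounds every fan-in at once, and unfolding the layers
    into formulas costs nothing. *)
Lemma AC_wires_after ls m : (N + size (flatten ls) < m)%N ->
  forall j, AC (size ls) m (fun x => nth false (wires_after ls (input_bits x)) j).
Proof.
elim/last_ind: ls => [|ls L IH] lsm j.
  rewrite /wires_after /=; have [jN|Nj] := ltnP j N; last first.
    left; exists false => x; rewrite nth_default // size_map -cardE card_ord //.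
  right; exists false, (Ordinal jN) => x.
  rewrite (nth_map (Ordinal jN)) ?size_enum_ord //=; congr (x _).
  exact: (nth_ord_enum (Ordinal jN) (Ordinal jN)).
rewrite -cats1 flatten_cat size_cat /= cats0 in lsm.
have {}IH := IH (leq_ltn_trans (leq_add (leqnn N) (leq_addr _ _)) lsm).
have szE x : size (wires_after ls (input_bits x)) = (N + size (flatten ls))%N.
  by rewrite size_wires_after size_map size_enum_ord.
have szm : (N + size (flatten ls) < m)%N.
  by apply: leq_ltn_trans lsm; rewrite addnA leq_addr.
rewrite size_rcons; apply: (@eq_AC _ _ _ (fun x => if (j < N + size (flatten ls))%N
    then nth false (wires_after ls (input_bits x)) j
    else nth false [seq cgate_eval (wires_after ls (input_bits x)) g | g <- L]
           (j - (N + size (flatten ls)))%N)) => [x|].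
  by rewrite /wires_after foldl_rcons nth_cat -/(wires_after _ _) szE.
case: ltnP => [_|_]; first by apply: AC_S => //; apply: leq_ltn_trans szm.
set i := (j - _)%N; have [iL|Li] := ltnP i (size L).
  apply: (@eq_AC _ _ _ (fun x => cgate_eval (wires_after ls (input_bits x)) (nth (CNot 0) L i))).
    by move=> x; rewrite (nth_map (CNot 0)).
  exact: AC_cgate szm szE IH.
apply: (@eq_AC _ _ _ (fun=> false)); last exact: AC_cst.
by move=> x; rewrite nth_default ?size_map.
Qed.

Lemma AC_ccircuit F m : (N + size (flatten (clayers F)) < m)%N ->
  AC (size (clayers F)) m (fun x => ccircuit_eval F (input_bits x)).
Proof. by move=> /AC_wires_after; apply. Qed.

End Circuits.

(** * Operators on qubits *)

Lemma qbit_of_qbits k (b : 'I_k -> bool) i : qbit (of_qbits b) i = b i.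
Proof.
rewrite /qbit /=; elim: k b i => [|k IHk] b i; first by case: i.
rewrite big_ord_recl subSS subn0.
have rest : (\sum_(j < k) b (lift ord0 j) * 2 ^ (k.+1 - (lift ord0 j).+1) < 2 ^ k)%N.
  exact: (of_qbits_subproof (fun j => b (lift ord0 j))).
case: (unliftP ord0 i) => [j ->|->].
  rewrite /= subSS; have kE : (2 ^ k = 2 ^ j.+1 * 2 ^ (k - j.+1))%N.
    by rewrite -expnD subnKC.
  rewrite kE mulnA divnMDl ?expn_gt0 // oddD expnS !oddM /= andbF /=.
  exact: IHk.
by rewrite subSS subn0 divnMDl ?expn_gt0 // divn_small // addn0 oddb.
Qed.

Section Bits.
Variable N : nat.
Implicit Types (x y : 'I_(2 ^ N)) (c : cube 'I_N).

Definition bits x : cube 'I_N := [ffun i => qbit x i].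
Definition idx c : 'I_(2 ^ N) := of_qbits c.

Lemma idxK : cancel idx bits.
Proof. by move=> c; apply/ffunP => i; rewrite ffunE qbit_of_qbits. Qed.

Lemma bitsK : cancel bits idx.
Proof.
apply/bij_can_sym; last exact: idxK.
by apply: inj_card_bij (can_inj idxK) _; rewrite card_cube !card_ord.
Qed.

Lemma sum_idx (V : nmodType) (F : 'I_(2 ^ N) -> V) : \sum_x F x = \sum_c F (idx c).
Proof. by rewrite (reindex idx) //; exists bits => ? _; rewrite ?idxK ?bitsK. Qed.

Definition single (i : 'I_N) : cube 'I_N := [ffun j => j == i].

End Bits.

Section Operators.
Variables (R : realType) (N : nat).
Local Notation C := R[i].
Local Notation cubeN := (cube 'I_N).
Local Notation op := 'M[C]_(2 ^ N).
Implicit Types (M P Q : op) (x y z a b c A B : cubeN).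

(** Basis states are indexed by the cube, so that flipping bits is addition and characters act on
    the indices. *)
Definition ent M x y := M (idx x) (idx y).
Definition opmx (f : cubeN -> cubeN -> C) : op := \matrix_(i, j) f (bits i) (bits j).

Lemma ent_opmx f x y : ent (opmx f) x y = f x y.
Proof. by rewrite /ent mxE !idxK. Qed.

Lemma ent_inj M Q : (forall x y, ent M x y = ent Q x y) -> M = Q.
Proof. by move=> MQ; apply/matrixP => i j; rewrite -(bitsK i) -(bitsK j); apply: MQ. Qed.

Lemma ent_mul M Q x y : ent (M *m Q) x y = \sum_z ent M x z * ent Q z y.
Proof. by rewrite /ent mxE sum_idx. Qed.

Lemma ent_adj M x y : ent (M ^t*) x y = (ent M y x)^*.
Proof. by rewrite /ent !mxE. Qed.

Lemma ent1 x y : ent 1%:M x y = (x == y)%:R.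
Proof. by rewrite /ent mxE (can_eq (@idxK N)). Qed.

Lemma ent_sum (J : Type) (r : seq J) (F : J -> op) x y :
  ent (\sum_(j <- r) F j) x y = \sum_(j <- r) ent (F j) x y.
Proof. by rewrite /ent summxE. Qed.

Lemma ent_scale (k : C) M x y : ent (k *: M) x y = k * ent M x y.
Proof. by rewrite /ent mxE. Qed.

Lemma adjM (m n p : nat) (M : 'M[C]_(m, n)) (Q : 'M[C]_(n, p)) :
  (M *m Q) ^t* = Q ^t* *m M ^t*.
Proof. by rewrite trmx_mul map_mxM. Qed.

Lemma unitary1 n : 1%:M \is @unitarymx C n n.
Proof. by apply/unitarymxP; rewrite trmx1 map_mx1 mulmx1. Qed.

Lemma unitaryK n (M : 'M[C]_n) : M \is unitarymx -> M ^t* *m M = 1%:M.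
Proof. by move=> Mu; apply: mulmx1C; apply/unitarymxP. Qed.

Lemma unitary_row_norm n (M : 'M[C]_n) i : M \is unitarymx ->
  \sum_j `|M i j| ^+ 2 = 1.
Proof.
move=> /unitarymxP/matrixP/(_ i i); rewrite !mxE eqxx => H; rewrite -[RHS]H.
by apply: eq_bigr => j _; rewrite !mxE normCK.
Qed.

Lemma unitary_entry_le1 n (M : 'M[C]_n) i j : M \is unitarymx -> `|M i j| <= 1.
Proof.
move=> Mu; rewrite -(@ler_sqr _ _ 1) ?nnegrE // expr1n -(unitary_row_norm i Mu).
by rewrite (bigD1 j) //= lerDl; apply: sumr_ge0 => k _; rewrite exprn_ge0.
Qed.

(** M is a tensor product with the identity outside A, expressed by entries: they preserve each
    outside bit and do not depend on its value. *)
Definition acts_on A M := forall i, ~~ A i ->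
  (forall x y, x i != y i -> ent M x y = 0) /\
  (forall x y, ent M (x + single i) (y + single i) = ent M x y).

Definition sub_wires A B := forall i, A i -> B i.

Lemma acts_onW A B M : sub_wires A B -> acts_on A M -> acts_on B M.
Proof. by move=> AB MA i iB; apply: MA; apply: contraNN iB => /AB. Qed.

Lemma acts_on_mul A M Q : acts_on A M -> acts_on A Q -> acts_on A (M *m Q).
Proof.
move=> MA QA i iA; have [M0 Mi] := MA i iA; have [Q0 Qi] := QA i iA; split=> x y.
  move=> xy; rewrite ent_mul big1 // => z _.
  have [xz|xz] := eqVneq (x i) (z i); last by rewrite M0 ?mul0r.
  by rewrite Q0 ?mulr0 // -xz.
rewrite !ent_mul (reindex_inj (addIr (single i))) /=.
by apply: eq_bigr => z _; rewrite Mi Qi.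
Qed.

Lemma acts_on_adj A M : acts_on A M -> acts_on A (M ^t*).
Proof.
move=> MA i iA; have [M0 Mi] := MA i iA; split=> x y; rewrite !ent_adj.
  by move=> xy; rewrite M0 ?conjC0 // eq_sym.
by rewrite Mi.
Qed.

Lemma acts_on1 A : acts_on A 1%:M.
Proof.
move=> i iA; split=> x y; rewrite !ent1; first by apply: contraNeq => /eqP; case: eqP => // ->.
by rewrite (inj_eq (addIr _)).
Qed.

Definition supp_in A c := [forall i, c i ==> A i].

(** The operator X^a Z^b, without phase; it is therefore unitary but self-adjoint only up to the
    sign chi a b. *)
Definition pauli a b : op := opmx (fun x y => (x == y + a)%:R * chi C b y).

Lemma ent_pauli a b x y : ent (pauli a b) x y = (x == y + a)%:R * chi C b y.
Proof. exact: ent_opmx. Qed.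

Lemma pauli0 : pauli 0 0 = 1%:M.
Proof. by apply: ent_inj => x y; rewrite ent_pauli ent1 addr0 chi0l mulr1. Qed.

Lemma pauli_mul a b a' b' :
  pauli a b *m pauli a' b' = chi C b a' *: pauli (a + a') (b + b').
Proof.
apply: ent_inj => x y; rewrite ent_mul ent_scale ent_pauli (bigD1 (y + a')) //=.
rewrite big1 ?addr0 => [|z /negbTE zy]; last by rewrite !ent_pauli zy mul0r mulr0.
rewrite !ent_pauli eqxx mul1r -addrA [a' + a]addrC chiDr chiDl.
by rewrite [chi _ b y * _]mulrC -!mulrA mulrCA.
Qed.

Lemma chi_conj b y : (chi C b y)^* = chi C b y.
Proof. by case: (chi_sign C b y) => ->; rewrite ?rmorphN rmorph1. Qed.

Lemma pauli_adj a b : (pauli a b) ^t* = chi C a b *: pauli a b.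
Proof.
apply: ent_inj => x y; rewrite ent_adj ent_scale !ent_pauli rmorphM /= chi_conj.
have -> : (y == x + a) = (x == y + a).
  by apply/eqP/eqP => ->; rewrite cubeDD.
have [->|_] := eqVneq x (y + a); last by rewrite rmorph0 !mul0r mulr0.
by rewrite rmorph1 !mul1r chiDr mulrC [chi C a b]chiC.
Qed.

Lemma pauli_unitary a b : pauli a b \is unitarymx.
Proof.
apply/unitarymxP; rewrite pauli_adj -scalemxAr pauli_mul scalerA chiC chi_sqr.
by rewrite !cubeDx pauli0 scale1r.
Qed.

Lemma acts_on_pauli A a b : supp_in A a -> supp_in A b -> acts_on A (pauli a b).
Proof.
move=> /forallP aA /forallP bA i iA.
have ai : a i = false by apply/negbTE; apply: contraNN iA => ai; move: (aA i); rewrite ai.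
have bi : b i = false by apply/negbTE; apply: contraNN iA => bi; move: (bA i); rewrite bi.
split=> x y; rewrite !ent_pauli.
  move=> xy; case: eqP => [xE|_]; last by rewrite mul0r.
  by move: xy; rewrite xE cubeDE ai addbF eqxx.
rewrite addrAC (inj_eq (addIr _)) chiDr.
have -> : chi C b (single i) = 1; last by rewrite mulr1.
rewrite /chi big1 // => j _; rewrite ffunE; case: eqP => [->|_]; last by rewrite andbF expr0.
by rewrite bi expr0.
Qed.

Definition pcoef M a b : C := avg (fun y => ent M (y + a) y * chi C b y).

(** Fourier inversion along each shifted diagonal x + y = a: [pcoef M a] is the Fourier transform of
    that diagonal. *)
Lemma pauli_expansion M : M = \sum_a \sum_b pcoef M a b *: pauli a b.
Proof.
apply: ent_inj => x y; rewrite ent_sum (bigD1 (y + x)) //= [X in _ + X]big1 ?addr0 => [|a aN].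
  rewrite ent_sum; under eq_bigr do rewrite ent_scale ent_pauli addrA cubeDx add0r eqxx mul1r.
  have := fourier_inversion (fun z => ent M (z + (y + x)) z) y.
  by rewrite addrA cubeDx add0r => ->.
rewrite ent_sum big1 // => b _; rewrite ent_scale ent_pauli; case: eqP => [xE|_].
  by case/eqP: aN; rewrite xE addrA cubeDx add0r.
by rewrite mul0r mulr0.
Qed.

Lemma pcoef_supp A M a b : acts_on A M -> ~~ (supp_in A a && supp_in A b) ->
  pcoef M a b = 0.
Proof.
move=> MA; have notin c : ~~ supp_in A c -> exists2 i, c i & ~~ A i.
  rewrite negb_forall => H; case: (existsP H) => i.
  by rewrite negb_imply => /andP[ci iA]; exists i.
case/nandP => /notin[i ci iA]; have [M0 Mi] := MA i iA; rewrite /pcoef /avg.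
  rewrite big1 ?mulr0 // => y _; rewrite M0 ?mul0r // cubeDE ci.
  by case: (y i).
(* Flipping the bit i, outside A but in b, keeps the entry of M and negates the character. *)
set s := \sum_y _; suff : s = - s.
  move/eqP; rewrite -addr_eq0 -mulr2n mulrn_eq0 /= => /eqP ->; exact: mulr0.
rewrite /s [LHS](reindex_inj (addIr (single i))) -sumrN /=; apply: eq_bigr => y _.
rewrite addrAC Mi chiDr.
have -> : chi C b (single i) = -1; last by rewrite mulrN1 mulrN.
rewrite /chi (bigD1 i) //= ffunE eqxx ci big1 ?mulr1 // => j /negbTE ji.
by rewrite ffunE ji andbF.
Qed.

Lemma pcoef_le1 M a b : M \is unitarymx -> `|pcoef M a b| <= 1.
Proof.
move=> Mu; rewrite /pcoef /avg normrM ger0_norm ?invr_ge0 ?ler0n //.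
apply: le_trans (_ : avg (fun _ : cubeN => 1 : C) <= _); last by rewrite avg1.
rewrite /avg ler_wpM2l ?invr_ge0 ?ler0n //.
apply: le_trans (ler_norm_sum _ _ _) _; apply: ler_sum => y _.
by rewrite normrM chi_norm mulr1; apply: unitary_entry_le1.
Qed.

Lemma card_supp_in A : \sum_(c : cubeN) (supp_in A c)%:R = 2 ^+ wt A :> C.
Proof.
transitivity (\prod_(i < N) \sum_(b : bool) (b ==> A i)%:R : C).
  rewrite bigA_distr_bigA; apply: eq_bigr => c _.
  have [/forallP cA|/forallPn[i /negbTE ci]] := boolP (supp_in A c).
    by rewrite big1 // => i _; rewrite cA.
  by rewrite (bigD1 i) //= ci mul0r.
rewrite /wt -prodrXr; apply: eq_bigr => i _; rewrite big_bool /=.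
by case: (A i); rewrite ?add0r ?expr1 ?expr0.
Qed.

(** At most 4^|A| Pauli operators are supported in A, and each coefficient of a unitary is at most
    1. *)
Lemma pcoef_l1 A M : M \is unitarymx -> acts_on A M ->
  \sum_a \sum_b `|pcoef M a b| <= 4 ^+ wt A.
Proof.
move=> Mu MA.
apply: le_trans (_ : \sum_a \sum_b (supp_in A a)%:R * (supp_in A b)%:R <= _).
  apply: ler_sum => a _; apply: ler_sum => b _; rewrite -natrM mulnb.
  case: (boolP (_ && _)) => [_|h]; first exact: pcoef_le1.
  by rewrite (pcoef_supp MA h) normr0.
under eq_bigr do rewrite -mulr_sumr card_supp_in.
rewrite -mulr_suml card_supp_in -exprMn.
have -> : 2 * 2 = 4 :> C by rewrite -natrM.
by [].
Qed.

Definition disjoint_wires A B := forall i, A i -> B i -> False.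

Lemma chi_disjoint A B a b : disjoint_wires A B -> supp_in A a -> supp_in B b -> chi C a b = 1.
Proof.
move=> dAB /forallP aA /forallP bB; rewrite /chi big1 // => i _.
case ai: (a i) => //=; case bi: (b i) => //=.
by move: (aA i) (bB i); rewrite ai bi /= => iA iB; case: (dAB i).
Qed.

Lemma pauli_comm A B a b a' b' : disjoint_wires A B ->
  supp_in A a -> supp_in A b -> supp_in B a' -> supp_in B b' ->
  pauli a b *m pauli a' b' = pauli a' b' *m pauli a b.
Proof.
move=> dAB aA bA aB bB; rewrite !pauli_mul [a' + a]addrC [b' + b]addrC.
by rewrite (chi_disjoint dAB bA aB) chiC (chi_disjoint dAB aA bB).
Qed.

Lemma acts_on_comm A B M Q : disjoint_wires A B -> acts_on A M -> acts_on B Q ->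
  M *m Q = Q *m M.
Proof.
move=> dAB MA QB; rewrite (pauli_expansion M) (pauli_expansion Q).
rewrite mulmx_suml mulmx_sumr; apply: eq_bigr => a _.
rewrite mulmx_suml mulmx_sumr; apply: eq_bigr => b _.
rewrite mulmx_suml mulmx_sumr; apply: eq_bigr => a' _.
rewrite mulmx_suml mulmx_sumr; apply: eq_bigr => b' _.
rewrite -!scalemxAl -!scalemxAr !scalerA mulrC.
have [/andP[aA bA]|h] := boolP (supp_in A a && supp_in A b); last first.
  by rewrite (pcoef_supp MA h) mulr0 !scale0r.
have [/andP[aB bB]|h] := boolP (supp_in B a' && supp_in B b'); last first.
  by rewrite (pcoef_supp QB h) mul0r !scale0r.
by rewrite (pauli_comm dAB aA bA aB bB).
Qed.

End Operators.

(** * Light cones and splitting along a block *)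

Section Embedding.
Variables (R : realType) (N : nat).
Local Notation C := R[i].
Local Notation cubeN := (cube 'I_N).
Local Notation op := 'M[C]_(2 ^ N).
Implicit Types x y z : cubeN.

Lemma ent_pcoef (M : op) x y : ent M x y = \sum_b pcoef M (y + x) b * chi C b y.
Proof.
have := fourier_inversion (fun z => ent M (z + (y + x)) z) y.
by rewrite addrA cubeDx add0r => ->.
Qed.

Lemma acts_on_shift (A c x y : cubeN) (M : op) : acts_on A M -> disjoint_wires A c ->
  ent M (x + c) (y + c) = ent M x y.
Proof.
move=> MA Ac; rewrite !ent_pcoef; apply: eq_bigr => b _.
have -> : y + c + (x + c) = y + x by rewrite addrACA cubeDx addr0.
have [/andP[_ bA]|h] := boolP (supp_in A (y + x) && supp_in A b); last first.
  by rewrite (pcoef_supp MA h) !mul0r.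
rewrite chiDr (_ : chi C b c = 1) ?mulr1 //; apply: (chi_disjoint R Ac bA).
by apply/forallP => i; apply/implyP.
Qed.

Lemma ent00_mul (A B : cubeN) (M Q : op) : disjoint_wires A B -> acts_on A M -> acts_on B Q ->
  ent (M *m Q) 0 0 = ent M 0 0 * ent Q 0 0.
Proof.
move=> AB MA QB; rewrite ent_mul (bigD1 (0 : cubeN)) //= big1 ?addr0 // => z /cube_neq0[i zi].
case Ai: (A i); last first.
  by have [M0 _] := MA i (negbT Ai); rewrite M0 ?mul0r // cube0E zi.
have Bi : ~~ B i by apply/negP; exact: AB.
by have [Q0 _] := QB i Bi; rewrite Q0 ?mulr0 // cube0E zi.
Qed.

Section Wires.
Variables (k : nat) (w : k.-tuple 'I_N).

Definition emb (M : 'M[C]_(2 ^ k)) : op := gate_mx (Gate w M).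
Definition sub (x : cubeN) : cube 'I_k := [ffun j => x (tnth w j)].
Definition put (u : cube 'I_k) (x : cubeN) : cubeN :=
  [ffun i => if [pick j | tnth w j == i] is Some j then u j else x i].
Definition wmask : cubeN := [ffun i => i \in tval w].
Definition agree (x y : cubeN) := [forall c, (c \notin tval w) ==> (x c == y c)].

Lemma ent_emb M x y : ent (emb M) x y = if agree x y then ent M (sub x) (sub y) else 0.
Proof.
rewrite /ent /emb /gate_mx mxE /=.
have -> : [forall c, (c \notin tval w) ==> (qbit (idx x) c == qbit (idx y) c)] = agree x y.
  by apply: eq_forallb => c; rewrite !qbit_of_qbits.
have H z : of_qbits (fun j => qbit (idx z) (tnth w j)) = idx (sub z).
  apply: val_inj => /=; apply: eq_bigr => j _; congr (_ * _)%N.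
  by rewrite ffunE qbit_of_qbits.
by rewrite !H.
Qed.

Lemma put_off u x c : c \notin tval w -> put u x c = x c.
Proof.
move=> cw; rewrite ffunE; case: pickP => // j /eqP jc; move: cw.
by rewrite -jc mem_tnth.
Qed.

Lemma agreeP x y : reflect (forall c, c \notin tval w -> x c = y c) (agree x y).
Proof.
apply: (iffP forallP) => [xy c cw|xy c]; last by apply/implyP => /xy ->.
by move: (xy c); rewrite cw => /eqP.
Qed.

Lemma agree_sym x y : agree x y = agree y x.
Proof. by apply/agreeP/agreeP => xy c /xy. Qed.

Lemma agree_put x u : agree x (put u x).
Proof. by apply/agreeP => c cw; rewrite put_off. Qed.

Lemma put_sub x y : agree x y -> put (sub y) x = y.
Proof.
move=> /agreeP xy; apply/ffunP => i; rewrite ffunE; case: pickP => [j /eqP <-|no].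
  by rewrite ffunE.
apply: xy; apply/tnthP => -[j ji]; by move: (no j); rewrite -ji eqxx.
Qed.

Lemma acts_on_emb M : acts_on wmask (emb M).
Proof.
move=> i; rewrite ffunE => iw; split=> x y.
  move=> xy; rewrite ent_emb; case: agreeP => // /(_ i iw) xyi.
  by rewrite xyi eqxx in xy.
have sE z : sub (z + single i) = sub z.
  apply/ffunP => j; rewrite !ffunE; case: eqP => [ji|_]; last exact: addbF.
  by rewrite -ji mem_tnth in iw.
rewrite !ent_emb !sE; congr (if _ then _ else _).
apply: eq_forallb => c; rewrite !cubeDE; congr (_ ==> _).
by case: (x c); case: (y c); case: (single i c).
Qed.

Lemma adj_emb M : (emb M) ^t* = emb (M ^t*).
Proof.
apply: ent_inj => x y; rewrite ent_adj !ent_emb agree_sym.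
by case: ifP => _; rewrite ?conjC0 // ent_adj.
Qed.

Hypothesis w_uniq : uniq w.

Lemma sub_put u x : sub (put u x) = u.
Proof.
apply/ffunP => j; rewrite !ffunE; case: pickP => [j' /eqP jj'|/(_ j)]; last by rewrite eqxx.
by congr (u _); apply: (tuple_uniqP _ w_uniq).
Qed.

Lemma sum_agree (V : nmodType) x (F : cubeN -> V) :
  \sum_(z | agree x z) F z = \sum_u F (put u x).
Proof.
rewrite (reindex_onto (fun u => put u x) sub) => [|z xz]; last exact: put_sub.
by apply: eq_bigl => u; rewrite agree_put sub_put eqxx.
Qed.

Lemma emb_mul M Q : emb M *m emb Q = emb (M *m Q).
Proof.
apply: ent_inj => x y; rewrite ent_mul.
transitivity (\sum_(z | agree x z) ent M (sub x) (sub z) * ent (emb Q) z y).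
  rewrite [RHS]big_mkcond; apply: eq_bigr => z _; rewrite ent_emb.
  by case: ifP => // _; rewrite mul0r.
rewrite sum_agree ent_emb; have [/agreeP xy|nxy] := boolP (agree x y).
  rewrite ent_mul; apply: eq_bigr => u _; rewrite ent_emb sub_put.
  by case: agreeP => // h; case: h => c cw; rewrite put_off // xy.
rewrite big1 // => u _; rewrite ent_emb; case: agreeP => [h|_]; last by rewrite mulr0.
by case/agreeP: nxy => c cw; rewrite -h // put_off.
Qed.

Lemma emb1 : emb 1%:M = 1%:M.
Proof.
apply: ent_inj => x y; rewrite ent_emb !ent1.
case: agreeP => [xy|nxy]; last by case: eqP => // xy; case: nxy => c _; rewrite xy.
congr (_%:R); congr (nat_of_bool _); apply/eqP/eqP => [sxy|-> //].
by rewrite -(put_sub (introT (agreeP _ _) xy)) -sxy; apply/esym/put_sub/agreeP.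
Qed.

Lemma ent_emb_put M u v : ent (emb M) (put u 0) (put v 0) = ent M u v.
Proof.
rewrite ent_emb !sub_put; case: agreeP => // h; case: h => c cw.
by rewrite !put_off.
Qed.

Lemma emb_inj : injective emb.
Proof. by move=> M Q MQ; apply: ent_inj => u v; rewrite -ent_emb_put MQ ent_emb_put. Qed.

Lemma put00 : put 0 0 = 0.
Proof.
by apply/ffunP => i; rewrite ffunE [RHS]cube0E; case: pickP => [j _|_]; rewrite cube0E.
Qed.

Lemma emb_unitary M : (emb M \is unitarymx) = (M \is unitarymx).
Proof.
apply/unitarymxP/unitarymxP; rewrite adj_emb emb_mul; last by move=> ->; rewrite emb1.
by move=> h; apply: emb_inj; rewrite h emb1.
Qed.

(** Inverse of [emb] on the operators supported on w, read off with all other qubits at 0. *)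
Definition restr (M : op) : 'M[C]_(2 ^ k) :=
  opmx (fun u v => ent M (put u 0) (put v 0)).

Lemma emb_restr M : acts_on wmask M -> emb (restr M) = M.
Proof.
move=> MA; apply: ent_inj => x y; rewrite ent_emb; case: agreeP => [xy|nxy]; last first.
  have [c cw xyc] : exists2 c, c \notin tval w & x c != y c.
    apply: contrapT => h; apply: nxy => c cw; apply: contrapT => /eqP xyc.
    by apply: h; exists c.
  have cm : ~~ wmask c by rewrite ffunE.
  by have [M0 _] := MA c cm; rewrite M0.
rewrite ent_opmx; pose c := x + put (sub x) 0.
have on z i : i \in tval w -> put (sub z) 0 i = z i.
  move=> /tnthP[j ->]; rewrite ffunE; case: pickP => [j' /eqP jj'|/(_ j)].
    by rewrite ffunE jj'.
  by rewrite eqxx.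
have cw : disjoint_wires wmask c.
  by move=> i; rewrite ffunE => iw; rewrite cubeDE on // addbb.
have cy : c = y + put (sub y) 0.
  apply/ffunP => i; rewrite !cubeDE; have [iw|iw] := boolP (i \in tval w).
    by rewrite !on // !addbb.
  by rewrite !put_off // xy.
rewrite -(acts_on_shift _ _ MA cw) {2}cy /c.
by rewrite ![put _ _ + _]addrC !cubeDD.
Qed.

Lemma restr_unitary M : acts_on wmask M -> M \is unitarymx -> restr M \is unitarymx.
Proof. by move=> MA; rewrite -emb_unitary emb_restr. Qed.

(** If a is nonzero the diagonal vanishes; otherwise the diagonal is a nontrivial character, which
    sums to 0. *)
Lemma tr_restr_pauli a b : supp_in wmask a -> supp_in wmask b -> (a != 0) || (b != 0) ->
  \tr (restr (pauli R a b)) = 0.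
Proof.
move=> /forallP aw /forallP bw ab.
have -> : \tr (restr (pauli R a b)) = \sum_u ent (pauli R a b) (put u 0) (put u 0).
  by rewrite /mxtrace sum_idx; apply: eq_bigr => u _; exact: ent_opmx.
have [a0|aN] := eqVneq a 0; last first.
  rewrite big1 // => u _; rewrite ent_pauli; case: eqP => [h|_]; last by rewrite mul0r.
  case/eqP: aN; apply: (addrI (put u 0)); by rewrite -h addr0.
rewrite a0 eqxx /= in ab; have [i bi] := cube_neq0 ab.
have : i \in tval w by have := bw i; rewrite bi ffunE.
move=> /tnthP[j ij].
have -> : \sum_u ent (pauli R a b) (put u 0) (put u 0) = \sum_u chi C b (put u 0).
  by apply: eq_bigr => u _; rewrite a0 ent_pauli addr0 eqxx mul1r.
set s := \sum_u _; suff : s = - s.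
  by move/eqP; rewrite -addr_eq0 -mulr2n mulrn_eq0 /= => /eqP.
rewrite /s [LHS](reindex_inj (addIr (single j))) -sumrN /=; apply: eq_bigr => u _.
have -> : put (u + single j) 0 = put u 0 + single i.
  apply/ffunP => l; rewrite cubeDE ffunE [put u 0 l]ffunE [single i l]ffunE.
  case: pickP => [j' /eqP jl|no].
    rewrite cubeDE; congr (_ (+) _); rewrite ffunE -jl ij.
    by apply/eqP/eqP => [-> //|]; apply: (tuple_uniqP _ w_uniq).
  rewrite cube0E /=; case: eqP => // li; by move: (no j); rewrite -ij li eqxx.
rewrite chiDr; have -> : chi C b (single i) = -1; last by rewrite mulrN1.
rewrite /chi (bigD1 i) //= ffunE eqxx bi big1 ?mulr1 // => l /negbTE li.
by rewrite ffunE li andbF.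
Qed.

End Wires.
End Embedding.

Section Circuits.
Variables (R : realType) (N : nat).
Local Notation C := R[i].
Local Notation cubeN := (cube 'I_N).
Local Notation op := 'M[C]_(2 ^ N).
Implicit Types (x y z A B : cubeN) (M Q : op) (g : gate R N) (L : qlayer R N).

Lemma gate_mx_unitary g : gate_wf g -> gate_mx g \is unitarymx.
Proof. by case: g => k w M /and3P[_ /= wu Mu]; rewrite -/(emb w M) emb_unitary. Qed.

Lemma acts_on_gate g : acts_on (wmask (wires g)) (gate_mx g).
Proof. by case: g => k w M; exact: acts_on_emb. Qed.

Lemma qlayer_mx_rcons L g : qlayer_mx (rcons L g) = gate_mx g *m qlayer_mx L.
Proof. by rewrite /qlayer_mx foldl_rcons. Qed.

Lemma qcircuit_mx_rcons (K : qcircuit R N) L :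
  qcircuit_mx (rcons K L) = qlayer_mx L *m qcircuit_mx K.
Proof. by rewrite /qcircuit_mx foldl_rcons. Qed.

Lemma qlayer_mx_unitary L : all (@gate_wf R N) L -> qlayer_mx L \is unitarymx.
Proof.
elim/last_ind: L => [|L g IH]; first by move=> _; exact: unitary1.
rewrite all_rcons qlayer_mx_rcons => /andP[gw Lw].
by apply: mul_unitarymx; [exact: gate_mx_unitary|exact: IH].
Qed.

Lemma qcircuit_mx_unitary (K : qcircuit R N) : all (@qlayer_wf R N) K ->
  qcircuit_mx K \is unitarymx.
Proof.
elim/last_ind: K => [|K L IH]; first by move=> _; exact: unitary1.
rewrite all_rcons qcircuit_mx_rcons => /andP[/andP[Lw _] Kw].
by apply: mul_unitarymx; [exact: qlayer_mx_unitary|exact: IH].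
Qed.

Definition layer_wires L : seq 'I_N := flatten [seq tval (wires g) | g <- L].

Lemma layer_wires_rcons L g : layer_wires (rcons L g) = layer_wires L ++ tval (wires g).
Proof. by rewrite /layer_wires map_rcons flatten_rcons. Qed.

Lemma sum_mem_count (w : seq 'I_N) (P : pred 'I_N) : uniq w ->
  (\sum_i (P i && (i \in w)))%N = count P w.
Proof.
move=> wu; rewrite -sum1_count [RHS]big_mkcond [RHS](big_uniq _ wu) /= [RHS]big_mkcond.
by apply: eq_bigr => i _; case: (i \in w); case: (P i).
Qed.

(** A gate that misses the support commutes with the observable and cancels. A gate that meets it
    has at most two wires, so it adds no more qubits than it already has in the support; as the
    gates of a layer are disjoint, the total growth is at most the number of touched qubits. *)
Lemma lightcone_layer L A M : all (@gate_wf R N) L -> uniq (layer_wires L) ->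
  acts_on A M -> exists2 A', acts_on A' ((qlayer_mx L) ^t* *m M *m qlayer_mx L) &
    (wt A' <= wt A + \sum_i (A i && (i \in layer_wires L)))%N.
Proof.
elim/last_ind: L A M => [|L g IH] A M.
  move=> _ _ MA; exists A; last exact: leq_addr.
  by rewrite /qlayer_mx /= trmx1 map_mx1 mul1mx mulmx1.
rewrite all_rcons layer_wires_rcons cat_uniq => /andP[gw Lw] /and3P[Lu /hasPn gL gu] MA.
have gun := gate_mx_unitary gw.
have -> : (qlayer_mx (rcons L g)) ^t* *m M *m qlayer_mx (rcons L g) =
   (qlayer_mx L) ^t* *m ((gate_mx g) ^t* *m M *m gate_mx g) *m qlayer_mx L.
  by rewrite qlayer_mx_rcons adjM !mulmxA.
have sumE : (\sum_i (A i && (i \in layer_wires L ++ tval (wires g))) =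
    \sum_i (A i && (i \in layer_wires L)) + count A (wires g))%N.
  rewrite -(sum_mem_count _ gu) -big_split; apply: eq_bigr => i _ /=.
  rewrite mem_cat; case: (A i) => //=; have := gL i.
  by case: (i \in tval (wires g)) => [/(_ isT) /negbTE ->|_]; rewrite ?orbF ?addn0.
have [hA|hA] := boolP (has A (wires g)); last first.
  have -> : (gate_mx g) ^t* *m M *m gate_mx g = M.
    rewrite -mulmxA (acts_on_comm _ MA (@acts_on_gate g)) => [|i Ai].
      by rewrite mulmxA unitaryK // mul1mx.
    by rewrite ffunE => ig; move/hasPn/(_ i ig): hA; rewrite Ai.
  have [A' A'M A'w] := IH A M Lw Lu MA; exists A' => //.
  by apply: leq_trans A'w _; rewrite sumE addnA leq_addr.
pose A1 : cubeN := [ffun i => A i || (i \in tval (wires g))].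
have MA1 : acts_on A1 ((gate_mx g) ^t* *m M *m gate_mx g).
  have gA1 : acts_on A1 (gate_mx g).
    by apply: acts_onW (@acts_on_gate g) => i; rewrite !ffunE => ->; rewrite orbT.
  apply: acts_on_mul => //; apply: acts_on_mul; first exact: acts_on_adj.
  by apply: acts_onW MA => i; rewrite ffunE => ->.
have [A' A'M A'w] := IH A1 _ Lw Lu MA1; exists A' => //.
apply: leq_trans A'w _; rewrite sumE.
have -> : (\sum_i (A1 i && (i \in layer_wires L)) = \sum_i (A i && (i \in layer_wires L)))%N.
  apply: eq_bigr => i _; rewrite ffunE; have := gL i.
  by case: (i \in tval (wires g)) => [/(_ isT) /negbTE ->|_]; rewrite ?andbF ?orbF.
rewrite addnCA addnC leq_add2l // addnC.
have -> : wt A1 = (wt A + count (predC A) (wires g))%N.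
  rewrite -(sum_mem_count _ gu) /wt -big_split; apply: eq_bigr => i _ /=.
  by rewrite ffunE; case: (A i); case: (i \in _).
(* Arity at most 2 with at least one wire in A: the wires outside A are no more than those
   inside. *)
rewrite addnC leq_add2r; have := count_predC A (wires g); rewrite size_tuple.
have /andP[/andP[_ g2] _] := gw; move: hA; rewrite has_count; lia.
Qed.

Lemma lightcone_circuit (K : qcircuit R N) A M : all (@qlayer_wf R N) K ->
  acts_on A M -> exists2 A', acts_on A' ((qcircuit_mx K) ^t* *m M *m qcircuit_mx K) &
    (wt A' <= 2 ^ size K * wt A)%N.
Proof.
elim/last_ind: K A M => [|K L IH] A M.
  move=> _ MA; exists A; last by rewrite mul1n.
  by rewrite /qcircuit_mx /= trmx1 map_mx1 mul1mx mulmx1.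
rewrite all_rcons qcircuit_mx_rcons => /andP[/andP[Lw Lu] Kw] MA.
have [A1 MA1 A1w] := lightcone_layer Lw Lu MA.
have [A' MA' A'w] := IH A1 _ Kw MA1; exists A'.
  by rewrite adjM !mulmxA in MA' *.
apply: leq_trans A'w _; rewrite size_rcons expnSr -mulnA leq_mul2l; apply/orP; right.
apply: leq_trans A1w _; rewrite mul2n -addnn leq_add2l; apply: leq_sum => i _.
by case: (A i); rewrite /= ?leq_b1.
Qed.

(** * Operator Schmidt decompositions across a cut *)

Definition wire_compl B : cubeN := [ffun i => ~~ B i].

Lemma disjoint_wires_cneg B : disjoint_wires B (wire_compl B).
Proof. by move=> i Bi; rewrite ffunE Bi. Qed.

(** The size of a decomposition is measured by the l1 norm of its coefficients over unitary factors:
    this norm is multiplicative for products, and unitary factors have entries of modulus at most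
    1. *)
Definition schmidt B (W : C) M := exists s : seq (C * op * op),
  [/\ M = \sum_(e <- s) e.1.1 *: (e.1.2 *m e.2),
      forall e, e \in s -> [/\ acts_on B e.1.2, e.1.2 \is unitarymx,
                               acts_on (wire_compl B) e.2 & e.2 \is unitarymx]
    & \sum_(e <- s) `|e.1.1| <= W].

Lemma schmidt_prod B P Q : acts_on B P -> P \is unitarymx -> acts_on (wire_compl B) Q ->
  Q \is unitarymx -> schmidt B 1 (P *m Q).
Proof.
move=> PB Pu QB Qu; exists [:: (1, P, Q)]; split.
- by rewrite big_seq1 scale1r.
- by move=> e; rewrite inE => /eqP -> /=; exact: And4 PB Pu QB Qu.
- by rewrite big_seq1 normr1.
Qed.

Lemma schmW B W W' M : W <= W' -> schmidt B W M -> schmidt B W' M.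
Proof. by move=> WW' [s [sE sP sW]]; exists s; split=> //; apply: le_trans WW'. Qed.

Lemma schmidt_ge0 B W M : schmidt B W M -> 0 <= W.
Proof. by move=> [s [_ _ sW]]; apply: le_trans sW; apply: sumr_ge0. Qed.

Lemma schmidt_mul B W W' M Q : schmidt B W M -> schmidt B W' Q -> schmidt B (W * W') (M *m Q).
Proof.
move=> MW QW; have W0 := schmidt_ge0 MW; have W0' := schmidt_ge0 QW.
move: MW QW => [s [-> sP sW]] [s' [-> s'P s'W]].
exists [seq (e.1.1 * e'.1.1, e.1.2 *m e'.1.2, e.2 *m e'.2) | e <- s, e' <- s']; split.
- rewrite big_allpairs_dep mulmx_suml; apply: eq_big_seq => e es.
  rewrite mulmx_sumr; apply: eq_big_seq => e' e's' /=.
  have [_ _ e2 _] := sP e es; have [e'1 _ _ _] := s'P e' e's'.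
  rewrite -scalemxAl -scalemxAr scalerA; congr (_ *: _).
  rewrite -!mulmxA; congr (_ *m _); rewrite !mulmxA; congr (_ *m _).
  exact/esym/(acts_on_comm (@disjoint_wires_cneg B) e'1 e2).
- move=> _ /allpairsP[[e e'] /= [es e's' ->]] /=.
  have [h1 h2 h3 h4] := sP e es; have [k1 k2 k3 k4] := s'P e' e's'.
  exact: And4 (acts_on_mul h1 k1) (mul_unitarymx h2 k2) (acts_on_mul h3 k3) (mul_unitarymx h4 k4).
- rewrite big_allpairs_dep.
  under eq_bigr do under eq_bigr do rewrite /= normrM.
  by under eq_bigr do rewrite -mulr_sumr; rewrite -mulr_suml ler_pM ?sumr_ge0.
Qed.

Lemma supp_in_meet B (a : cubeN) : supp_in B (meet a B).
Proof. by apply/forallP => i; rewrite ffunE; case: (a i); case: (B i). Qed.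

Lemma supp_in_diff B (a : cubeN) : supp_in (wire_compl B) (diff a B).
Proof. by apply/forallP => i; rewrite !ffunE; case: (a i); case: (B i). Qed.

Lemma pauli_split B (a b : cubeN) :
  pauli R a b = pauli R (meet a B) (meet b B) *m pauli R (diff a B) (diff b B).
Proof.
rewrite pauli_mul !meetDdiff (chi_disjoint _ (@disjoint_wires_cneg B)) ?scale1r //.
  exact: supp_in_meet.
exact: supp_in_diff.
Qed.

Lemma schmidt_pauli B A M : M \is unitarymx -> acts_on A M -> schmidt B (4 ^+ wt A) M.
Proof.
move=> Mu MA; exists [seq (pcoef M p.1 p.2, pauli R (meet p.1 B) (meet p.2 B),
   pauli R (diff p.1 B) (diff p.2 B)) | p <- index_enum _]; split.
- rewrite big_map /= {1}(pauli_expansion M) pair_big /=; apply: eq_bigr => p _.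
  by rewrite (pauli_split B).
- move=> _ /mapP[p _ ->] /=; split; try exact: pauli_unitary.
    by apply: acts_on_pauli; exact: supp_in_meet.
  by apply: acts_on_pauli; exact: supp_in_diff.
- rewrite big_map /=; apply: le_trans (pcoef_l1 Mu MA).
  by rewrite pair_big.
Qed.

Definition crossing B g := has B (wires g) && has (wire_compl B) (wires g).

(** A gate on one side of the cut is a single term; a crossing one has at most two qubits, and its
    Pauli expansion weighs at most 4^2 = 16. *)
Lemma schmidt_gate B g : gate_wf g -> schmidt B (16 ^+ crossing B g) (gate_mx g).
Proof.
move=> gw; have gu := gate_mx_unitary gw; have gA := @acts_on_gate g.
have [_|] := boolP (crossing B g).
  apply: schmW (schmidt_pauli B gu gA); rewrite expr1.
  have -> : 16 = 4 ^+ 2 :> C by rewrite -natrX.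
  have /and3P[/andP[_ g2] wu _] := gw.
  apply: ler_weXn2l; first by rewrite ler1n.
  have := sum_mem_count predT wu; rewrite count_predT size_tuple => wE.
  apply: leq_trans (leq_trans _ (eq_leq wE)) g2; apply: leq_sum => i _.
  by rewrite ffunE.
rewrite negb_and => /orP[|] /hasPn h; rewrite expr0.
  have gB : acts_on (wire_compl B) (gate_mx g) by apply: acts_onW gA => i; rewrite !ffunE => /h.
  rewrite -[gate_mx g]mul1mx; exact: schmidt_prod (@acts_on1 R N B) (unitary1 R _) gB gu.
have gB : acts_on B (gate_mx g).
  by apply: acts_onW gA => i; rewrite ffunE => /h; rewrite ffunE negbK.
rewrite -[gate_mx g]mulmx1; exact: schmidt_prod gB gu (@acts_on1 R N _) (unitary1 R _).
Qed.

Lemma schmidt_layer B L : all (@gate_wf R N) L -> schmidt B (16 ^+ count (crossing B) L) (qlayer_mx L).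
Proof.
elim/last_ind: L => [_|L g IH].
  rewrite expr0 /qlayer_mx /= -[1%:M]mulmx1.
  by apply: schmidt_prod; do ?exact: acts_on1; exact: unitary1.
rewrite all_rcons qlayer_mx_rcons => /andP[gw Lw].
rewrite -cats1 count_cat /= addn0 addnC exprD; apply: schmidt_mul; last exact: IH.
exact: schmidt_gate.
Qed.

(** The wires of a layer are distinct, so l and r belong to at most one gate each. Two crossing
    gates of weight 16 give the 256 per layer below. *)
Lemma count_crossing B L (l r : 'I_N) : uniq (layer_wires L) ->
  (forall g, List.In g L -> crossing B g -> (l \in tval (wires g)) || (r \in tval (wires g))) ->
  (count (crossing B) L <= 2)%N.
Proof.
move=> Lu lr; have le1 k : (count_mem k (layer_wires L) <= 1)%N.
  by rewrite count_uniq_mem // leq_b1.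
suff : (count (crossing B) L <= count_mem l (layer_wires L) + count_mem r (layer_wires L))%N.
  by move=> /leq_trans; apply; apply: (leq_add (le1 l) (le1 r)).
elim: L lr {Lu le1} => [//|g L IH] lr.
rewrite /layer_wires /= !count_cat addnACA; apply: leq_add; last first.
  by apply: IH => g' g'L; apply: lr; right.
case: (boolP (crossing B g)) => // gc; have := lr g (or_introl erefl) gc.
by rewrite -!has_pred1 !has_count => /orP[] h; rewrite ?addn_gt0 h ?orbT.
Qed.

Lemma schmidt_circuit B (K : qcircuit R N) (l r : 'I_N) : all (@qlayer_wf R N) K ->
  (forall g, List.In g (flatten K) -> crossing B g -> (l \in tval (wires g)) || (r \in tval (wires g))) ->
  schmidt B (256 ^+ size K) (qcircuit_mx K).
Proof.
elim/last_ind: K => [_ _|K L IH].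
  rewrite expr0 /qcircuit_mx /= -[1%:M]mulmx1.
  by apply: schmidt_prod; do ?exact: acts_on1; exact: unitary1.
rewrite all_rcons qcircuit_mx_rcons size_rcons exprS flatten_rcons.
move=> /andP[/andP[Lw Lu] Kw] lr; apply: schmidt_mul; last first.
  by apply: IH => // g gK; apply: lr; apply: List.in_or_app; left.
apply: schmW (schmidt_layer B Lw); have -> : 256 = 16 ^+ 2 :> C by rewrite -natrX.
apply: ler_weXn2l; first by rewrite ler1n.
by apply: (count_crossing Lu) => g gL; apply: lr; apply: List.in_or_app; right.
Qed.

End Circuits.

(** * The oracle as a product over blocks of qubits *)

Section Blocks.
Variables (n t : nat).

Lemma block_wire_subproof (j : 'I_t) (i : 'I_n) : (j * n + i < n * t)%N.
Proof.
have := ltn_ord j; have := ltn_ord i => h1 h2.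
apply: (@leq_trans (j.+1 * n)); first by rewrite mulSn addnC ltn_add2r.
by rewrite mulnC leq_mul2l h2 orbT.
Qed.

Definition block_wire j i : 'I_(n * t) := Ordinal (block_wire_subproof j i).

Definition block (j : 'I_t) : n.-tuple 'I_(n * t) := [tuple block_wire j i | i < n].

Lemma tnth_block j i : tnth (block j) i = block_wire j i.
Proof. by rewrite tnth_mktuple. Qed.

Lemma block_uniq j : uniq (block j).
Proof.
by rewrite map_inj_uniq ?enum_uniq // => i i' /(congr1 val)/= /addnI h; apply: val_inj.
Qed.

Lemma mem_block j (k : 'I_(n * t)) : (k \in tval (block j)) = (j * n <= k < j * n + n)%N.
Proof.
apply/tnthP/andP => [[i ->]|[jk kj]].
  by rewrite tnth_block /= leq_addr ltn_add2l ltn_ord.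
have h : (k - j * n < n)%N by rewrite ltn_subLR.
by exists (Ordinal h); rewrite tnth_block; apply: val_inj; rewrite /= subnKC.
Qed.

Lemma block_disjoint (j j' : 'I_t) k : k \in tval (block j) -> k \in tval (block j') -> j = j'.
Proof.
rewrite !mem_block => /andP[h1 h2] /andP[h3 h4]; apply: val_inj => /=.
have : (j < j'.+1)%N by rewrite -(@ltn_pmul2r n); lia.
have : (j' < j.+1)%N by rewrite -(@ltn_pmul2r n); lia.
lia.
Qed.

Lemma mem_some_block (k : 'I_(n * t)) : exists j, k \in tval (block j).
Proof.
have n0 : (0 < n)%N by case: n k => [|//] [].
have kt : (k %/ n < t)%N by rewrite ltn_divLR //; apply: leq_trans (ltn_ord k) _; rewrite mulnC.
exists (Ordinal kt); rewrite mem_block /= leq_divM /=.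
by rewrite {1}(divn_eq k n) ltn_add2l ltn_pmod.
Qed.

End Blocks.

Section Oracle.
Variables (R : realType) (n t : nat).
Local Notation C := R[i].
Local Notation op := 'M[C]_(2 ^ (n * t)).
Implicit Types (U : 'M[C]_(2 ^ n)) (x y z : cube 'I_(n * t)).

Definition digit d (d0 : (0 < d)%N) k (x : nat) (j : 'I_k) : 'I_d :=
  Ordinal (ltn_pmod (x %/ d ^ (k - j.+1)) d0).

Lemma div_mod_digit (d a b x : nat) : (0 < d)%N -> (b < a)%N ->
  ((x %% d ^ a) %/ d ^ b %% d = x %/ d ^ b %% d)%N.
Proof.
move=> d0 ba; rewrite [X in _ = (X %/ _ %% _)%N](divn_eq x (d ^ a)).
set q := (x %/ _)%N; set r := (x %% _)%N.
have -> : (d ^ a = d ^ (a - b.+1) * d * d ^ b)%N by rewrite -mulnA -expnS -expnD subnK.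
by rewrite mulnA divnMDl ?expn_gt0 ?d0 // mulnA -modnDml modnMl.
Qed.

Lemma ntensmx_entry d (d0 : (0 < d)%N) k (M : 'M[C]_d) (x y : 'I_(d ^ k)) :
  ntensmx M k x y = \prod_(j < k) M (digit d0 x j) (digit d0 y j).
Proof.
case: k x y => [|k] x y.
  rewrite big_ord0 /ntensmx /= mxE (_ : x == y) //.
  by apply/eqP/val_inj; case: x y => [[|//] ?] [[|//] ?].
rewrite /ntensmx; elim: k x y => [|k IHk] x y.
  rewrite big_ord1 /=; congr (M _ _); apply: val_inj => /=;
    by rewrite divn1 modn_small.
rewrite [LHS]mxE /= IHk [RHS]big_ord_recl; congr (M _ _ * _).
- apply: val_inj => /=; rewrite subSS subn0 modn_small // ltn_divLR ?expn_gt0 ?d0 //.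
- apply: val_inj => /=; rewrite subSS subn0 modn_small // ltn_divLR ?expn_gt0 ?d0 //.
apply: eq_bigr => j _; congr (M _ _); apply: val_inj;
  by rewrite /= subSS div_mod_digit // ltnS leq_subr.
Qed.

Lemma digit_idx x (j : 'I_t) (d0 : (0 < 2 ^ n)%N) :
  digit d0 (idx x) j = idx (sub (block n j) x).
Proof.
rewrite -[LHS]bitsK; congr (idx _); apply/ffunP => i; rewrite !ffunE tnth_block.
rewrite -(qbit_of_qbits x (block_wire j i)) /qbit -/(idx x) /=.
rewrite -[LHS]oddb -[RHS]oddb -!modn2.
have ni : (n - i.+1 < n)%N by rewrite ltn_subrL /= (leq_ltn_trans (leq0n i)).
rewrite div_mod_digit //.
rewrite -divnMA -expnM -expnD; congr (odd (_ %/ 2 ^ _ %% 2)).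
have := ltn_ord i; have := ltn_ord j; move: (val i) (val j) => a b bt an.
have -> : (t = b.+1 + (t - b.+1))%N by rewrite subnKC.
rewrite addKn; nia.
Qed.

Lemma ent_oracle U x y :
  ent (oracle_mx t U) x y = \prod_(j < t) ent U (sub (block n j) x) (sub (block n j) y).
Proof.
have d0 : (0 < 2 ^ n)%N by rewrite expn_gt0.
rewrite {1}/ent /oracle_mx castmxE (ntensmx_entry d0) /=.
by apply: eq_bigr => j _; rewrite !digit_idx.
Qed.

Lemma tensmx1 (p q : nat) : (1%:M : 'M[C]_p) *t (1%:M : 'M[C]_q) = 1%:M.
Proof.
apply/matrixP => i j; case: (mxtens_indexP i) => i0 i1; case: (mxtens_indexP j) => j0 j1.
rewrite tensmxE !mxE -natrM mulnb; congr (_%:R); congr (nat_of_bool _).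
rewrite (can_eq (@mxtens_indexK _ _)) xpair_eqE //.
Qed.

Lemma tensmx_unitary (p q : nat) (M : 'M[C]_p) (Q : 'M[C]_q) :
  M \is unitarymx -> Q \is unitarymx -> M *t Q \is unitarymx.
Proof.
move=> /unitarymxP Mu /unitarymxP Qu; apply/unitarymxP.
by rewrite trmx_tens map_mxT tensmx_mul Mu Qu tensmx1.
Qed.

Lemma ntensmx_unitary (d k : nat) (M : 'M[C]_d) : M \is unitarymx -> ntensmx M k \is unitarymx.
Proof.
move=> Mu; case: k => [|k]; first exact: unitary1.
rewrite /ntensmx; elim: k => [//|k IHk]; exact: tensmx_unitary.
Qed.

Lemma castmx_unitary (p q : nat) (e : p = q) (M : 'M[C]_p) :
  M \is unitarymx -> castmx (e, e) M \is unitarymx.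
Proof. by case: q / e. Qed.

Lemma oracle_unitary U : U \is unitarymx -> oracle_mx t U \is unitarymx.
Proof. by move=> Uu; apply: castmx_unitary; apply: ntensmx_unitary. Qed.

(** The tensor power with the factor of block j0 replaced by the identity. *)
Definition other_blocks (j0 : 'I_t) U : op := opmx (fun x y =>
  (sub (block n j0) x == sub (block n j0) y)%:R *
  \prod_(j < t | j != j0) ent U (sub (block n j) x) (sub (block n j) y)).

Lemma acts_on_other_blocks j0 U : acts_on (wire_compl (wmask (block n j0))) (other_blocks j0 U).
Proof.
move=> i; rewrite !ffunE negbK => ij0; split=> x y; rewrite !ent_opmx.
  move=> xy; case: eqP => [/ffunP h|_]; last by rewrite mul0r.
  move: ij0 xy => /tnthP[k ->]; have := h k; rewrite !ffunE => ->.
  by rewrite eqxx.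
have subD j z : sub (block n j) (z + single i) = sub (block n j) z + sub (block n j) (single i).
  by apply/ffunP => k; rewrite !ffunE.
congr (_%:R * _); first by rewrite !subD (inj_eq (addIr _)).
apply: eq_bigr => j jj0; suff h z : sub (block n j) (z + single i) = sub (block n j) z.
  by rewrite !h.
apply/ffunP => k; rewrite !ffunE; case: eqP => [ki|_]; last exact: addbF.
case/eqP: jj0; apply: (@block_disjoint n t j j0 i) => //.
by rewrite -ki mem_tnth.
Qed.

Lemma oracle_split j0 U : oracle_mx t U = emb (block n j0) U *m other_blocks j0 U.
Proof.
apply: ent_inj => x y; rewrite ent_mul ent_oracle.
have bu := block_uniq n j0.
pose z := put (block n j0) (sub (block n j0) y) x.
rewrite [RHS](bigD1 z) //= [X in _ = _ + X]big1 ?addr0 => [|z' z'z].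
  rewrite ent_emb agree_put ent_opmx sub_put // eqxx mul1r [LHS](bigD1 j0) //=.
  congr (_ * _); apply: eq_bigr => j jj0; congr (ent U _ _); apply/ffunP => k.
  rewrite [LHS]ffunE [RHS]ffunE put_off //; apply: contra jj0 => kj0; apply/eqP.
  by apply: block_disjoint kj0; exact: mem_tnth.
rewrite ent_emb ent_opmx; case: ifP => [xz'|_]; last by rewrite mul0r.
case: eqP => [zy|_]; last by rewrite mul0r mulr0.
by case/eqP: z'z; rewrite /z -zy put_sub.
Qed.

End Oracle.

Lemma adj_sum (R : realType) (J : Type) (s : seq J) m (F : J -> 'M[R[i]]_m) :
  (\sum_(e <- s) F e) ^t* = \sum_(e <- s) (F e) ^t*.
Proof. by rewrite raddf_sum raddf_sum. Qed.

Lemma adjZ (R : realType) m (k : R[i]) (M : 'M[R[i]]_m) : (k *: M) ^t* = k^* *: M ^t*.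
Proof. by apply/matrixP => i j; rewrite !mxE rmorphM. Qed.

Lemma adj_unitary (R : realType) m (M : 'M[R[i]]_m) : M \is unitarymx -> M ^t* \is unitarymx.
Proof. by rewrite trmxC_unitary. Qed.

(** Stated for arbitrary matrices: P and V stand for operators on the block, Q and W for operators
    on the other qubits, and only the two commutations needed are assumed. *)
Lemma mulmx_conj_split (K : pzRingType) m (P Q V W V' W' : 'M[K]_m) :
  V *m Q = Q *m V -> W' *m (V' *m P *m V) = V' *m P *m V *m W' ->
  (W' *m V') *m (P *m Q) *m (V *m W) = V' *m P *m V *m (W' *m Q *m W).
Proof.
move=> VQ WC; transitivity (W' *m (V' *m P *m (Q *m V)) *m W); first by rewrite !mulmxA.
rewrite -VQ; transitivity ((W' *m (V' *m P *m V)) *m Q *m W); first by rewrite !mulmxA.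
by rewrite WC !mulmxA.
Qed.

Lemma mulmx_bilinear_split (K : comPzRingType) m (c c' : K) (P Q P' Q' W T : 'M[K]_m) :
  P *m W *m Q = Q *m (P *m W) -> P' *m (Q *m T) = Q *m T *m P' ->
  (c *: (Q *m P)) *m (W *m T) *m (c' *: (P' *m Q')) =
  (c * c') *: ((P *m W *m P') *m (Q *m T *m Q')).
Proof.
move=> h1 h2; rewrite -!scalemxAl -scalemxAr scalerA; congr (_ *: _).
transitivity ((Q *m (P *m W)) *m T *m P' *m Q'); first by rewrite !mulmxA.
rewrite -h1; transitivity (P *m W *m (Q *m T *m P') *m Q'); first by rewrite !mulmxA.
by rewrite -h2 !mulmxA.
Qed.

(** * Biases of output parities as matrix entries on one block *)

Section Bias.
Variables (R : realType) (n t : nat).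
Hypothesis n0 : (0 < n)%N.
Local Notation C := R[i].
Local Notation op := 'M[C]_(2 ^ (n * t)).
Local Notation blk := 'M[C]_(2 ^ n).
Implicit Types (U : blk).

Definition sandwich (e : C * blk * blk * blk) U : C :=
  ent (e.1.1.2 ^t* *m U ^t* *m e.1.2 *m U *m e.2) 0 0.

Definition good_terms (W : C) (s : seq (C * blk * blk * blk)) :=
  (forall e, e \in s -> [/\ 0 <= e.1.1.1, e.1.1.2 \is unitarymx, e.1.2 \is unitarymx,
     \tr e.1.2 = 0 & e.2 \is unitarymx]) /\ \sum_(e <- s) e.1.1.1 <= W.

(** A block is an interval, and a gate across one of its ends acts on adjacent qubits, hence on the
    first or the last qubit of the block. *)
Lemma local_crossing (K : qcircuit R (n * t)) (j : 'I_t) : geom_local_1d K ->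
  exists l r : 'I_(n * t), forall g, List.In g (flatten K) ->
    crossing (wmask (block n j)) g -> (l \in tval (wires g)) || (r \in tval (wires g)).
Proof.
move=> Kl; exists (block_wire j (Ordinal n0)).
have n1 : (n.-1 < n)%N by rewrite prednK.
exists (block_wire j (Ordinal n1)) => g gK.
have gl : all (fun a : 'I_(n * t) => all (fun b : 'I_(n * t) => a <= b.+1)%N (wires g)) (wires g).
  move: Kl gK; rewrite /geom_local_1d; elim: (flatten K) => //= g' s IH /andP[gg' gs] [<- //|].
  exact: IH.
have loc (a b : 'I_(n * t)) : a \in tval (wires g) -> b \in tval (wires g) -> (a <= b.+1)%N.
  by move=> ag bg; move/allP/(_ a ag)/allP/(_ b bg): gl.
move=> /andP[/hasP[a ag aB] /hasP[b bg bB]].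
move: aB bB; rewrite !ffunE !mem_block => aB bB.
have := loc a b ag bg; have := loc b a bg ag => h1 h2.
have : a = block_wire j (Ordinal n0) \/ a = block_wire j (Ordinal n1).
  have [h|h] := ltnP b (j * n); [left|right]; apply: val_inj => /=; lia.
by case=> <-; rewrite ag ?orbT.
Qed.

(** The Pauli operator, the oracle and the circuit are all split along a block where the Pauli is
    not the identity. The circuit occurs twice, whence the square of its weight. The terms are fixed
    before U, so the same list serves both ensembles. *)
Lemma pauli_sandwich (K : qcircuit R (n * t)) (a b : cube 'I_(n * t)) :
  all (@qlayer_wf R (n * t)) K -> geom_local_1d K -> (a != 0) || (b != 0) ->
  exists2 s, good_terms (256 ^+ size K ^+ 2) s & forall U, U \is unitarymx ->
    `|ent ((qcircuit_mx K) ^t* *m ((oracle_mx t U) ^t* *m pauli R a b *m oracle_mx t U)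
           *m qcircuit_mx K) 0 0| <= \sum_(e <- s) e.1.1.1 * `|sandwich e U|.
Proof.
move=> Kw Kl ab.
have [j jab] : exists j, (meet a (wmask (block n j)) != 0) || (meet b (wmask (block n j)) != 0).
  have key (c : cube 'I_(n * t)) : c != 0 -> exists j, meet c (wmask (block n j)) != 0.
    move=> /cube_neq0[k ck]; have [j kj] := mem_some_block k; exists j.
    by apply/eqP => /ffunP/(_ k); rewrite !ffunE ck kj.
  by case/orP: ab => /key[j jc]; exists j; rewrite jc ?orbT.
set B := wmask (block n j) in jab.
have bu := block_uniq n j.
have [l [r lr]] := local_crossing j Kl.
have [s [sE sP sW]] := schmidt_circuit (l := l) (r := r) (B := B) Kw lr.
pose a' := meet a B; pose b' := meet b B.
have aB : supp_in B a' := supp_in_meet B a.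
have bB : supp_in B b' := supp_in_meet B b.
pose P := restr (block n j) (pauli R a' b').
have PB : acts_on B (pauli R a' b') := acts_on_pauli R aB bB.
have Pu : P \is unitarymx := restr_unitary bu PB (pauli_unitary R a' b').
have Pt : \tr P = 0 := tr_restr_pauli R bu aB bB jab.
pose Q := pauli R (diff a B) (diff b B).
have QB : acts_on (wire_compl B) Q := acts_on_pauli R (supp_in_diff B a) (supp_in_diff B b).
pose res (M : op) := restr (block n j) M.
exists [seq (`|e.1.1| * `|e'.1.1|, res e.1.2, P, res e'.1.2) | e <- s, e' <- s].
  split.
    move=> _ /allpairsP[[e e'] /= [es e's ->]] /=.
    have [h1 h2 _ _] := sP e es; have [k1 k2 _ _] := sP e' e's.
    exact: And5 (mulr_ge0 (normr_ge0 _) (normr_ge0 _)) (restr_unitary bu h1 h2) Pu Pt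
      (restr_unitary bu k1 k2).
  rewrite big_allpairs_dep /=; under eq_bigr do rewrite -mulr_sumr.
  by rewrite -mulr_suml expr2 ler_pM ?sumr_ge0.
move=> U Uu; pose Uj := emb (block n j) U; pose V := other_blocks j U.
have UjB : acts_on B Uj by exact: acts_on_emb.
have VB : acts_on (wire_compl B) V by exact: acts_on_other_blocks.
have Ou : oracle_mx t U \is unitarymx by exact: oracle_unitary.
have Uju : Uj \is unitarymx by rewrite emb_unitary.
have OE : oracle_mx t U = Uj *m V by exact: oracle_split.
have Vu : V \is unitarymx.
  have -> : V = Uj ^t* *m oracle_mx t U by rewrite OE mulmxA (unitaryK Uju) mul1mx.
  exact: mul_unitarymx (adj_unitary Uju) Ou.
have dB := @disjoint_wires_cneg (n * t) B.
pose W := Uj ^t* *m pauli R a' b' *m Uj; pose T := V ^t* *m Q *m V.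
have WB : acts_on B W := acts_on_mul (acts_on_mul (acts_on_adj UjB) PB) UjB.
have TB : acts_on (wire_compl B) T := acts_on_mul (acts_on_mul (acts_on_adj VB) QB) VB.
have Tu : T \is unitarymx.
  exact: mul_unitarymx (mul_unitarymx (adj_unitary Vu) (pauli_unitary _ _ _)) Vu.
have -> : (oracle_mx t U) ^t* *m pauli R a b *m oracle_mx t U = W *m T.
  rewrite OE adjM (pauli_split R B).
  exact: mulmx_conj_split (acts_on_comm dB UjB QB) (esym (acts_on_comm dB WB (acts_on_adj VB))).
rewrite sE adj_sum mulmx_suml mulmx_suml ent_sum.
apply: le_trans (ler_norm_sum _ _ _) _; rewrite big_allpairs_dep /= big_seq [leRHS]big_seq.
apply: ler_sum => e es; rewrite mulmx_sumr ent_sum.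
apply: le_trans (ler_norm_sum _ _ _) _; rewrite big_seq [leRHS]big_seq.
apply: ler_sum => e' e's; have [h1 h2 h3 h4] := sP e es; have [k1 k2 k3 k4] := sP e' e's.
rewrite adjZ adjM (mulmx_bilinear_split _ _ _
  (acts_on_comm dB (acts_on_mul (acts_on_adj h1) WB) (acts_on_adj h3))
  (acts_on_comm dB k1 (acts_on_mul (acts_on_adj h3) TB))).
rewrite ent_scale !normrM norm_conjC; apply: ler_wpM2l; first exact: mulr_ge0 (normr_ge0 _) (normr_ge0 _).
(* The initial state is a product state, so each term factors into an entry on the block and an
   entry on the rest. *)
rewrite (ent00_mul dB (acts_on_mul (acts_on_mul (acts_on_adj h1) WB) k1)
  (acts_on_mul (acts_on_mul (acts_on_adj h3) TB) k3)).
rewrite normrM /sandwich /=.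
have -> : e.1.2 ^t* *m W *m e'.1.2 =
    emb (block n j) ((res e.1.2) ^t* *m U ^t* *m P *m U *m res e'.1.2).
  rewrite -!(emb_mul bu) -!adj_emb (emb_restr h1) (emb_restr k1) (emb_restr PB).
  by rewrite /W !mulmxA.
have := ent_emb_put bu ((res e.1.2) ^t* *m U ^t* *m P *m U *m res e'.1.2) 0 0.
rewrite !put00 => ->; apply: ler_piMr; first exact: normr_ge0.
(* The rest still contains the other copies of U; for every U it is an entry of a unitary, which is
   all that is used. *)
exact: unitary_entry_le1 (mul_unitarymx (mul_unitarymx (adj_unitary h4) Tu) k4).
Qed.

(** The parity of the bits in S is the observable Z^S. Conjugation by the second circuit spreads it
    over its light cone, and each Pauli operator in its expansion is handled by [pauli_sandwich]. *)
Lemma bias_expansion (K1 K2 : qcircuit R (n * t)) (S : cube 'I_(n * t)) :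
  all (@qlayer_wf R (n * t)) K1 -> geom_local_1d K1 -> all (@qlayer_wf R (n * t)) K2 ->
  S != 0 ->
  exists2 s, good_terms (4 ^+ (2 ^ size K2 * wt S) * 256 ^+ size K1 ^+ 2) s &
  forall U, U \is unitarymx ->
    `|\sum_x chi C S x * `|ent (qcircuit_mx K2 *m oracle_mx t U *m qcircuit_mx K1) x 0| ^+ 2|
     <= \sum_(e <- s) e.1.1.1 * `|sandwich e U|.
Proof.
move=> K1w K1l K2w S0; pose O := (qcircuit_mx K2) ^t* *m pauli R 0 S *m qcircuit_mx K2.
have K2u := qcircuit_mx_unitary K2w.
have ZS : acts_on S (pauli R 0 S).
  by apply: acts_on_pauli; apply/forallP => i; rewrite ?ffunE ?implybb.
have [A OA Aw] := lightcone_circuit K2w ZS.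
have Ou : O \is unitarymx.
  exact: mul_unitarymx (mul_unitarymx (adj_unitary K2u) (pauli_unitary _ _ _)) K2u.
(* The identity is the one Pauli operator without a block to split along; its coefficient is the
   normalized trace of O, which equals that of Z^S, namely 0. *)
have O00 : pcoef O 0 0 = 0.
  rewrite /pcoef /avg.
  have -> : \sum_(y : cube 'I_(n * t)) ent O (y + 0) y * chi C 0 y = \tr O.
    by rewrite /mxtrace sum_idx; apply: eq_bigr => y _; rewrite addr0 chi0l mulr1.
  rewrite /O mxtrace_mulC mulmxA (unitarymxP K2u) mul1mx /mxtrace sum_idx.
  rewrite (eq_bigr (fun y : cube 'I_(n * t) => chi C y S)) => [|y _].
    by rewrite chi_sum (negbTE S0) !mulr0.
  by rewrite -/(ent _ y y) ent_pauli addr0 eqxx mul1r chiC.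
pose val U (p : cube 'I_(n * t) * cube 'I_(n * t)) :=
  ent ((qcircuit_mx K1) ^t* *m ((oracle_mx t U) ^t* *m pauli R p.1 p.2 *m oracle_mx t U)
           *m qcircuit_mx K1) 0 0.
have term p : exists s, good_terms (`|pcoef O p.1 p.2| * 256 ^+ size K1 ^+ 2) s /\
  forall U, U \is unitarymx -> `|pcoef O p.1 p.2 * val U p| <= \sum_(e <- s) e.1.1.1 * `|sandwich e U|.
  case: p => a b /=; have [/andP[/eqP -> /eqP ->]|ab] := boolP ((a == 0) && (b == 0)).
    exists [::]; split; first by split=> //; rewrite big_nil O00 normr0 mul0r.
    by move=> U _; rewrite O00 mul0r normr0 big_nil.
  rewrite negb_and in ab; have [s [sP sW] sU] := pauli_sandwich K1w K1l ab.
  exists [seq (`|pcoef O a b| * e.1.1.1, e.1.1.2, e.1.2, e.2) | e <- s]; split; first split.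
  - move=> _ /mapP[e es ->] /=; have [h1 h2 h3 h4 h5] := sP e es.
    exact: And5 (mulr_ge0 (normr_ge0 _) h1) h2 h3 h4 h5.
  - by rewrite big_map /= -mulr_sumr; apply: ler_wpM2l.
  move=> U Uu; rewrite big_map /= normrM; under eq_bigr do rewrite -mulrA.
  by rewrite -mulr_sumr; apply: ler_wpM2l => //; exact: sU.
have [f fP] := choice term.
exists (flatten [seq f p | p <- index_enum _]); first split.
- by move=> e /flatten_mapP[p _ ef]; have [[h _] _] := fP p; exact: h.
- rewrite big_flatten big_map /=.
  apply: le_trans (_ : \sum_p `|pcoef O p.1 p.2| * 256 ^+ size K1 ^+ 2 <= _).
    by apply: ler_sum => p _; have [[_ h] _] := fP p.
  rewrite -mulr_suml; apply: ler_wpM2r; first by rewrite !exprn_ge0.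
  rewrite -(pair_bigA _ (fun a b => `|pcoef O a b|)) /=; apply: le_trans (pcoef_l1 Ou OA) _.
  by apply: ler_weXn2l => //; rewrite ler1n.
move=> U Uu; set M := qcircuit_mx K2 *m oracle_mx t U *m qcircuit_mx K1.
have -> : \sum_x chi C S x * `|ent M x 0| ^+ 2 = ent (M ^t* *m pauli R 0 S *m M) 0 0.
  rewrite -mulmxA ent_mul; apply: eq_bigr => x _; rewrite ent_adj normCK.
  rewrite [ent (_ *m M) x 0]ent_mul (bigD1 x) //= big1 ?addr0 => [|y yx].
    by rewrite ent_pauli addr0 eqxx mul1r; ring.
  by rewrite ent_pauli addr0 eq_sym (negbTE yx) !mul0r.
have -> : M ^t* *m pauli R 0 S *m M =
    (qcircuit_mx K1) ^t* *m ((oracle_mx t U) ^t* *m O *m oracle_mx t U) *m qcircuit_mx K1.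
  by rewrite /M /O !adjM !mulmxA.
rewrite (pauli_expansion O) pair_big /= mulmx_sumr mulmx_suml mulmx_sumr mulmx_suml ent_sum.
rewrite big_flatten big_map /=; apply: le_trans (ler_norm_sum _ _ _) _.
apply: ler_sum => p _; have [_ h] := fP p; apply: le_trans (h U Uu).
by rewrite -!scalemxAr -!scalemxAl -!scalemxAr -scalemxAl ent_scale.
Qed.

End Bias.

(** * Trace norm and second moments *)

Section ComplexParts.
Variable R : realType.
Implicit Types z w : R[i].

Definition sqnorm z : R := complex.Re z ^+ 2 + complex.Im z ^+ 2.

Lemma cReD z w : complex.Re (z + w) = complex.Re z + complex.Re w.
Proof. by case: z; case: w. Qed.
Lemma cImD z w : complex.Im (z + w) = complex.Im z + complex.Im w.
Proof. by case: z; case: w. Qed.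
Lemma cReM z w : complex.Re (z * w) = complex.Re z * complex.Re w - complex.Im z * complex.Im w.
Proof. by case: z; case: w. Qed.
Lemma cImM z w : complex.Im (z * w) = complex.Re z * complex.Im w + complex.Im z * complex.Re w.
Proof. by case: z; case: w. Qed.
Lemma cReC z : complex.Re (z^*) = complex.Re z.
Proof. by case: z. Qed.
Lemma cImC z : complex.Im (z^*) = - complex.Im z.
Proof. by case: z. Qed.
Lemma cReN z : complex.Re (- z) = - complex.Re z.
Proof. by case: z. Qed.
Lemma cImN z : complex.Im (- z) = - complex.Im z.
Proof. by case: z. Qed.

Lemma Re_sum (J : Type) (s : seq J) (P : pred J) (F : J -> R[i]) :
  complex.Re (\sum_(j <- s | P j) F j) = \sum_(j <- s | P j) complex.Re (F j).
Proof. by elim/big_rec2: _ => // j x y _ <-; rewrite cReD. Qed.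
Lemma Im_sum (J : Type) (s : seq J) (P : pred J) (F : J -> R[i]) :
  complex.Im (\sum_(j <- s | P j) F j) = \sum_(j <- s | P j) complex.Im (F j).
Proof. by elim/big_rec2: _ => // j x y _ <-; rewrite cImD. Qed.

Lemma sqnorm_ge0 z : 0 <= sqnorm z.
Proof. by rewrite addr_ge0 ?sqr_ge0. Qed.

Lemma sqnormC z : sqnorm (z^*) = sqnorm z.
Proof. by rewrite /sqnorm cReC cImC sqrrN. Qed.

Lemma sqnormM z w : sqnorm (z * w) = sqnorm z * sqnorm w.
Proof. by rewrite /sqnorm cReM cImM; ring. Qed.

Lemma Re_mulC z : complex.Re (z * z^*) = sqnorm z.
Proof. by rewrite cReM cReC cImC /sqnorm; ring. Qed.

Lemma norm_sqnorm z : `|z| ^+ 2 = real_complex R (sqnorm z).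
Proof. by rewrite /sqnorm add_Re2_Im2. Qed.

Lemma norm_sqrt_sqnorm z : `|z| = real_complex R (Num.sqrt (sqnorm z)).
Proof. exact: normc_def. Qed.

Lemma sqnorm_eq0 z : (sqnorm z == 0) = (z == 0).
Proof.
rewrite /sqnorm paddr_eq0 ?sqr_ge0 // !sqrf_eq0; case: z => a b /=.
by rewrite eq_complex.
Qed.

Lemma unitary_row_sqnorm n (M : 'M[R[i]]_n) i : M \is unitarymx ->
  \sum_j sqnorm (M i j) = 1.
Proof.
move=> Mu; have := congr1 (@complex.Re R) (unitary_row_norm i Mu).
rewrite Re_sum => H; rewrite -[RHS]H; apply: eq_bigr => j _.
by rewrite norm_sqnorm.
Qed.

Lemma unitary_col_sqnorm n (M : 'M[R[i]]_n) j : M \is unitarymx ->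
  \sum_i sqnorm (M i j) = 1.
Proof.
rewrite -trmx_unitary => /(unitary_row_sqnorm j) <-.
by apply: eq_bigr => i _; rewrite mxE.
Qed.

Lemma Re_cauchy (J : finType) (x y : J -> R[i]) :
  \sum_j sqnorm (x j) = 1 ->
  \sum_j complex.Re (x j * y j) <= Num.sqrt (\sum_j sqnorm (y j)).
Proof.
move=> x1; set T := \sum_j sqnorm (y j).
have T0 : 0 <= T by apply: sumr_ge0 => j _; exact: sqnorm_ge0.
set s := Num.sqrt T; have s0 : 0 <= s := sqrtr_ge0 T.
have ss : s ^+ 2 = T by rewrite sqr_sqrtr.
have [sE|sN] := eqVneq s 0.
  have TE : T = 0 by rewrite -ss sE expr0n.
  rewrite sE big1 // => j _.
  have := psumr_eq0P (fun j _ => sqnorm_ge0 (y j)) TE (i := j) isT.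
  move/eqP; rewrite sqnorm_eq0 => /eqP ->.
  by rewrite mulr0.
have sp : 0 < s by rewrite lt_def sN.
(* Cauchy-Schwarz through AM-GM, with the weight s equal to the norm of y so that both halves
   contribute s / 2. *)
apply: le_trans (_ : \sum_j (s * sqnorm (x j) + sqnorm (y j) / s) / 2 <= _).
  apply: ler_sum => j _; rewrite ler_pdivlMr // -(ler_pM2r sp) cReM /sqnorm.
  rewrite [X in _ <= X]mulrDl divfK //.
  have := sqr_ge0 (s * complex.Re (x j) - complex.Re (y j)).
  have := sqr_ge0 (s * complex.Im (x j) + complex.Im (y j)).
  by rewrite !expr2; lra.
rewrite -mulr_suml big_split -mulr_sumr -mulr_suml x1 mulr1 -/T -ss expr2 mulfK //.
by rewrite /=; lra.
Qed.

End ComplexParts.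

Lemma adjE (R : realType) m n (M : 'M[R[i]]_(m, n)) i j : (M ^t*) i j = (M j i)^*.
Proof. by rewrite !mxE. Qed.

(** * Trace norm: duality with unitaries and rank-one operators *)

Section TraceNorm.
Variables (R : realType) (d : nat).
Local Notation C := R[i].
Implicit Types A M : 'M[C]_d.

Definition svd_right A := spectralmx (A ^t* *m A).

Lemma svd_right_unitary A : svd_right A \is unitarymx.
Proof. exact: spectral_unitarymx. Qed.

Lemma gram_svd A : (A *m (svd_right A) ^t*) ^t* *m (A *m (svd_right A) ^t*) =
  diag_mx (spectral_diag (A ^t* *m A)).
Proof.
set S := svd_right A; set H := A ^t* *m A.
have Su : S \is unitarymx := svd_right_unitary A.
have HN : H \is normalmx by apply/normalmxP; rewrite /H adjM trmxCK.
have HE := orthomx_spectralP HN.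
rewrite -/S in HE; rewrite adjM trmxCK; transitivity (S *m H *m S ^t*); first by rewrite /H !mulmxA.
rewrite [X in S *m X *m _]HE (invmx_unitary Su) !mulmxA (unitarymxP Su) mul1mx -mulmxA (unitarymxP Su).
by rewrite mulmx1.
Qed.

(** In an eigenbasis of the Gram matrix of A the columns of A become orthogonal, and their norms are
    the singular values. *)
Lemma trace_norm_svd A : trace_norm A =
  \sum_i Num.sqrt (\sum_k sqnorm ((A *m (svd_right A) ^t*) k i)).
Proof.
rewrite /trace_norm; apply: eq_bigr => i _; congr Num.sqrt.
have /matrixP/(_ i i) := gram_svd A; rewrite [RHS]mxE eqxx mulr1n => <-.
rewrite mxE Re_sum; apply: eq_bigr => k _.
by rewrite adjE mulrC Re_mulC.
Qed.

Lemma Re_tr_le_trace_norm M A : M \is unitarymx ->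
  complex.Re (\tr (M *m A)) <= trace_norm A.
Proof.
move=> Mu; rewrite trace_norm_svd; set S := svd_right A; set B := A *m S ^t*.
have Su : S \is unitarymx := svd_right_unitary A.
have -> : M *m A = M *m B *m S by rewrite /B -!mulmxA (unitaryK Su) mulmx1.
rewrite mxtrace_mulC mulmxA /mxtrace Re_sum; apply: ler_sum => i _.
rewrite mxE Re_sum; apply: Re_cauchy.
by apply: unitary_row_sqnorm; apply: mul_unitarymx.
Qed.

(** The singular values are the moduli of the entries of z = S v. The Gram matrix is diagonal, so
    products of two distinct ones vanish, and the square of their sum equals the sum of their
    squares, which is 1. *)
Lemma trace_norm_rank1 (u v : 'cV[C]_d) :
  \sum_k sqnorm (u k 0) = 1 -> \sum_k sqnorm (v k 0) = 1 -> trace_norm (u *m v ^t*) <= 1.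
Proof.
move=> u1 v1; rewrite trace_norm_svd; set S := svd_right _.
have Su : S \is unitarymx by exact: svd_right_unitary.
pose z := S *m v; have BE k i : (u *m v ^t* *m S ^t*) k i = u k 0 * (z i 0)^*.
  by rewrite -mulmxA -adjM -/z mxE big_ord1 !mxE.
pose a i := Num.sqrt (sqnorm (z i 0)).
under eq_bigr => i _.
  under eq_bigr do rewrite BE sqnormM sqnormC.
  rewrite -mulr_suml u1 mul1r -/(a i); over.
have a0 i : 0 <= a i by exact: sqrtr_ge0.
have aa i : a i ^+ 2 = sqnorm (z i 0) by rewrite sqr_sqrtr ?sqnorm_ge0.
have za : \sum_i a i ^+ 2 = 1.
  under eq_bigr do rewrite aa.
  have : z ^t* *m z = v ^t* *m v by rewrite /z adjM mulmxA -[_ *m S]mulmxA (unitaryK Su) mulmx1.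
  move=> /matrixP/(_ 0 0)/(congr1 (@complex.Re R)).
  rewrite [(z ^t* *m z) _ _]mxE [(v ^t* *m v) _ _]mxE !Re_sum -v1 => H.
  transitivity (\sum_k complex.Re (z ^t* 0 k * z k 0)).
    by apply: eq_bigr => k _; rewrite adjE mulrC Re_mulC.
  by rewrite H; apply: eq_bigr => k _; rewrite adjE mulrC Re_mulC.
have orth i j : i != j -> a i * a j = 0.
  move=> ij; have /matrixP/(_ i j) := gram_svd (u *m v ^t*); rewrite -/S [RHS]mxE (negbTE ij) mulr0n.
  rewrite mxE => H; have {}H : z i 0 * (z j 0)^* = 0.
    rewrite -[RHS]H -[LHS]mul1r.
    have -> : 1 = \sum_k (u k 0)^* * u k 0 :> C.
      apply/eqP; rewrite eq_complex Re_sum Im_sum; apply/andP; split; apply/eqP.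
        by rewrite -[LHS]u1; apply: eq_bigr => k _; rewrite mulrC Re_mulC.
      by rewrite big1 // => k _; rewrite cImM cReC cImC; ring.
    rewrite mulr_suml; apply: eq_bigr => k _; rewrite adjE !BE rmorphM /= conjCK.
    by ring.
  have : sqnorm (z i 0) * sqnorm (z j 0) = 0 by rewrite -[sqnorm (z j 0)]sqnormC -sqnormM H /sqnorm /= expr0n addr0.
  rewrite -!aa -exprMn => /eqP; rewrite sqrf_eq0 => /eqP //.
have : (\sum_i a i) ^+ 2 = 1.
  rewrite -za expr2 mulr_suml; apply: eq_bigr => i _.
  rewrite (bigD1 i) //= mulrDr mulr_sumr big1 ?addr0 ?expr2 // => j ji.
  by rewrite orth // eq_sym.
have s0 : 0 <= \sum_i a i by apply: sumr_ge0.
by move=> s1; rewrite -(@ler_sqr _ _ 1) ?nnegrE // s1 expr1n.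
Qed.

End TraceNorm.

(** * Expectations of functions bounded on an almost sure event *)

Section Expectation.
Variables (R : realType) (dsp : measure_display) (T : measurableType dsp).
Variables (P : probability T R) (E : set T).
Hypotheses (mE : measurable E) (PE : P E = 1%E).
Implicit Types f g : T -> R.

(* Random unitaries are only almost surely unitary: functions of them are
   bounded on an event E of probability 1. *)
Definition bounded_rv f := measurable_fun setT f /\ exists M, forall w, E w -> `|f w| <= M.

Definition mean f : R := (\int[P]_(w in E) f w)%R.

Lemma bounded_rv_integrable f : bounded_rv f -> P.-integrable E (EFin \o f).
Proof.
move=> [mf [M fM]]; apply: measurable_bounded_integrable => //.
- by rewrite [X in (X < _)%E]PE ltry.
- exact: measurable_funTS.
- exists M; split; first exact: num_real.
  by move=> y My w Ew; apply: le_trans (fM w Ew) (ltW My).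
Qed.

Lemma Rintegral_setT f : bounded_rv f -> (\int[P]_w f w)%R = mean f.
Proof.
move=> fb; have fi := bounded_rv_integrable fb; case: fb => mf _.
have mN : measurable (~` E)%classic by exact: measurableC.
have N0 : P (~` E)%classic = 0 by rewrite probability_setC // PE subee.
have EE : (setT `\` ~` E = E)%classic by rewrite setTD setCK.
have mEf := measurableT_comp (@EFin_measurable R setT) mf.
rewrite /Rintegral (negligible_integral mN) ?EE //.
by apply/(negligible_integrable mN measurableT mEf N0); rewrite EE.
Qed.

Lemma bounded_rv_cst c : bounded_rv (fun=> c).
Proof. by split; [exact: measurable_cst|exists `|c|]. Qed.

Lemma bounded_rvD f g : bounded_rv f -> bounded_rv g -> bounded_rv (fun w => f w + g w).
Proof.
move=> [mf [M fM]] [mg [M' gM]]; split; first exact: measurable_funD.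
exists (M + M') => w Ew; apply: le_trans (ler_normD _ _) _.
by apply: lerD; [apply: fM|apply: gM].
Qed.

Lemma bounded_rvM f g : bounded_rv f -> bounded_rv g -> bounded_rv (fun w => f w * g w).
Proof.
move=> [mf [M fM]] [mg [M' gM]]; split; first exact: measurable_funM.
by exists (M * M') => w Ew; rewrite normrM ler_pM //; [apply: fM|apply: gM].
Qed.

Lemma bounded_rvZ c f : bounded_rv f -> bounded_rv (fun w => c * f w).
Proof. by move=> fb; apply: bounded_rvM => //; exact: bounded_rv_cst. Qed.

Lemma bounded_rvN f : bounded_rv f -> bounded_rv (fun w => - f w).
Proof.
move=> /(bounded_rvZ (-1)); congr bounded_rv; apply/funext => w; exact: mulN1r.
Qed.

Lemma bounded_rvB f g : bounded_rv f -> bounded_rv g -> bounded_rv (fun w => f w - g w).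
Proof. by move=> fb gb; apply: bounded_rvD => //; exact: bounded_rvN. Qed.

Lemma bounded_rv_sum (J : Type) (s : seq J) (Q : pred J) (F : J -> T -> R) :
  (forall j, bounded_rv (F j)) -> bounded_rv (fun w => \sum_(j <- s | Q j) F j w).
Proof.
move=> Fb; elim: s => [|j s IH].
  by rewrite (_ : (fun w => _) = fun=> 0); [exact: bounded_rv_cst|apply/funext => w; rewrite big_nil].
rewrite (_ : (fun w => _) = fun w => (if Q j then F j w else 0) + \sum_(j <- s | Q j) F j w).
  by case: (Q j); apply: bounded_rvD => //; exact: bounded_rv_cst.
by apply/funext => w; rewrite big_cons; case: (Q j); rewrite ?add0r.
Qed.

Lemma meanD f g : bounded_rv f -> bounded_rv g -> mean (fun w => f w + g w) = mean f + mean g.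
Proof. by move=> /bounded_rv_integrable fi /bounded_rv_integrable gi; apply: RintegralD. Qed.

Lemma meanZ c f : bounded_rv f -> mean (fun w => c * f w) = c * mean f.
Proof. by move=> /bounded_rv_integrable fi; apply: RintegralZl. Qed.

Lemma meanB f g : bounded_rv f -> bounded_rv g -> mean (fun w => f w - g w) = mean f - mean g.
Proof. by move=> /bounded_rv_integrable fi /bounded_rv_integrable gi; apply: RintegralB. Qed.

Lemma mean_cst c : mean (fun=> c) = c.
Proof. by rewrite /mean Rintegral_cst // [X in fine X]PE mulr1. Qed.

Lemma mean_le f g : bounded_rv f -> bounded_rv g -> (forall w, E w -> f w <= g w) ->
  mean f <= mean g.
Proof. by move=> /bounded_rv_integrable fi /bounded_rv_integrable gi; apply: le_Rintegral. Qed.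

Lemma mean_ge0 f : (forall w, E w -> 0 <= f w) -> 0 <= mean f.
Proof. exact: Rintegral_ge0. Qed.

Lemma eq_mean f g : (forall w, E w -> f w = g w) -> mean f = mean g.
Proof. by move=> fg; apply: eq_Rintegral => w; rewrite inE; apply: fg. Qed.

Lemma mean_sum (J : Type) (s : seq J) (Q : pred J) (F : J -> T -> R) :
  (forall j, bounded_rv (F j)) ->
  mean (fun w => \sum_(j <- s | Q j) F j w) = \sum_(j <- s | Q j) mean (F j).
Proof.
move=> Fb; elim: s => [|j s IH].
  rewrite big_nil -[RHS](mean_cst 0); apply: eq_mean => w _; by rewrite big_nil.
rewrite big_cons; case: ifP => Qj; last first.
  by rewrite -IH; apply: eq_mean => w _; rewrite big_cons Qj.
rewrite -IH -meanD //; last exact: bounded_rv_sum.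
by apply: eq_mean => w _; rewrite big_cons Qj.
Qed.

Lemma mean_norm f : bounded_rv f -> `|mean f| <= mean (fun w => `|f w|).
Proof. by move=> /bounded_rv_integrable fi; apply: le_normr_Rintegral. Qed.

Section Complex.
Local Notation C := R[i].

Definition bounded_cv (f : T -> C) :=
  bounded_rv (fun w => complex.Re (f w)) /\ bounded_rv (fun w => complex.Im (f w)).

Lemma bounded_cv_cst c : bounded_cv (fun=> c).
Proof. by split; exact: bounded_rv_cst. Qed.

Lemma eq_bounded_rv f g : f =1 g -> bounded_rv f -> bounded_rv g.
Proof. by move=> /funext ->. Qed.

Lemma bounded_cvM (f g : T -> C) : bounded_cv f -> bounded_cv g -> bounded_cv (fun w => f w * g w).
Proof.
move=> [f1 f2] [g1 g2]; split.
  by apply: eq_bounded_rv (bounded_rvB (bounded_rvM f1 g1) (bounded_rvM f2 g2)) => w; rewrite cReM.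
by apply: eq_bounded_rv (bounded_rvD (bounded_rvM f1 g2) (bounded_rvM f2 g1)) => w; rewrite cImM.
Qed.

Lemma bounded_cv_conj (f : T -> C) : bounded_cv f -> bounded_cv (fun w => (f w)^*).
Proof.
move=> [f1 f2]; split; first by apply: eq_bounded_rv f1 => w; rewrite cReC.
by apply: eq_bounded_rv (bounded_rvN f2) => w; rewrite cImC.
Qed.

Lemma bounded_cv_sum (J : Type) (s : seq J) (Q : pred J) (F : J -> T -> C) :
  (forall j, bounded_cv (F j)) -> bounded_cv (fun w => \sum_(j <- s | Q j) F j w).
Proof.
move=> Fb; split.
  apply: eq_bounded_rv (bounded_rv_sum s Q (fun j => (Fb j).1)) => w.
  by rewrite Re_sum.
apply: eq_bounded_rv (bounded_rv_sum s Q (fun j => (Fb j).2)) => w.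
by rewrite Im_sum.
Qed.

Lemma bounded_rv_sqnorm (f : T -> C) : bounded_cv f -> bounded_rv (fun w => sqnorm (f w)).
Proof.
by move=> [f1 f2]; apply: eq_bounded_rv (bounded_rvD (bounded_rvM f1 f1) (bounded_rvM f2 f2)).
Qed.

Definition bounded_mx m n (X : T -> 'M[C]_(m, n)) := forall i j, bounded_cv (fun w => X w i j).

Lemma bounded_mx_cst m n (M : 'M[C]_(m, n)) : bounded_mx (fun=> M).
Proof. by move=> i j; exact: bounded_cv_cst. Qed.

Lemma eq_bounded_cv (f g : T -> C) : f =1 g -> bounded_cv f -> bounded_cv g.
Proof. by move=> /funext ->. Qed.

Lemma bounded_mxM m n p (X : T -> 'M[C]_(m, n)) (Y : T -> 'M[C]_(n, p)) :
  bounded_mx X -> bounded_mx Y -> bounded_mx (fun w => X w *m Y w).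
Proof.
move=> Xb Yb i j.
apply: (@eq_bounded_cv (fun w => \sum_k X w i k * Y w k j)) => [w|]; first by rewrite mxE.
by apply: bounded_cv_sum => k; apply: bounded_cvM.
Qed.

Lemma bounded_mx_adj m n (X : T -> 'M[C]_(m, n)) : bounded_mx X -> bounded_mx (fun w => (X w) ^t*).
Proof.
move=> Xb i j; apply: (@eq_bounded_cv (fun w => (X w j i)^*)) => [w|]; first by rewrite adjE.
exact: bounded_cv_conj.
Qed.

Lemma bounded_mx_tens m n p q (X : T -> 'M[C]_(m, n)) (Y : T -> 'M[C]_(p, q)) :
  bounded_mx X -> bounded_mx Y -> bounded_mx (fun w => X w *t Y w).
Proof.
move=> Xb Yb i j; set i' := mxtens_unindex i; set j' := mxtens_unindex j.
apply: (@eq_bounded_cv (fun w => X w i'.1 j'.1 * Y w i'.2 j'.2)) => [w|]; first by rewrite mxE.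
exact: bounded_cvM.
Qed.

Lemma Re_tr_expect_mx d (M : 'M[C]_d) (X : T -> 'M[C]_d) : bounded_mx X ->
  complex.Re (\tr (M *m expect_mx P X)) = mean (fun w => complex.Re (\tr (M *m X w))).
Proof.
move=> Xb; rewrite /mxtrace Re_sum.
transitivity (\sum_i \sum_k mean (fun w => complex.Re (M i k * X w k i))).
  apply: eq_bigr => i _; rewrite mxE Re_sum; apply: eq_bigr => k _.
  have [b1 b2] := Xb k i; rewrite mxE cReM /= !Rintegral_setT // -!meanZ // -meanB;
    try exact: bounded_rvZ.
  by apply: eq_mean => w _; rewrite cReM.
have Mb i k : bounded_rv (fun w => complex.Re (M i k * X w k i)).
  by case: (bounded_cvM (bounded_cv_cst (M i k)) (Xb k i)).
under eq_bigr do rewrite -mean_sum //.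
rewrite -mean_sum => [|i]; last exact: bounded_rv_sum.
apply: eq_mean => w _; rewrite Re_sum; apply: eq_bigr => i _.
by rewrite mxE Re_sum.
Qed.

End Complex.
End Expectation.

(** * Squared matrix entries as traces over two copies *)

Section SecondMoment.
Variables (R : realType) (d : nat).
Local Notation C := R[i].
Implicit Types X Y V Q : 'M[C]_d.

Definition middle X Q Y V (i0 : 'I_d) : C := (X ^t* *m V ^t* *m Q *m V *m Y) i0 i0.

Lemma tr_tens p q (M : 'M[C]_p) (N : 'M[C]_q) : \tr (M *t N) = \tr M * \tr N.
Proof. by rewrite /mxtrace mulr_sum; apply: eq_bigr => i _; rewrite mxE. Qed.

Lemma adj_tens m n p q (M : 'M[C]_(m, n)) (N : 'M[C]_(p, q)) : (M *t N) ^t* = M ^t* *t N ^t*.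
Proof. by rewrite trmx_tens map_mxT. Qed.

Lemma tr_adj n (M : 'M[C]_n) : \tr (M ^t*) = (\tr M)^*.
Proof. by rewrite /mxtrace rmorph_sum; apply: eq_bigr => k _; rewrite adjE. Qed.

(** A rank-one operator with the two vectors exchanged between ket and bra: tested against Q on one
    copy and its adjoint on the other, it yields a matrix entry times its conjugate. It need not be
    a state, so the design condition is applied to a general operator of trace norm at most 1. *)
Definition swap_state X Y (i0 : 'I_d) : 'M[C]_(d * d) :=
  (col i0 Y *t col i0 X) *m (col i0 X *t col i0 Y) ^t*.

Lemma tens_col_sqnorm (u v : 'cV[C]_d) :
  \sum_k sqnorm (u k 0) = 1 -> \sum_k sqnorm (v k 0) = 1 ->
  \sum_k sqnorm ((u *t v : 'M[C]_(d * d, 1)) k 0) = 1.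
Proof.
move=> u1 v1; rewrite -[RHS]mulr1 -{1}u1 -v1 mulr_sum; apply: eq_bigr => k _.
by rewrite mxE -sqnormM; congr (sqnorm (u _ _ * v _ _)); apply: ord1.
Qed.

Lemma trace_norm_swap_state X Y i0 : X \is unitarymx -> Y \is unitarymx ->
  trace_norm (swap_state X Y i0) <= 1.
Proof.
move=> Xu Yu.
have cX : \sum_k sqnorm (col i0 X k 0) = 1.
  by rewrite -(unitary_col_sqnorm i0 Xu); apply: eq_bigr => k _; rewrite mxE.
have cY : \sum_k sqnorm (col i0 Y k 0) = 1.
  by rewrite -(unitary_col_sqnorm i0 Yu); apply: eq_bigr => k _; rewrite mxE.
exact: (@trace_norm_rank1 R (d * d) (col i0 Y *t col i0 X) (col i0 X *t col i0 Y)
  (tens_col_sqnorm cY cX) (tens_col_sqnorm cX cY)).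
Qed.

Lemma adj_col_mul (X M Y : 'M[C]_d) i0 :
  \tr ((col i0 X) ^t* *m M *m col i0 Y) = (X ^t* *m M *m Y) i0 i0.
Proof.
rewrite /mxtrace big_ord1 !mxE; apply: eq_bigr => k _; rewrite !mxE; congr (_ * _).
by apply: eq_bigr => l _; rewrite !mxE.
Qed.

Lemma sqnorm_middle X Q Y V i0 :
  complex.Re (\tr ((Q *t Q ^t*) *m ((V *t V) *m swap_state X Y i0 *m (V *t V) ^t*))) =
  sqnorm (middle X Q Y V i0).
Proof.
rewrite /swap_state; set u := col i0 X; set v := col i0 Y.
have -> : \tr ((Q *t Q ^t*) *m ((V *t V) *m ((v *t u) *m (u *t v) ^t*) *m (V *t V) ^t*)) =
   \tr ((u *t v) ^t* *m (V *t V) ^t* *m (Q *t Q ^t*) *m (V *t V) *m (v *t u)).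
  rewrite !mulmxA mxtrace_mulC !mulmxA mxtrace_mulC !mulmxA.
  by [].
rewrite !adj_tens !tensmx_mul tr_tens /middle.
have trq : \tr (u ^t* *m V ^t* *m Q *m V *m v) = (X ^t* *m V ^t* *m Q *m V *m Y) i0 i0.
  by rewrite -!mulmxA !mulmxA -2!(mulmxA (u ^t*)) adj_col_mul !mulmxA.
have -> : v ^t* *m V ^t* *m Q ^t* *m V *m u = (u ^t* *m V ^t* *m Q *m V *m v) ^t*.
  by rewrite !adjM !trmxCK !mulmxA.
rewrite tr_adj trq; exact: Re_mulC.
Qed.

End SecondMoment.

Section Design.
Variables (R : realType) (d : nat).
Local Notation C := R[i].

Lemma bounded_mx_unitary dsp (T : measurableType dsp) (E : set T) (U : T -> 'M[C]_d) :
  (forall w, E w -> U w \is unitarymx) ->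
  (forall i j, measurable_fun setT (fun w => complex.Re (U w i j)) /\
               measurable_fun setT (fun w => complex.Im (U w i j))) ->
  bounded_mx E U.
Proof.
move=> Uu Um i j; have [mRe mIm] := Um i j.
have le1 w : E w -> sqnorm (U w i j) <= 1.
  move=> Ew; rewrite -(unitary_row_sqnorm i (Uu w Ew)) (bigD1 j) //= lerDl.
  by apply: sumr_ge0 => k _; exact: sqnorm_ge0.
split; split => //; exists 1 => w Ew; have := le1 w Ew; rewrite /sqnorm => h;
  rewrite -(@ler_sqr _ _ 1) ?nnegrE // expr1n real_normK ?num_real //.
  by apply: le_trans h; rewrite lerDl sqr_ge0.
by apply: le_trans h; rewrite lerDr sqr_ge0.
Qed.

Lemma twirl2_second_moment dsp (T : measurableType dsp) (P : probability T R) (E : set T)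
    (U : T -> 'M[C]_d) (X Q Y : 'M[C]_d) i0 :
  measurable E -> P E = 1%E -> bounded_mx E U ->
  complex.Re (\tr ((Q *t Q ^t*) *m twirl2 P U (swap_state X Y i0))) =
  mean P E (fun w => sqnorm (middle X Q Y (U w) i0)).
Proof.
move=> mE PE Ub; have UU := bounded_mx_tens Ub Ub.
rewrite (Re_tr_expect_mx mE PE); last first.
  apply: bounded_mxM; last exact: bounded_mx_adj.
  by apply: bounded_mxM => //; exact: bounded_mx_cst.
by apply: eq_mean => w _; exact: sqnorm_middle.
Qed.

(** Duality: the unitary Q *t Q ^t* tests the difference of the two twirls of [swap_state]. *)
Lemma design_second_moment (eps : R) dsp (T : measurableType dsp) (P : probability T R)
    (E : set T) (U : T -> 'M[C]_d) dsp' (T' : measurableType dsp') (P' : probability T' R)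
    (E' : set T') (U' : T' -> 'M[C]_d) (X Q Y : 'M[C]_d) i0 :
  measurable E -> P E = 1%E -> bounded_mx E U ->
  measurable E' -> P' E' = 1%E -> bounded_mx E' U' ->
  (forall rho, trace_norm rho <= 1 -> trace_norm (twirl2 P U rho - twirl2 P' U' rho) <= eps) ->
  X \is unitarymx -> Q \is unitarymx -> Y \is unitarymx ->
  mean P E (fun w => sqnorm (middle X Q Y (U w) i0)) <=
  eps + mean P' E' (fun w => sqnorm (middle X Q Y (U' w) i0)).
Proof.
move=> mE PE Ub mE' PE' Ub' design Xu Qu Yu.
rewrite -(twirl2_second_moment X Q Y i0 mE PE Ub) -(twirl2_second_moment X Q Y i0 mE' PE' Ub').
have QQu : Q *t Q ^t* \is unitarymx := tensmx_unitary Qu (adj_unitary Qu).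
have := Re_tr_le_trace_norm (twirl2 P U (swap_state X Y i0) - twirl2 P' U' (swap_state X Y i0)) QQu.
move=> /le_trans/(_ (design _ (trace_norm_swap_state i0 Xu Yu))).
by rewrite mulmxBr linearB /= cReD cReN lerBlDr addrC.
Qed.

End Design.

(** * The Haar second moment *)

Section Haar.
Variables (R : realType) (d : nat).
Local Notation C := R[i].
Local Notation BM := (borel_mx R d).

Lemma measurable_entry (i j : 'I_d) :
  measurable_fun setT (fun V : BM => complex.Re ((V : 'M[C]_d) i j)) /\
  measurable_fun setT (fun V : BM => complex.Im ((V : 'M[C]_d) i j)).
Proof.
by split=> _ B mB; rewrite setTI; apply: sub_sigma_algebra; exists i, j, B; split=> //;
  [left|right].
Qed.

Definition unitaries : set BM := [set V | (V : 'M[C]_d) \is unitarymx]%classic.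

Lemma bounded_mx_id (E : set BM) : (E `<=` unitaries)%classic ->
  bounded_mx E (id : BM -> 'M[C]_d).
Proof.
by move=> EU; apply: bounded_mx_unitary => [w /EU //|i j]; exact: measurable_entry.
Qed.

Lemma measurable_unitaries : measurable unitaries.
Proof.
pose h (V : BM) := \sum_i \sum_j sqnorm (((V : 'M[C]_d) *m (V : 'M[C]_d) ^t*) i j - (1%:M : 'M[C]_d) i j).
(* On the empty event boundedness is vacuous, so the closure lemmas for [bounded_rv] here prove
   measurability alone. *)
have hb : bounded_rv set0 h.
  apply: bounded_rv_sum => i; apply: bounded_rv_sum => j; apply: bounded_rv_sqnorm.
  have Vb : bounded_mx set0 (id : BM -> 'M[C]_d) by apply: bounded_mx_id => V.
  have [b1 b2] := bounded_mxM Vb (bounded_mx_adj Vb) i j.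
  split.
    apply: eq_bounded_rv (bounded_rvB b1 (bounded_rv_cst _ (complex.Re ((1%:M : 'M[C]_d) i j)))) => V.
    by rewrite cReD cReN.
  apply: eq_bounded_rv (bounded_rvB b2 (bounded_rv_cst _ (complex.Im ((1%:M : 'M[C]_d) i j)))) => V.
  by rewrite cImD cImN.
have -> : unitaries = (h @^-1` [set 0])%classic.
  apply/seteqP; split=> V /=; rewrite /unitaries /=.
    move=> /unitarymxP Vu; rewrite /h Vu big1 // => i _; rewrite big1 // => j _.
    by rewrite subrr /sqnorm /= expr0n addr0.
  move=> h0; apply/unitarymxP/matrixP => i j; apply/eqP; rewrite -subr_eq0 -sqnorm_eq0.
  have g0 k l : 0 <= sqnorm (((V : 'M[C]_d) *m (V : 'M[C]_d) ^t*) k l - (1%:M : 'M[C]_d) k l).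
    exact: sqnorm_ge0.
  have r0 k : 0 <= \sum_l sqnorm (((V : 'M[C]_d) *m (V : 'M[C]_d) ^t*) k l - (1%:M : 'M[C]_d) k l).
    by apply: sumr_ge0.
  have := psumr_eq0P (fun k _ => r0 k) h0 (i := i) isT.
  by move=> /(psumr_eq0P (fun l _ => g0 i l)) /(_ j isT)/eqP.
have [mh _] := hb; rewrite -[X in measurable X]setTI; apply: mh => //.
Qed.

Section Invariance.
Variable mu : probability BM R.
Hypothesis mu_haar : is_haar mu.

Lemma haar_unitaries : mu unitaries = 1%E.
Proof. by case: mu_haar. Qed.

Local Notation Mean := (mean mu unitaries).

Lemma measurable_mulmxr (K : 'M[C]_d) :
  measurable_fun setT (fun V : BM => ((V : 'M[C]_d) *m K : BM)).
Proof.
apply: (@measurability _ _ BM BM setT (fun V : BM => ((V : 'M[C]_d) *m K : BM))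
  (@entry_cylinders R d) erefl).
move=> _ [B0 [k [j [B [mB BE]]]] <-].
have Vb : bounded_mx set0 (id : BM -> 'M[C]_d) by apply: bounded_mx_id => V.
have [[m1 _] [m2 _]] := bounded_mxM Vb (bounded_mx_cst set0 K) k j.
by case: BE => ->; [exact: m1|exact: m2].
Qed.

Lemma mean_mulmxr (K : 'M[C]_d) (f : BM -> R) : K \is unitarymx -> bounded_rv unitaries f ->
  Mean (fun V => f ((V : 'M[C]_d) *m K)) = Mean f.
Proof.
move=> Ku fb; have mU := measurable_unitaries; have U1 := haar_unitaries.
have mK := measurable_mulmxr K.
have fKb : bounded_rv unitaries (fun V : BM => f ((V : 'M[C]_d) *m K : BM)).
  case: fb => mf [M fM]; split; first exact: (measurableT_comp mf mK).
  by exists M => V Vu; apply: fM; apply: mul_unitarymx.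
rewrite -(Rintegral_setT mU U1 fb) -(Rintegral_setT mU U1 fKb) /Rintegral; congr fine.
have fi := bounded_rv_integrable mU U1 fKb.
have mf : measurable_fun setT (EFin \o f) by apply: measurableT_comp => //; case: fb.
have fKi : mu.-integrable ((fun V : BM => (V : 'M[C]_d) *m K : BM) @^-1` setT)%classic
    ((EFin \o f) \o (fun V : BM => (V : 'M[C]_d) *m K : BM)).
  rewrite preimage_setT.
  have mN : measurable (~` unitaries)%classic by exact: measurableC.
  have N0 : mu (~` unitaries)%classic = 0%E by rewrite probability_setC // U1 subee.
  apply/(negligible_integrable mN measurableT _ N0); first exact: measurableT_comp.
  by rewrite setTD setCK.
have := integral_pushforward mK mf fKi measurableT.
rewrite preimage_setT => <-.
apply: eq_measure_integral => A mA _; case: mu_haar => _ _ /(_ K Ku A mA); exact.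
Qed.

End Invariance.
End Haar.

(** * Conjugation by permutations, signs and a reflection *)

Section Conjugates.
Variables (R : realType) (d : nat).
Local Notation C := R[i].
Implicit Types (K W : 'M[C]_d).

Lemma sum_two_point (V : pzSemiRingType) (J : finType) (a b : J) (p q : V) (F : J -> V) :
  \sum_j (p * (j == a)%:R + q * (j == b)%:R) * F j = p * F a + q * F b.
Proof.
under eq_bigr do rewrite mulrDl.
rewrite big_split /= (bigD1 a) //= eqxx mulr1 big1 => [|j /negbTE ->]; last by rewrite mulr0 mul0r.
rewrite (bigD1 b) //= eqxx mulr1 big1 => [|j /negbTE ->]; last by rewrite mulr0 mul0r.
by rewrite !addr0.
Qed.

Lemma conj_entry K W (i j : 'I_d) :
  (K ^t* *m W *m K) i j = \sum_a (K a i)^* * \sum_b K b j * W a b.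
Proof.
rewrite -mulmxA mxE; apply: eq_bigr => a _; rewrite adjE; congr (_ * _).
by rewrite mxE; apply: eq_bigr => b _; rewrite mulrC.
Qed.

Lemma perm_unitary (s : 'S_d) : (perm_mx s : 'M[C]_d) \is unitarymx.
Proof.
apply/unitarymxP; rewrite tr_perm_mx map_perm_mx -perm_mxM mulgV perm_mx1 //.
Qed.

Lemma perm_conj (s : 'S_d) W (i j : 'I_d) :
  ((perm_mx s^-1 : 'M[C]_d) ^t* *m W *m perm_mx s^-1) i j = W (s i) (s j).
Proof. by rewrite tr_perm_mx map_perm_mx invgK -row_permE -col_permE !mxE. Qed.

Definition flip (l : 'I_d) : 'M[C]_d := diag_mx (\row_k (-1) ^+ (k == l)).

Lemma flip_adj l : (flip l) ^t* = flip l.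
Proof.
rewrite /flip tr_diag_mx; apply/matrixP => i j; rewrite !mxE.
by rewrite rmorphMn /= rmorphXn rmorphN rmorph1.
Qed.

Lemma flip_unitary l : flip l \is unitarymx.
Proof.
apply/unitarymxP; rewrite flip_adj mulmx_diag; apply/matrixP => i j; rewrite !mxE.
by rewrite -expr2 sqrr_sign.
Qed.

Lemma flip_conj l W i j :
  ((flip l) ^t* *m W *m flip l) i j = (-1) ^+ (i == l) * (-1) ^+ (j == l) * W i j.
Proof. by rewrite flip_adj mul_mx_diag mul_diag_mx !mxE mulrAC. Qed.

Section Reflection.
Variables i0 i1 : 'I_d.
Hypothesis i01 : i0 != i1.

Let x : 'cV[C]_d := delta_mx i0 0 + 2 *: delta_mx i1 0.

(* The reflection along e_i0 + 2 e_i1: its rational entries 3/5 and -4/5 mix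
   diagonal and off-diagonal entries, which compares their second moments. *)
Definition reflection : 'M[C]_d := 1%:M - (2 / 5) *: (x *m x ^t*).

Lemma reflection_xx : x ^t* *m x = 5%:M.
Proof.
apply/matrixP => i j; rewrite !ord1 mxE.
under eq_bigr do rewrite adjE !mxE eqxx !andbT.
transitivity (\sum_k (1 * (k == i0)%:R + 2 * (k == i1)%:R) * ((k == i0)%:R + 2 * (k == i1)%:R) : C).
  by apply: eq_bigr => k _; rewrite mul1r rmorphD rmorphM !rmorph_nat.
rewrite sum_two_point !eqxx [i1 == _]eq_sym (negbTE i01) !mxE /=.
by ring.
Qed.

Lemma reflection_adj : reflection ^t* = reflection.
Proof.
rewrite /reflection linearB /= map_mxB -/(_ ^t*) trmx1 map_mx1; congr (_ - _).
by rewrite adjZ adjM trmxCK rmorphM fmorphV !rmorph_nat.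
Qed.

Lemma reflection_unitary : reflection \is unitarymx.
Proof.
apply/unitarymxP; rewrite reflection_adj /reflection mulmxBr mulmx1.
rewrite mulmxBl mul1mx -scalemxAl -scalemxAr -mulmxA (mulmxA _ x) reflection_xx.
rewrite mul_scalar_mx -scalemxAr !scalerA.
rewrite -addrA -[RHS]addr0; congr (_ + _).
rewrite -opprD -scalerBl -scalerDl.
have -> : 2 / 5 + (2 / 5 - 2 / 5 * (2 / 5 * 5)) = 0 :> C by field.
by rewrite scale0r oppr0.
Qed.

(** The entry (i0, i1) of the conjugate is (-12 W00 - 9 W01 + 16 W10 + 12 W11) / 25, solved here for
    the difference of the diagonal entries. *)
Lemma reflection_conj W : let W' := reflection ^t* *m W *m reflection in
  W i0 i0 - W i1 i1 = (-25 * W' i0 i1 - 9 * W i0 i1 + 16 * W i1 i0) / 12.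
Proof.
move=> W'.
have Kx k : (x k 0 = (k == i0)%:R + 2 * (k == i1)%:R) by rewrite !mxE eqxx !andbT.
have KE k l : reflection k l = (k == l)%:R - 2 / 5 * (x k 0 * x l 0).
  have xx : (x *m x ^t*) k l = x k 0 * x l 0.
    by rewrite mxE big_ord1 adjE [in X in _ * X = _]Kx rmorphD rmorphM !rmorph_nat -Kx.
  by rewrite /reflection -xx !mxE.
have K0 k : (reflection k i0)^* = 3 / 5 * (k == i0)%:R + - (4 / 5) * (k == i1)%:R.
  rewrite KE !Kx eqxx (negbTE i01) !(rmorphB, rmorphM, rmorphD, fmorphV, rmorph_nat) /=.
  by field.
have K1 k : reflection k i1 = - (4 / 5) * (k == i0)%:R + - (3 / 5) * (k == i1)%:R.
  rewrite KE !Kx eqxx [i1 == i0]eq_sym (negbTE i01) mulr0n mulr1n. by field.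
have -> : W' i0 i1 = 3 / 5 * (- (4 / 5) * W i0 i0 + - (3 / 5) * W i0 i1) +
                   - (4 / 5) * (- (4 / 5) * W i1 i0 + - (3 / 5) * W i1 i1).
  rewrite /W' conj_entry; under eq_bigr do rewrite K0.
  rewrite sum_two_point; under eq_bigr do rewrite K1; rewrite sum_two_point.
  by under eq_bigr do rewrite K1; rewrite sum_two_point.
by field.
Qed.

End Reflection.
End Conjugates.

(** * Second moments of the entries of a Haar-random conjugate of Q *)

Section HaarMiddle.
Variables (R : realType) (d : nat).
Local Notation C := R[i].
Local Notation BM := (borel_mx R d).
Variable mu : probability BM R.
Hypothesis mu_haar : is_haar mu.
Local Notation Mean := (mean mu (@unitaries R d)).
Local Notation bounded := (bounded_rv (@unitaries R d)).
Variable Q : 'M[C]_d.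
Hypothesis Qu : Q \is unitarymx.

Definition conjq (V : BM) : 'M[C]_d := (V : 'M[C]_d) ^t* *m Q *m V.
Local Notation w := conjq.

Lemma bounded_conjq : bounded_mx (@unitaries R d) w.
Proof.
have Vb : bounded_mx (@unitaries R d) (id : BM -> 'M[C]_d) by exact: bounded_mx_id.
exact: bounded_mxM (bounded_mxM (bounded_mx_adj Vb) (bounded_mx_cst _ Q)) Vb.
Qed.

Let mU : measurable (@unitaries R d) := @measurable_unitaries R d.
Let U1 : mu (@unitaries R d) = 1%E := haar_unitaries mu_haar.

Lemma mean_conjq (K : 'M[C]_d) (G : 'M[C]_d -> R) : K \is unitarymx ->
  bounded (fun V => G (w V)) ->
  Mean (fun V => G (K ^t* *m w V *m K)) = Mean (fun V => G (w V)).
Proof.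
move=> Ku Gb; rewrite -(mean_mulmxr mu_haar Ku Gb).
by apply: eq_mean => V _; rewrite /conjq adjM !mulmxA.
Qed.

Lemma bounded_sqnorm_conjq i j : bounded (fun V => sqnorm (w V i j)).
Proof. by apply: bounded_rv_sqnorm; exact: bounded_conjq. Qed.

Lemma bounded_mul_conjq c i j k l : bounded (fun V => complex.Re (c * (w V i j * (w V k l)^*))).
Proof.
have [//] := bounded_cvM (bounded_cv_cst (@unitaries R d) c)
  (bounded_cvM (bounded_conjq i j) (bounded_cv_conj (bounded_conjq k l))).
Qed.

Lemma mean_perm_sqnorm (s : 'S_d) i j :
  Mean (fun V => sqnorm (w V (s i) (s j))) = Mean (fun V => sqnorm (w V i j)).
Proof.
rewrite -[RHS](mean_conjq (G := fun W => sqnorm (W i j)) (perm_unitary R s^-1)).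
  by apply: eq_mean => V _; rewrite perm_conj.
exact: bounded_sqnorm_conjq.
Qed.

Lemma mean_perm_mul (s : 'S_d) i j :
  Mean (fun V => complex.Re (1 * (w V (s i) (s i) * (w V (s j) (s j))^*))) =
  Mean (fun V => complex.Re (1 * (w V i i * (w V j j)^*))).
Proof.
rewrite -[RHS](mean_conjq (G := fun W => complex.Re (1 * (W i i * (W j j)^*))) (perm_unitary R s^-1)).
  by apply: eq_mean => V _; rewrite !perm_conj.
exact: bounded_mul_conjq.
Qed.

(** Conjugation by the sign flip at a suitable index l negates exactly one of the two entries, so
    the mean equals its opposite. The index is k if i = j, and j otherwise. *)
Lemma mean_cross c i j k : j != k ->
  Mean (fun V => complex.Re (c * (w V i j * (w V i k)^*))) = 0.
Proof.
move=> jk.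
suff [l h] : exists l, ((-1) ^+ (i == l) * (-1) ^+ (j == l) = - ((-1) ^+ (i == l) * (-1) ^+ (k == l)) :> C).
  apply/eqP; rewrite -[_ == 0](mulrn_eq0 _ 2) mulr2n addr_eq0; apply/eqP.
  set G := fun W : 'M[C]_d => complex.Re (c * (W i j * (W i k)^*)).
  rewrite -[LHS](mean_conjq (G := G) (flip_unitary R l)); last exact: bounded_mul_conjq.
  rewrite -[RHS]mulN1r -(meanZ mU U1); last exact: bounded_mul_conjq.
  apply: eq_mean => V _; rewrite /G !flip_conj h mulN1r -cReN; congr complex.Re.
  rewrite -[RHS]mulrN; congr (_ * _).
  have -> : (((-1) ^+ (i == l) * (-1) ^+ (k == l) * w V i k)^* : C) =
     ((-1) ^+ (i == l) * (-1) ^+ (k == l)) * (w V i k)^*.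
    by rewrite !rmorphM !rmorphXn rmorphN rmorph1.
  have hs : ((-1) ^+ (i == l) * (-1) ^+ (k == l)) * ((-1) ^+ (i == l) * (-1) ^+ (k == l)) = 1 :> C.
    by case: (i == l); case: (k == l); rewrite ?expr0 ?expr1; ring.
  transitivity (- (((-1) ^+ (i == l) * (-1) ^+ (k == l)) * ((-1) ^+ (i == l) * (-1) ^+ (k == l)) * (w V i j * (w V i k)^*)) : C).
    by ring.
  by rewrite hs mul1r.
have [ij|ij] := eqVneq i j.
  by exists k; rewrite ij eqxx (negbTE jk) !expr0 expr1; ring.
by exists j; rewrite eqxx (negbTE ij) eq_sym (negbTE jk) !expr0 expr1; ring.
Qed.

Hypothesis trQ : \tr Q = 0.
Variables i0 i1 : 'I_d.
Hypothesis i01 : i0 != i1.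

Let beta := Mean (fun V => sqnorm (w V i0 i1)).
Let alpha := Mean (fun V => sqnorm (w V i0 i0)).

Lemma conjq_unitary V : unitaries V -> w V \is unitarymx.
Proof.
move=> Vu; have {}Vu : (V : 'M[C]_d) \is unitarymx := Vu.
exact: (mul_unitarymx (mul_unitarymx (adj_unitary Vu) Qu) Vu).
Qed.

Lemma offdiag_mean j : j != i0 -> Mean (fun V => sqnorm (w V i0 j)) = beta.
Proof.
move=> j0; rewrite /beta -(mean_perm_sqnorm (tperm i1 j) i0 i1) tpermL tpermD //.
by rewrite eq_sym.
Qed.

Lemma mean_rows : alpha + (d.-1)%:R * beta = 1.
Proof.
rewrite -[RHS](mean_cst mU U1); transitivity (Mean (fun V => \sum_j sqnorm (w V i0 j))).
  rewrite (mean_sum mU U1) => [|j]; last exact: bounded_sqnorm_conjq.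
  rewrite (bigD1 i0) //=; congr (_ + _).
  under eq_bigr => j j0 do rewrite offdiag_mean //.
  by rewrite sumr_const mulr_natl; congr (_ *+ _); rewrite cardC1 card_ord.
apply: eq_mean => V Vu; exact: unitary_row_sqnorm (conjq_unitary Vu).
Qed.

Lemma beta_ge0 : 0 <= beta.
Proof. by apply: mean_ge0 => V _; exact: sqnorm_ge0. Qed.

Lemma alpha_ge0 : 0 <= alpha.
Proof. by apply: mean_ge0 => V _; exact: sqnorm_ge0. Qed.

Lemma sqnorm_mulC (z : C) : complex.Re (1 * (z * z^*)) = sqnorm z.
Proof. by case: z => a b; rewrite /sqnorm /=; ring. Qed.

(** The conjugate of Q is traceless like Q, so an entry of its diagonal is orthogonal to the sum of
    the diagonal. By symmetry alpha + (d - 1) g = 0, which makes g nonpositive. *)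
Lemma diag_corr : Mean (fun V => complex.Re (1 * (w V i0 i0 * (w V i1 i1)^*))) <= 0.
Proof.
set g := Mean _.
have gE j : j != i0 -> Mean (fun V => complex.Re (1 * (w V i0 i0 * (w V j j)^*))) = g.
  move=> j0; rewrite /g -(mean_perm_mul (tperm i1 j) i0 i1) tpermL tpermD //.
  by rewrite eq_sym.
have : alpha + (d.-1)%:R * g = 0.
  rewrite -[RHS](mean_cst mU U1).
  transitivity (Mean (fun V => \sum_j complex.Re (1 * (w V i0 i0 * (w V j j)^*)))).
    rewrite (mean_sum mU U1) => [|j]; last exact: bounded_mul_conjq.
    rewrite (bigD1 i0) //=; congr (_ + _).
      by apply: eq_mean => V _; rewrite sqnorm_mulC.
    under eq_bigr => j j0 do rewrite gE //.
    by rewrite sumr_const mulr_natl; congr (_ *+ _); rewrite cardC1 card_ord.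
  apply: eq_mean => V Vu; rewrite -Re_sum -!mulr_sumr -rmorph_sum -/(\tr (w V)).
  have -> : \tr (w V) = 0.
    rewrite /conjq mxtrace_mulC mulmxA; have /unitarymxP -> : (V : 'M[C]_d) \is unitarymx by [].
    by rewrite mul1mx.
  by rewrite rmorph0 !mulr0.
move=> h; have d1 : 0 < (d.-1)%:R :> R.
  rewrite ltr0n; have := ltn_ord i0; have := ltn_ord i1; move: i01; rewrite -val_eqE /=; lia.
by rewrite -(pmulr_rle0 g d1); have := alpha_ge0; lra.
Qed.

(** By [diag_corr], 2 alpha is at most the second moment of the difference of two diagonal entries,
    which [reflection_conj] writes with three off-diagonal ones. Since (x + y + z)^2 <= 3 (x^2 + y^2
    + z^2), this is at most 3 (625 + 81 + 256) / 144 = 962/48 times beta, just above 20 beta. *)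
Lemma alpha_le : alpha <= 11 * beta.
Proof.
pose W' V := (reflection R i0 i1) ^t* *m w V *m reflection R i0 i1.
have W'b : bounded (fun V => sqnorm (W' V i0 i1)).
  have h : bounded_mx (@unitaries R d) W'.
    exact: bounded_mxM (bounded_mxM (bounded_mx_cst _ _) bounded_conjq) (bounded_mx_cst _ _).
  by apply: bounded_rv_sqnorm; exact: h.
have W'm : Mean (fun V => sqnorm (W' V i0 i1)) = beta.
  exact: (mean_conjq (G := fun W => sqnorm (W i0 i1)) (reflection_unitary R i01)
    (bounded_sqnorm_conjq i0 i1)).
have m11 : Mean (fun V => sqnorm (w V i1 i1)) = alpha.
  by rewrite /alpha -(mean_perm_sqnorm (tperm i0 i1) i0 i0) tpermL.
have m10 : Mean (fun V => sqnorm (w V i1 i0)) = beta.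
  by rewrite /beta -(mean_perm_sqnorm (tperm i0 i1) i0 i1) tpermL tpermR.
have sb := bounded_sqnorm_conjq.
have : Mean (fun V => (sqnorm (w V i0 i0) + sqnorm (w V i1 i1)) +
     (-2) * complex.Re (1 * (w V i0 i0 * (w V i1 i1)^*))) <=
  Mean (fun V => (625 / 48) * sqnorm (W' V i0 i1) + ((81 / 48) * sqnorm (w V i0 i1) +
     (256 / 48) * sqnorm (w V i1 i0))).
  apply: (mean_le mU U1).
  - by apply: bounded_rvD; [exact: bounded_rvD|apply: bounded_rvZ; exact: bounded_mul_conjq].
  - exact: bounded_rvD (bounded_rvZ _ W'b) (bounded_rvD (bounded_rvZ _ (sb _ _)) (bounded_rvZ _ (sb _ _))).
  move=> V _; have := reflection_conj i01 (w V); rewrite /= -/(W' V).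
  move: (w V i0 i0) (w V i1 i1) (W' V i0 i1) (w V i0 i1) (w V i1 i0) => z00 z11 y z01 z10 h.
  have -> : sqnorm z00 + sqnorm z11 + -2 * complex.Re (1 * (z00 * z11^*)) = sqnorm (z00 - z11).
    by case: z00 z11 {h} => a b [a' b']; rewrite /sqnorm /=; ring.
  rewrite h; case: y z01 z10 {h} => a b [a1 b1] [a2 b2].
  have sq3 (x y z : R) : (x + y + z) ^+ 2 <= 3 * (x ^+ 2 + y ^+ 2 + z ^+ 2).
    by have := sqr_ge0 (x - y); have := sqr_ge0 (x - z); have := sqr_ge0 (y - z); nra.
  have := sq3 (- 25 / 12 * a) (- 9 / 12 * a1) (16 / 12 * a2).
  have := sq3 (- 25 / 12 * b) (- 9 / 12 * b1) (16 / 12 * b2).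
  have natC k : (k%:R +i* 0)%C = k%:R :> C by exact: (rmorph_nat (real_complex R) k).
  have -> : ((- 25 * (a +i* b) - 9 * (a1 +i* b1) + 16 * (a2 +i* b2)) / 12)%C =
     ((- 25 / 12 * a + - 9 / 12 * a1 + 16 / 12 * a2) +i* (- 25 / 12 * b + - 9 / 12 * b1 + 16 / 12 * b2))%C :> C.
    apply: (@mulIf _ 12); first by rewrite pnatr_eq0.
    rewrite divfK ?pnatr_eq0 // -!natC; apply/eqP; rewrite eq_complex /=.
    by apply/andP; split; apply/eqP; field.
  rewrite /sqnorm /=; lra.
have bz c i j := bounded_rvZ c (sb i j).
have bc := bounded_mul_conjq 1 i0 i0 i1 i1.
rewrite (meanD mU U1 (bounded_rvD (sb i0 i0) (sb i1 i1)) (bounded_rvZ (-2) bc)).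
rewrite (meanD mU U1 (sb i0 i0) (sb i1 i1)) (meanZ mU U1 (-2) bc).
rewrite (meanD mU U1 (bounded_rvZ (625 / 48) W'b) (bounded_rvD (bz _ i0 i1) (bz _ i1 i0))).
rewrite (meanD mU U1 (bz _ i0 i1) (bz _ i1 i0)).
rewrite (meanZ mU U1 _ W'b) (meanZ mU U1 _ (sb i0 i1)) (meanZ mU U1 _ (sb i1 i0)).
rewrite W'm m11 m10 -/beta -/alpha; have := diag_corr; have := beta_ge0; lra.
Qed.

(* Right invariance alone suffices: X^* turns the quantity into an entry of W Z,
   W = V^* Q V, and signs and transpositions reduce it to two second moments. *)
Lemma haar_middle X Y : X \is unitarymx -> Y \is unitarymx ->
  Mean (fun V => sqnorm (middle X Q Y V i0)) <= 11 / (d.-1)%:R.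
Proof.
move=> Xu Yu; pose Z := X ^t* *m Y.
have Zu : Z \is unitarymx by exact: mul_unitarymx (adj_unitary Xu) Yu.
have Vb : bounded_mx (@unitaries R d) (id : BM -> 'M[C]_d) by exact: bounded_mx_id.
have mb : bounded (fun V => sqnorm (middle X Q Y V i0)).
  apply: bounded_rv_sqnorm.
  exact: (bounded_mxM (bounded_mxM (bounded_mxM (bounded_mxM (bounded_mx_cst _ (X ^t*))
    (bounded_mx_adj Vb)) (bounded_mx_cst _ Q)) Vb) (bounded_mx_cst _ Y) i0 i0).
rewrite -(mean_mulmxr mu_haar (adj_unitary Xu) mb).
have sqE V : sqnorm (middle X Q Y (V *m X ^t*) i0) =
    \sum_j \sum_k complex.Re ((Z j i0 * (Z k i0)^*) * (w V i0 j * (w V i0 k)^*)).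
  have -> : middle X Q Y (V *m X ^t*) i0 = \sum_j w V i0 j * Z j i0.
    transitivity ((w V *m Z) i0 i0); last by rewrite mxE.
    congr (fun_of_matrix _ i0 i0); rewrite adjM trmxCK !mulmxA.
    have -> : X ^t* *m X = 1%:M by have /unitarymxP := adj_unitary Xu; rewrite trmxCK.
    by rewrite mul1mx.
  rewrite -sqnorm_mulC mul1r rmorph_sum /= mulr_suml Re_sum; apply: eq_bigr => j _.
  rewrite mulr_sumr Re_sum; apply: eq_bigr => k _.
  by rewrite rmorphM /=; congr complex.Re; ring.
have -> : Mean (fun V => sqnorm (middle X Q Y ((V : 'M[C]_d) *m X ^t*) i0)) = Mean (fun V => \sum_j \sum_k
    complex.Re ((Z j i0 * (Z k i0)^*) * (w V i0 j * (w V i0 k)^*))).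
  by apply: eq_mean => V _; exact: sqE.
rewrite (mean_sum mU U1) => [|j]; last by apply: bounded_rv_sum => k; exact: bounded_mul_conjq.
have -> : \sum_j Mean (fun V => \sum_k complex.Re ((Z j i0 * (Z k i0)^*) * (w V i0 j * (w V i0 k)^*))) =
    \sum_j sqnorm (Z j i0) * Mean (fun V => sqnorm (w V i0 j)).
  apply: eq_bigr => j _; rewrite (mean_sum mU U1) => [|k]; last exact: bounded_mul_conjq.
  rewrite (bigD1 j) //= [X in _ + X]big1 => [|k kj]; last by rewrite mean_cross // eq_sym.
  rewrite addr0 -(meanZ mU U1); last exact: bounded_sqnorm_conjq.
  apply: eq_mean => V _; case: (Z j i0) (w V i0 j) => a b [a' b']; rewrite /sqnorm /=; ring.
apply: (@le_trans _ _ (\sum_j sqnorm (Z j i0) * (11 * beta))).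
  apply: ler_sum => j _; apply: ler_wpM2l; first exact: sqnorm_ge0.
  have [->|/offdiag_mean ->] := eqVneq j i0; first exact: alpha_le.
  by have := beta_ge0; lra.
rewrite -mulr_suml (unitary_col_sqnorm i0 Zu) mul1r ler_wpM2l //.
have d1 : 0 < (d.-1)%:R :> R.
  rewrite ltr0n; have := ltn_ord i0; have := ltn_ord i1; move: i01; rewrite -val_eqE /=; lia.
rewrite -[leRHS]mul1r ler_pdivlMr // mulrC; have := mean_rows; have := alpha_ge0; lra.
Qed.

End HaarMiddle.

(** * Output distributions *)

Section Output.
Variables (R : realType) (n t : nat).
Local Notation C := R[i].
Variables K1 K2 : qcircuit R (n * t).
Local Notation cubeN := (cube 'I_(n * t)).

Definition final (U : 'M[C]_(2 ^ n)) := qcircuit_mx K2 *m oracle_mx t U *m qcircuit_mx K1.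

Definition prob (U : 'M[C]_(2 ^ n)) (x : cubeN) : R := sqnorm (ent (final U) x 0).

Lemma idx0 N : idx (0 : cube 'I_N) = of_qbits (fun=> false).
Proof. by congr of_qbits; apply/funext => i; rewrite ffunE. Qed.

Lemma mul_delta_adj N (M : 'M[C]_N) i j :
  (M *m delta_mx j j *m M ^t*) i i = M i j * (M i j)^*.
Proof.
rewrite mxE (bigD1 j) //= big1 ?addr0 => [|k kj].
  rewrite adjE; congr (_ * _); rewrite mxE (bigD1 j) //= big1 ?addr0 => [|l lj].
    by rewrite mxE !eqxx mulr1.
  by rewrite mxE (negbTE lj) mulr0.
by rewrite mxE big1 ?mul0r // => l _; rewrite mxE (negbTE kj) andbF mulr0.
Qed.

Lemma output_distE F U b : output_dist K1 K2 F U (zero_state R (n * t)) b =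
  \sum_(x : cubeN) prob U x * (ccircuit_eval F (input_bits x) == b)%:R.
Proof.
rewrite /output_dist /zero_state -idx0 big_mkcond sum_idx; apply: eq_bigr => x _.
rewrite (_ : [seq qbit (idx x) i | i <- enum 'I_(n * t)] = input_bits x); last first.
  by apply: eq_map => i; exact: qbit_of_qbits.
case: eqP => _; last by rewrite mulr0.
by rewrite mulr1 mul_delta_adj Re_mulC.
Qed.

Hypotheses (K1w : all (@qlayer_wf R (n * t)) K1) (K2w : all (@qlayer_wf R (n * t)) K2).

Lemma prob_ge0 U x : 0 <= prob U x.
Proof. exact: sqnorm_ge0. Qed.

Lemma prob_sum U : U \is unitarymx -> \sum_x prob U x = 1.
Proof.
move=> Uu; have Wu : final U \is unitarymx.
  exact: (mul_unitarymx (mul_unitarymx (qcircuit_mx_unitary K2w) (oracle_unitary t Uu)) (qcircuit_mx_unitary K1w)).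
by rewrite -(unitary_col_sqnorm (idx 0) Wu) sum_idx.
Qed.

Section Random.
Variables (dsp : measure_display) (T : measurableType dsp) (P : probability T R) (E : set T).
Hypotheses (mE : measurable E) (PE : P E = 1%E).
Variable U : T -> 'M[C]_(2 ^ n).
Hypotheses (Uu : forall w, E w -> U w \is unitarymx) (Ub : bounded_mx E U).

Lemma bounded_cv_prod (J : Type) (s : seq J) (F : J -> T -> C) :
  (forall j, bounded_cv E (F j)) -> bounded_cv E (fun w => \prod_(j <- s) F j w).
Proof.
move=> Fb; elim: s => [|j s IH].
  by apply: eq_bounded_cv (bounded_cv_cst E 1) => w; rewrite big_nil.
by apply: eq_bounded_cv (bounded_cvM (Fb j) IH) => w; rewrite big_cons.
Qed.

Lemma bounded_prob x : bounded_rv E (fun w => prob (U w) x).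
Proof.
have Ob : bounded_mx E (fun w => oracle_mx t (U w)).
  move=> i j; apply: (eq_bounded_cv (f := fun w => \prod_(k <- index_enum 'I_t)
      ent (U w) (sub (block n k) (bits i)) (sub (block n k) (bits j)))) => [w|].
    by rewrite -ent_oracle /ent !bitsK.
  by apply: bounded_cv_prod => k; exact: Ub.
apply: bounded_rv_sqnorm.
exact: (bounded_mxM (bounded_mxM (bounded_mx_cst _ _) Ob) (bounded_mx_cst _ _)).
Qed.

Definition mean_prob x := mean P E (fun w => prob (U w) x).

Lemma mean_prob_ge0 x : 0 <= mean_prob x.
Proof. by apply: mean_ge0 => w _; exact: prob_ge0. Qed.

Lemma expect_mean_prob G : expect mean_prob G = mean P E (fun w => \sum_x prob (U w) x * G x).
Proof.
rewrite (mean_sum mE PE) => [|x]; last exact: (bounded_rvM (bounded_prob x) (bounded_rv_cst E (G x))).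
apply: eq_bigr => x _; rewrite /mean_prob mulrC -(meanZ mE PE _ (bounded_prob x)).
by apply: eq_mean => w _; rewrite mulrC.
Qed.

Lemma mean_prob_sum : \sum_x mean_prob x = 1.
Proof.
transitivity (expect mean_prob (fun=> 1)); first by apply: eq_bigr => x _; rewrite /= mulr1.
rewrite expect_mean_prob -[RHS](mean_cst mE PE); apply: eq_mean => w Ew.
by rewrite -[RHS](prob_sum (Uu Ew)); apply: eq_bigr => x _; rewrite /= mulr1.
Qed.

Lemma mean_output_distE F b : mean_output_dist P U K1 K2 F (zero_state R (n * t)) b =
  expect mean_prob (fun x => (ccircuit_eval F (input_bits x) == b)%:R).
Proof.
rewrite /mean_output_dist expect_mean_prob.
rewrite (_ : (fun w => output_dist _ _ _ _ _ _) = fun w => \sum_x prob (U w) x *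
  (ccircuit_eval F (input_bits x) == b)%:R); last by apply/funext => w; rewrite output_distE.
apply: (Rintegral_setT mE PE); apply: bounded_rv_sum => x.
exact: (bounded_rvM (bounded_prob x) (bounded_rv_cst E _)).
Qed.

Hypothesis n0 : (0 < n)%N.
Hypothesis K1l : geom_local_1d K1.
Variable lam : R.
Hypothesis lam0 : 0 < lam.
Hypothesis second_moment : forall X Q Y, X \is unitarymx -> Q \is unitarymx ->
  \tr Q = 0 -> Y \is unitarymx ->
  mean P E (fun w => sqnorm (middle X Q Y (U w) (idx 0))) <= lam ^+ 2.

Lemma chi_real S (x : cubeN) : chi C S x = real_complex R (chi R S x).
Proof. by rewrite /chi rmorph_prod; apply: eq_bigr => i _; rewrite rmorphXn rmorphN rmorph1. Qed.

Lemma Re_norm_real (r : R) : complex.Re `|real_complex R r| = `|r|.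
Proof. by rewrite norm_sqrt_sqnorm /sqnorm /= expr0n addr0 sqrtr_sqr. Qed.

(** The pointwise bound of [bias_expansion] is linear in the moduli, while the design controls their
    squares; lam is the common root mean square bound. *)
Lemma mean_bias S : S != 0 ->
  `|expect mean_prob (chi R S)| <= 4 ^+ (2 ^ size K2 * wt S) * 256 ^+ size K1 ^+ 2 * lam.
Proof.
move=> S0; have [s [sP sW] sB] := bias_expansion n0 K1w K1l K2w S0.
pose k (e : C * 'M[C]_(2 ^ n) * 'M[C]_(2 ^ n) * 'M[C]_(2 ^ n)) := complex.Re e.1.1.1.
have k0 e : e \in s -> 0 <= k e.
  by move=> /sP[+ _ _ _ _]; rewrite /k; case: (e.1.1.1) => a b; rewrite lecE /= => /andP[].
have sand e w : sandwich e (U w) = middle e.1.1.2 e.1.2 e.2 (U w) (idx 0) by [].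
have mb e : bounded_rv E (fun w => sqnorm (sandwich e (U w))).
  apply: bounded_rv_sqnorm.
  exact: (bounded_mxM (bounded_mxM (bounded_mxM (bounded_mxM (bounded_mx_cst _ _)
    (bounded_mx_adj Ub)) (bounded_mx_cst _ _)) Ub) (bounded_mx_cst _ _) (idx 0) (idx 0)).
(* AM-GM: r <= r^2 / (2 lam) + lam / 2, with mean at most lam when the mean of r^2 is at most
   lam^2. *)
pose g e w := k e * ((2 * lam)^-1 * sqnorm (sandwich e (U w)) + lam / 2).
have gb e : bounded_rv E (g e).
  exact: (bounded_rvZ _ (bounded_rvD (bounded_rvZ _ (mb e)) (bounded_rv_cst _ _))).
have fb : bounded_rv E (fun w => \sum_x prob (U w) x * chi R S x).
  by apply: bounded_rv_sum => x; exact: (bounded_rvM (bounded_prob x) (bounded_rv_cst E _)).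
rewrite expect_mean_prob; apply: le_trans (mean_norm mE PE fb) _.
apply: (@le_trans _ _ (mean P E (fun w => \sum_(e <- s) g e w))).
  apply: (mean_le mE PE); last 1 first.
  - move=> w Ew; have := sB _ (Uu Ew); rewrite -/(final (U w)).
    have -> : \sum_x chi C S x * `|ent (final (U w)) x 0| ^+ 2 =
       real_complex R (\sum_x prob (U w) x * chi R S x).
      rewrite rmorph_sum; apply: eq_bigr => x _.
      by rewrite norm_sqnorm chi_real [RHS]rmorphM mulrC.
    rewrite lecE => /andP[_]; rewrite Re_norm_real => /le_trans; apply.
    rewrite Re_sum big_seq [leRHS]big_seq; apply: ler_sum => e es.
    rewrite norm_sqrt_sqnorm cReM /= mulr0 subr0; apply: ler_wpM2l; first exact: k0.
    set r := Num.sqrt _; have <- : r ^+ 2 = sqnorm (sandwich e (U w)) by rewrite sqr_sqrtr ?sqnorm_ge0.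
    have : 0 <= (2 * lam)^-1 * (r - lam) ^+ 2 by rewrite mulr_ge0 ?sqr_ge0 // invr_ge0 mulr_ge0 // ltW.
    have -> : (2 * lam)^-1 * (r - lam) ^+ 2 = (2 * lam)^-1 * r ^+ 2 + lam / 2 - r.
      by field; rewrite gt_eqF.
    by rewrite subr_ge0.
  - have [mf [M fM]] := fb; split; first exact: measurableT_comp.
    by exists M => w Ew; rewrite normr_id; exact: fM.
  - by apply: bounded_rv_sum.
rewrite (mean_sum mE PE) //; apply: (@le_trans _ _ (\sum_(e <- s) k e * lam)).
  rewrite big_seq [leRHS]big_seq; apply: ler_sum => e es.
  have b1 := bounded_rvZ (2 * lam)^-1 (mb e).
  rewrite /g (meanZ mE PE _ (bounded_rvD b1 (bounded_rv_cst _ _))) (meanD mE PE b1 (bounded_rv_cst _ _)).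
  rewrite (meanZ mE PE _ (mb e)) (mean_cst mE PE); apply: ler_wpM2l; first exact: k0.
  have [_ Xu Qu tQ Yu] := sP e es.
  have h := second_moment Xu Qu tQ Yu.
  have l0 : 0 <= (2 * lam)^-1 by rewrite invr_ge0 mulr_ge0 // ltW.
  have := ler_wpM2l l0 h; have -> : (2 * lam)^-1 * lam ^+ 2 = lam / 2 by field; rewrite gt_eqF.
  move=> {}h; have := lerD h (lexx (lam / 2)); rewrite -splitr; exact.
rewrite -mulr_suml ler_pM2r // -Re_sum; move: sW; rewrite lecE => /andP[_] /le_trans; apply.
have -> : 4 ^+ (2 ^ size K2 * wt S) * 256 ^+ size K1 ^+ 2 =
   real_complex R (4 ^+ (2 ^ size K2 * wt S) * 256 ^+ size K1 ^+ 2).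
  by rewrite rmorphM !rmorphXn !rmorph_nat.
exact: lexx.
Qed.

End Random.
End Output.

(** * The distance at a single n *)

Section FixedSize.
Variables (R : realType) (n t : nat).
Local Notation C := R[i].
Variables K1 K2 : qcircuit R (n * t).
Hypotheses (K1w : all (@qlayer_wf R (n * t)) K1) (K2w : all (@qlayer_wf R (n * t)) K2).
Hypotheses (n0 : (0 < n)%N) (K1l : geom_local_1d K1).
Variable haar : probability (borel_mx R (2 ^ n)) R.
Hypothesis haarP : is_haar haar.

Lemma haar_second_moment (X Q Y : 'M[C]_(2 ^ n)) : X \is unitarymx -> Q \is unitarymx ->
  \tr Q = 0 -> Y \is unitarymx ->
  mean haar (@unitaries R (2 ^ n)) (fun V => sqnorm (middle X Q Y V (idx 0))) <=
  11 / (2 ^ n).-1%:R.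
Proof.
move=> Xu Qu trQ Yu.
have i01 : idx 0 != idx (single (Ordinal n0)).
  rewrite (can_eq (@idxK n)); apply/eqP => /ffunP/(_ (Ordinal n0)).
  by rewrite !ffunE eqxx.
exact: (haar_middle haarP Qu trQ i01 Xu Yu).
Qed.

Variables (P : probability nat R) (U : nat -> 'M[C]_(2 ^ n)).
Hypothesis Uu : forall k, U k \is unitarymx.
Variable eps : R.
Hypothesis design : approx_2design eps P U haar.

Lemma discrete_bounded : bounded_mx (@setT nat) U.
Proof. by apply: bounded_mx_unitary => [w _|i j]; [exact: Uu|split]. Qed.

(** Both output distributions are compared with uniform bits, whence the factor 2. The fooling
    theorem enters as a hypothesis already specialized to these qubits. *)
Lemma tv_dist_le (d a B : nat) (F : ccircuit) (lam : R) :
  (forall (mu : cube 'I_(n * t) -> R) (f : cube 'I_(n * t) -> bool),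
    (forall x, 0 <= mu x) -> \sum_x mu x = 1 ->
    (forall S, (0 < wt S <= a ^ B)%N -> `|expect mu (chi R S)| <= 2^-1 ^+ (a ^ B)) ->
    AC d (2 ^ a) f ->
    `|expect mu (fun x => (f x)%:R) - avg (fun x => (f x)%:R)| <= 2^-1 ^+ a) ->
  (size (clayers F) <= d)%N -> (n * t + size (flatten (clayers F)) < 2 ^ a)%N ->
  0 < lam -> 0 <= eps -> eps + 11 / (2 ^ n).-1%:R <= lam ^+ 2 ->
  4 ^+ (2 ^ size K2 * a ^ B) * 256 ^+ size K1 ^+ 2 * lam <= 2^-1 ^+ (a ^ B) ->
  tv_dist (mean_output_dist P U K1 K2 F (zero_state R (n * t)))
          (mean_output_dist haar id K1 K2 F (zero_state R (n * t))) <= 2 * 2^-1 ^+ a.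
Proof.
move=> fooled Fd Fa lam0 eps0 lamP lamB.
have Ib := @bounded_mx_id R (2 ^ n) _ (fun x h => h).
have mU := @measurable_unitaries R (2 ^ n); have U1 := haar_unitaries haarP.
have Db := discrete_bounded.
have mT : measurable (@setT nat) by [].
have P1 : P setT = 1%E by exact: probability_setT.
have haar2 X Q Y : X \is unitarymx -> Q \is unitarymx -> \tr Q = 0 -> Y \is unitarymx ->
    mean haar (@unitaries R (2 ^ n)) (fun V => sqnorm (middle X Q Y V (idx 0))) <= lam ^+ 2.
  move=> Xu Qu tQ Yu; apply: le_trans (haar_second_moment Xu Qu tQ Yu) (le_trans _ lamP).
  by rewrite lerDr.
have des2 X Q Y : X \is unitarymx -> Q \is unitarymx -> \tr Q = 0 -> Y \is unitarymx ->
    mean P setT (fun k => sqnorm (middle X Q Y (U k) (idx 0))) <= lam ^+ 2.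
  move=> Xu Qu tQ Yu; apply: le_trans lamP.
  apply: le_trans (design_second_moment (idx 0) mT P1 Db mU U1 Ib design Xu Qu Yu) _.
  exact: lerD (lexx eps) (haar_second_moment Xu Qu tQ Yu).
have mono (x y w l : R) : x <= y -> 0 <= w -> 0 <= l -> x * w * l <= y * w * l.
  by move=> xy w0 l0; do 2!apply: ler_wpM2r => //.
have small (x : R) (S : cube 'I_(n * t)) : (0 < wt S <= a ^ B)%N ->
    (S != 0 -> x <= 4 ^+ (2 ^ size K2 * wt S) * 256 ^+ size K1 ^+ 2 * lam) ->
    x <= 2^-1 ^+ (a ^ B).
  move=> /andP[S0 SB] h; apply: le_trans (h _) (le_trans _ lamB); first by rewrite -wt_gt0.
  have W0 : 0 <= 256 ^+ size K1 ^+ 2 :> R by do 2!apply: exprn_ge0; exact: ler0n.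
  apply: mono W0 (ltW lam0); apply: ler_weXn2l; first by rewrite ler1n.
  by rewrite leq_mul2l SB orbT.
have acF b : AC d (2 ^ a) (fun x : cube 'I_(n * t) => ccircuit_eval F (input_bits x) == b :> bool).
  have FA := ACW (leq_ltn_trans (leq0n _) Fa) Fd (AC_ccircuit Fa).
  apply: (@eq_AC _ _ _ (fun x => ~~ b (+) ccircuit_eval F (input_bits x))) => [x|].
    by case: b (ccircuit_eval _ _) => [] [].
  exact: AC_neg FA.
have dist b : `|mean_output_dist P U K1 K2 F (zero_state R (n * t)) b -
    mean_output_dist haar id K1 K2 F (zero_state R (n * t)) b| <= 2 * 2^-1 ^+ a.
  rewrite (mean_output_distE K1 K2 mT P1 Db) (mean_output_distE K1 K2 mU U1 Ib).
  have h1 := fooled _ _ (mean_prob_ge0 K1 K2 P setT U)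
    (mean_prob_sum K1w K2w mT P1 (fun k _ => Uu k) Db) (fun S SB => small _ S SB
      (fun s0 => mean_bias K1w K2w mT P1 (fun k _ => Uu k) Db n0 K1l lam0 des2 s0)) (acF b).
  have h2 := fooled _ _ (mean_prob_ge0 K1 K2 haar _ id)
    (mean_prob_sum K1w K2w mU U1 (fun V h => h) Ib) (fun S SB => small _ S SB
      (fun s0 => mean_bias K1w K2w mU U1 (fun V h => h) Ib n0 K1l lam0 haar2 s0)) (acF b).
  rewrite distrC in h2; move: h1 h2; set x := expect _ _; set y := expect _ _; set z := avg _.
  move=> h1 h2; have -> : x - y = (x - z) + (z - y) by ring.
  apply: le_trans (ler_normD _ _) _; rewrite mulr_natl mulr2n; exact: lerD.
rewrite /tv_dist; apply: le_trans (_ : 2^-1 * \sum_(b : bool) (2 * 2^-1 ^+ a) <= _).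
  by apply: ler_wpM2l; [rewrite invr_ge0|apply: ler_sum => b _; exact: dist].
by rewrite big_bool /=; lra.
Qed.

End FixedSize.

(** * Asymptotics *)

Lemma leq_sqr_exp2 s : (4 <= s)%N -> (s * s <= 2 ^ s)%N.
Proof.
elim: s => [//|s IH]; rewrite leq_eqVlt => /predU1P[<- //|s4].
by rewrite expnS; have := IH s4; nia.
Qed.

Lemma leq_exp_exp2 m : exists L, forall l, (L <= l)%N -> (l ^ m <= 2 ^ l)%N.
Proof.
exists (2 ^ (2 * m + 4))%N => l lL; set s := trunc_log 2 l.
have l0 : (0 < l)%N by apply: leq_trans lL; rewrite expn_gt0.
have ms : (2 * m + 4 <= s)%N by exact: trunc_log_max.
have sl : (2 ^ s <= l)%N by exact: trunc_logP.
have ls : (l < 2 ^ s.+1)%N by exact: trunc_log_ltn.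
apply: leq_trans (_ : 2 ^ (s.+1 * m) <= _)%N.
  by rewrite expnM; case: (m) => [//|m']; rewrite leq_exp2r // ltnW.
rewrite leq_exp2l //; apply: leq_trans sl; apply: leq_trans (leq_sqr_exp2 _); last by lia.
nia.
Qed.

(** The exponent h is forced to be - ln |f n| / ln n; being eventually below each n^-k says that it
    diverges. Where f vanishes any divergent value will do, and n is taken. *)
Lemma negligible_inv_poly (R : realType) (f : nat -> R) :
  (forall k : nat, exists N : nat, forall n, (N <= n)%N -> `|f n| <= n%:R^-1 ^+ k) ->
  negligible_fun f.
Proof.
move=> fk.
exists (fun n => if f n == 0 then n%:R else - ln `|f n| / ln n%:R); last first.
  exists 2%N => // n /= n2; have n1 : 1 < n%:R :> R by rewrite ltr1n.
  case: eqP => [->|/eqP f0]; first by rewrite normr0 powR_ge0.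
  have lnn : ln n%:R != 0 :> R by rewrite gt_eqF // ln_gt0.
  have nz : n%:R != 0 :> R by rewrite gt_eqF // (lt_trans ltr01).
  rewrite /powR (negbTE nz) mulNr divfK // opprK lnK //.
  by rewrite posrE normr_gt0.
apply/cvgryPge => A; set k := (Num.truncn `|A|).+1.
have Ak : A <= k%:R by apply: le_trans (ler_norm A) (ltW (truncnS_gt _)).
have [N HN] := fk k; exists (maxn N (maxn 2 k)) => // n /=.
rewrite !geq_max => /and3P[Nn n2 kn]; case: eqP => [_|/eqP f0].
  by apply: le_trans Ak _; rewrite ler_nat.
have n1 : 1 < n%:R :> R by rewrite ltr1n.
have n0 : 0 < n%:R :> R by rewrite (lt_trans ltr01).
apply: le_trans Ak _; rewrite ler_pdivlMr ?ln_gt0 // lerNr.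
have -> : - (k%:R * ln n%:R) = ln (n%:R^-1 ^+ k) :> R.
  by rewrite lnXn ?invr_gt0 // lnV ?posrE // mulNrn mulr_natl.
by rewrite ler_ln ?posrE ?normr_gt0 ?exprn_gt0 ?invr_gt0 //; exact: HN.
Qed.

Lemma log2_ge_trunc (R : realType) n : (0 < n)%N -> (trunc_log 2 n)%:R <= log2 n%:R :> R.
Proof.
move=> n0; rewrite /log2 ler_pdivlMr ?ln_gt0 ?ltr1n // mulr_natl -lnXn //.
by rewrite ler_ln ?posrE ?exprn_gt0 ?ltr0n // -natrX ler_nat trunc_logP.
Qed.

Lemma superquasipoly_small (R : realType) (x g : R) (l m q : nat) :
  (0 < l)%N -> l%:R <= x -> m%:R <= g -> (q <= l ^ m)%N ->
  2 `^ (- (x `^ g)) <= 2^-1 ^+ q.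
Proof.
move=> l0 lx mg qm; have l1 : 1 <= l%:R :> R by rewrite ler1n.
have x1 := le_trans l1 lx.
have h : q%:R <= x `^ g.
  apply: le_trans (_ : l%:R `^ m%:R <= _); first by rewrite powR_mulrn ?ler0n // -natrX ler_nat.
  apply: le_trans (_ : x `^ m%:R <= _); first by rewrite ge0_ler_powR ?nnegrE ?ler0n // (le_trans ler01).
  by rewrite ler_powR.
have -> : 2^-1 ^+ q = 2 `^ (- q%:R) :> R by rewrite powRN powR_mulrn // exprVn.
by rewrite ler_powR ?ler1n // lerN2.
Qed.

(** With 4 = 2^2 and 256^2 = 2^16, the weight of the expansion is 2^(2 * 2^s2 * M + 16 * s1), which
    the second part of the exponent of lam cancels. *)
Lemma weight_le (R : realType) (s1 s2 d1 d2 M : nat) : (s1 <= d1)%N -> (s2 <= d2)%N ->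
  4 ^+ (2 ^ s2 * M) * 256 ^+ s1 ^+ 2 * 2^-1 ^+ (M + (2 * 2 ^ d2 * M + 16 * d1)) <=
  2^-1 ^+ M :> R.
Proof.
move=> s1d s2d; set e := (2 * 2 ^ d2 * M + 16 * d1)%N.
have -> : 4 ^+ (2 ^ s2 * M) * 256 ^+ s1 ^+ 2 = 2 ^+ (2 * 2 ^ s2 * M + 16 * s1) :> R.
  have -> : 4 = 2 ^+ 2 :> R by rewrite -natrX.
  have -> : 256 = 2 ^+ 8 :> R by rewrite -natrX.
  by rewrite -!exprM -exprD; congr (_ ^+ _); lia.
rewrite [2^-1 ^+ (M + e)]exprD mulrCA -[leRHS]mulr1; apply: ler_wpM2l; first by rewrite exprn_ge0 // invr_ge0.
rewrite exprVn ler_pdivrMr ?exprn_gt0 // mul1r; apply: ler_weXn2l; first by rewrite ler1n.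
rewrite /e leq_add // ?leq_mul2l ?s1d ?orbT // leq_mul2r leq_mul2l leq_exp2l // s2d !orbT //.
Qed.

(** The slack 6 makes 2^n - 1 at least 32 * 2^(2q), and 1/64 + 11/32 < 1. *)
Lemma second_moment_small (R : realType) (n q : nat) : (2 * q + 6 <= n)%N ->
  2^-1 ^+ (2 * q + 6) + 11 / (2 ^ n).-1%:R <= (2^-1 ^+ q) ^+ 2 :> R.
Proof.
move=> nq; rewrite -exprM (mulnC q 2) exprD; set x := 2^-1 ^+ (2 * q).
have x0 : 0 < x by rewrite exprn_gt0 // invr_gt0.
have h : (2 ^ (2 * q) * 32 <= (2 ^ n).-1)%N.
  have : (2 ^ (2 * q + 6) <= 2 ^ n)%N by rewrite leq_exp2l.
  rewrite expnD (_ : 2 ^ 6 = 64)%N //; have : (0 < 2 ^ (2 * q))%N by rewrite expn_gt0.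
  lia.
have h2 : 11 / (2 ^ n).-1%:R <= 11 / 32 * x.
  have xE : x = ((2 ^ (2 * q))%:R)^-1 by rewrite natrX /x exprVn.
  rewrite xE -mulrA -invfM -natrM ler_wpM2l // lef_pV2 ?posrE ?ltr0n; last 2 first.
  - by apply: leq_trans h; rewrite muln_gt0 expn_gt0.
  - by rewrite muln_gt0 expn_gt0.
  by rewrite ler_nat mulnC.
have h3 : x * 2^-1 ^+ 6 = x / 64 by congr (_ * _); rewrite exprVn -natrX.
rewrite h3; lra.
Qed.

(** One exponent for two purposes: 2^a exceeds the number of wires, and 2 * 2^-a is at most n^-k. *)
Lemma poly_bounds (c cF k l n t gates : nat) : (0 < n)%N -> (n < 2 ^ l.+1)%N ->
  (t <= n ^ c)%N -> (gates <= n ^ cF)%N ->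
  (n * t + gates < 2 ^ ((c + cF + k + 4) * l.+1))%N /\
  (2 * n ^ k <= 2 ^ ((c + cF + k + 4) * l.+1))%N.
Proof.
move=> n0 nl tn gn; set s := l.+1.
have nX j : (n ^ j <= 2 ^ (j * s))%N.
  by rewrite mulnC expnM; case: j => [//|j]; rewrite leq_exp2r // ltnW.
have b j : (j * s + s <= (c + cF + k + 4) * s)%N -> (2 * 2 ^ (j * s) <= 2 ^ ((c + cF + k + 4) * s))%N.
  move=> h; rewrite -expnS leq_exp2l //; apply: leq_trans h; rewrite /s; lia.
split; last first.
  apply: leq_trans (b k _); first by rewrite leq_mul2l nX orbT.
  by rewrite /s; nia.
apply: leq_ltn_trans (_ : 2 * 2 ^ ((c + cF + 1) * s) < _)%N.
  rewrite mul2n -addnn leq_add //.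
    apply: leq_trans (_ : n ^ (c + 1) <= _)%N; first by rewrite addn1 expnS leq_mul2l tn orbT.
    by apply: leq_trans (nX _) _; rewrite leq_exp2l // leq_mul2r; lia.
  apply: leq_trans gn (leq_trans (nX _) _).
  by rewrite leq_exp2l // leq_mul2r; lia.
rewrite -expnS ltn_exp2l // /s; nia.
Qed.

(** The exponent is O(l^B), with constants depending on the depths and on k; one more factor l
    absorbs them once l is large, hence B.+1. *)
Lemma exponent_bound (A B d1 d2 l M : nat) : M = ((A * l.+1) ^ B)%N -> (0 < l)%N ->
  ((2 * A) ^ B * (2 + 4 * 2 ^ d2) + 32 * d1 + 6 <= l)%N ->
  (2 * (M + (2 * 2 ^ d2 * M + 16 * d1)) + 6 <= l ^ B.+1)%N.
Proof.
move=> ME l0 Kl.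
have MB : (M <= (2 * A) ^ B * l ^ B)%N.
  rewrite -expnMn ME; case: (B) => [//|B']; rewrite leq_exp2r //; nia.
have lB : (0 < l ^ B)%N by rewrite expn_gt0 l0.
rewrite expnS; apply: leq_trans (_ : ((2 * A) ^ B * (2 + 4 * 2 ^ d2) + 32 * d1 + 6) * l ^ B <= _)%N;
  last by rewrite leq_mul2r Kl orbT.
set y := ((2 * A) ^ B)%N in MB *; set z := (l ^ B)%N in MB lB *; set p := (2 ^ d2)%N.
have h1 : ((2 + 4 * p) * M <= (2 + 4 * p) * (y * z))%N by rewrite leq_mul2l MB orbT.
have h2 : (32 * d1 + 6 <= (32 * d1 + 6) * z)%N by rewrite leq_pmulr.
nia.
Qed.
Local Open Scope complex_scope.

Theorem theorem4p7 (R : realType)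
    (haar : forall n : nat, probability (borel_mx R (2 ^ n)) R)
    (haarP : forall n : nat, is_haar (haar n))
    (P : nat -> probability nat R)
    (U : forall n : nat, nat -> 'M[R[i]]_(2 ^ n))
    (U_unitary : forall n k : nat, U n k \is unitarymx)
    (eps : nat -> R)
    (eps_small : inv_superquasipoly eps)
    (U_2design : forall n : nat, approx_2design (eps n) (P n) (U n) (haar n))
    (t : nat -> nat)
    (t_poly : poly_bounded t)
    (C1 C2 : forall n : nat, qcircuit R (n * t n))
    (F : nat -> ccircuit)
    (C1_QNC0 : is_QNC0 C1)
    (C1_local : forall n : nat, geom_local_1d (C1 n))
    (C2_QNC0 : is_QNC0 C2)
    (F_AC0 : is_AC0 F) :
  negligible_fun (fun n : nat =>
    tv_dist
      (mean_output_dist (P n) (U n) (C1 n) (C2 n) (F n)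
         (zero_state R (n * t n)))
      (mean_output_dist (haar n) id (C1 n) (C2 n) (F n)
         (zero_state R (n * t n)))).
Proof.
apply: negligible_inv_poly => k.
have [c [Nt _ tP]] := t_poly.
have [_ [d1 sz1] _] := C1_QNC0; have [_ [d2 sz2] _] := C2_QNC0.
have [K1w _ _] := C1_QNC0; have [K2w _ _] := C2_QNC0.
have [[d szF] [cF [NF _ FP]]] := F_AC0.
have [B fooled] := AC_fooled d.
have [g /cvgryPge/(_ B.+1%:R)[Ng _ gP] [Ne _ eP]] := eps_small.
have [L LP] := leq_exp_exp2 B.+1.
set A := (c + cF + k + 4)%N.
set K := ((2 * A) ^ B * (2 + 4 * 2 ^ d2) + 32 * d1 + 6)%N.
(* The first bound makes l = floor(log2 n) exceed L and K, so that the required accuracy is at most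
   l^B.+1 bits and this is at most 2^l <= n. *)
exists (maxn (2 ^ (maxn L K).+1) (maxn (maxn Nt NF) (maxn Ng Ne))) => n.
rewrite !geq_max => /and3P[nL /andP[nNt nNF] /andP[nNg nNe]].
have n0 : (0 < n)%N by apply: leq_trans nL; rewrite expn_gt0.
set l := trunc_log 2 n.
have lL : (maxn L K < l)%N by exact: trunc_log_max.
move: lL; rewrite gtn_max => /andP[Ll Kl].
have l0 : (0 < l)%N by apply: leq_ltn_trans Kl.
have nl : (2 ^ l <= n < 2 ^ l.+1)%N by rewrite trunc_logP // trunc_log_ltn.
case/andP: nl => ln nl.
have [size_lt tv_le] := poly_bounds k n0 nl (tP n nNt) (FP n nNF).
set a := (A * l.+1)%N in size_lt tv_le *.
(* M is both the weight of the parities and the number of bits of bias that [AC_fooled] asks for;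
   lam will be 2^-q. *)
set M := (a ^ B)%N; set q := (M + (2 * 2 ^ d2 * M + 16 * d1))%N.
have ql : (2 * q + 6 <= l ^ B.+1)%N by exact: exponent_bound erefl l0 (ltnW Kl).
have qn : (2 * q + 6 <= n)%N by apply: leq_trans ql (leq_trans (LP l (ltnW Ll)) ln).
have eps_le : eps n <= 2^-1 ^+ (2 * q + 6).
  apply: le_trans (eP n nNe) (superquasipoly_small l0 (log2_ge_trunc R n0) (gP n nNg) ql).
(* The error is relaxed to a power of 2 that is visibly nonnegative and fits
   [second_moment_small]. *)
have design : approx_2design (2^-1 ^+ (2 * q + 6)) (P n) (U n) (haar n).
  by move=> rho rho1; apply: le_trans (U_2design n rho rho1) eps_le.
have a1 : (1 < a)%N by rewrite /a /A; nia.
have h2 : 0 < 2^-1 :> R by rewrite invr_gt0.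
have card_le : (#|'I_(n * t n)| <= 2 ^ a)%N.
  by rewrite card_ord; apply: leq_trans (leq_addr _ _) (ltnW size_lt).
have := tv_dist_le (B := B) (K1w n) (K2w n) n0 (C1_local n) (haarP n) (U_unitary n) design
  (fun mu f => fooled R _ a mu f a1 card_le) (szF n) size_lt (exprn_gt0 q h2)
  (exprn_ge0 _ (ltW h2)) (second_moment_small R qn) (weight_le R M (sz1 n) (sz2 n)).
set tv := tv_dist _ _ => tvP.
have tv0 : 0 <= tv by rewrite /tv /tv_dist mulr_ge0 ?invr_ge0 // sumr_ge0.
rewrite ger0_norm //; apply: le_trans tvP _.
rewrite !exprVn ler_pdivrMr ?exprn_gt0 // ler_pdivlMl ?exprn_gt0 ?ltr0n // mulrC.
by rewrite -!natrX -natrM ler_nat.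
Qed.
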